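(* Let $p,n\in\mathbb N$, $m\in\mathbb Z$, $\alpha\in\mathbb R$, $\beta>0$ with $\alpha+p\beta>0$, $-1\le B<A\le1$, $\kappa=(1-A)/(1-B)$, $0<\mu<1$ and $0<\gamma\le1$. If $f\in\mathcal A_p(n)$ satisfies $$\frac{\Theta_p^m(n;\alpha,\beta)f(z)}{z^p}\prec\left(\frac{1+Az}{1+Bz}\right)^{\gamma}\quad(z\in\mathbb U),$$ then $$\operatorname{Re}\left\{(1-\mu)\left(\frac{\Theta_p^m(n;\alpha,\beta)f(z)}{z^p}\right)^{1/\gamma}+\mu\frac{\Theta_p^{m+1}(n;\alpha,\beta)f(z)}{\Theta_p^m(n;\alpha,\beta)f(z)}\right\}>\mu+(1-\mu)\kappa\quad\text{for }|z|<R,$$ where $R=R(p,n,\mu,\alpha,\beta,\gamma,\kappa)$ is the smallest positive root of the equation $$(1-\mu)(\alpha+p\beta)(1-2\kappa)r^{2n}-2\{(1-\mu)(\alpha+p\beta)(1-\kappa)+n\mu\beta\gamma\}r^n+(1-\mu)(\alpha+p\beta)=0.$$ The result is the best possible for the function $f\in\mathcal A_p(n)$ defined by $$\left(\frac{\Theta_p^m(n;\alpha,\beta)f(z)}{z^p}\right)^{1/n}=\left(\frac{1+(1-2\kappa)z^n}{1-z^n}\right)^{\gamma}\quad(z\in\mathbb U).$$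
   Context: $\mathbb U=\{z\in\mathbb C:|z|<1\}$. $\mathcal A_p(n)$ is the class of functions $f(z)=z^p+\sum_{k\ge p+n}a_kz^k$ which are analytic and $p$-valent in $\mathbb U$. For $m\in\mathbb Z$ the linear operator $\Theta_p^m(n;\alpha,\beta)$ on $\mathcal A_p(n)$ is $$\Theta_p^m(n;\alpha,\beta)f(z)=z^p+\sum_{k=p+n}^\infty\left(\frac{\alpha+k\beta}{\alpha+p\beta}\right)^m a_kz^k .$$ For functions $F,G$ analytic in $\mathbb U$, $F\prec G$ means $F=G\circ w$ for some analytic $w:\mathbb U\to\mathbb U$ with $w(0)=0$. Powers are principal values (the analytic branch equal to $1$ at $z=0$).
   Formalization: The extremal f is only claimed analytic and normalized, as it need not be p-valent; the bound up to R and subordination (to A=1-2κ, B=-1) are for Θf/z^p=((1+(1-2κ)z^n)/(1-z^n))^γ; for the printed 1/n equation only failure beyond R is stated. *)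

(* Defs.v *)
From Stdlib Require Export Reals ZArith List ClassicalEpsilon.
From Coquelicot Require Export Coquelicot.
Open Scope R_scope.

Definition in_disc (z : C) : Prop := Cmod z < 1.

Definition analytic (f : C -> C) : Prop :=
  forall z, in_disc z -> @ex_derive C_AbsRing C_NormedModule f z.

(* f takes no value more than p times and some value exactly p times.  Roots
   are listed without repetition; for non-constant analytic functions counting
   them with multiplicity gives the same notion, since a root of multiplicity k
   splits into k distinct roots for nearby values. *)
Definition p_valent (p : nat) (f : C -> C) : Prop :=
  (forall (w : C) (l : list C), NoDup l ->
     (forall z, In z l -> in_disc z /\ f z = w) -> (length l <= p)%nat) /\
  (exists (w : C) (l : list C), NoDup l /\
     (forall z, In z l -> in_disc z /\ f z = w) /\ length l = p).

Definition C_is_series (u : nat -> C) (l : C) : Prop :=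
  @is_series C_AbsRing C_NormedModule u l.

Definition C_Series (u : nat -> C) : C :=
  (Series (fun k => Re (u k)), Series (fun k => Im (u k))).

(* f z = z^p + sum over k >= p + n of a_k z^k, with k written p + n + j. *)
Definition expands (p n : nat) (f : C -> C) (a : nat -> C) : Prop :=
  forall z, in_disc z ->
    C_is_series (fun j => (a (p + n + j)%nat * z ^ (p + n + j))%C)
                (f z - z ^ p)%C.

Definition normalized (p n : nat) (f : C -> C) : Prop :=
  analytic f /\ exists a, expands p n f a.

Definition class_A (p n : nat) (f : C -> C) : Prop :=
  normalized p n f /\ p_valent p f.

(* The coefficients of index k >= p + n are determined by f; the other values
   of the chosen sequence are arbitrary and never used. *)
Definition coeff (p n : nat) (f : C -> C) : nat -> C :=
  epsilon (inhabits (fun _ => RtoC 0)) (expands p n f).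

Definition Theta (p n : nat) (m : Z) (alpha beta : R) (f : C -> C) (z : C) : C :=
  (z ^ p + C_Series (fun j =>
     let k := (p + n + j)%nat in
     RtoC (powerRZ ((alpha + INR k * beta) / (alpha + INR p * beta)) m)
     * coeff p n f k * z ^ k))%C.

(* All the quotients considered have a removable singularity at 0 with
   value 1, which is filled in here. *)
Definition quotient (F G : C -> C) (z : C) : C :=
  if Ceq_dec z 0 then RtoC 1 else (F z / G z)%C.

Definition Cexp (z : C) : C := (RtoC (exp (Re z)) * (cos (Im z), sin (Im z)))%C.

Definition is_log (g L : C -> C) : Prop :=
  analytic L /\ L (RtoC 0) = RtoC 0 /\
  forall z, in_disc z -> Cexp (L z) = g z.

(* For g analytic and zero-free in the disc with g 0 = 1: the branch of g^s
   which is analytic in the disc and equal to 1 at 0.  The logarithm is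
   uniquely determined in the disc whenever it exists. *)
Definition power (g : C -> C) (s : R) (z : C) : C :=
  Cexp (RtoC s * epsilon (inhabits (fun _ => RtoC 0)) (is_log g) z)%C.

Definition subordinate (F G : C -> C) : Prop :=
  exists w : C -> C,
    analytic w /\ (forall z, in_disc z -> in_disc (w z)) /\
    w (RtoC 0) = RtoC 0 /\
    forall z, in_disc z -> F z = G (w z).

Definition mobius (A B : R) (z : C) : C := ((1 + A * z) / (1 + B * z))%C.

Definition Theta_quot (p n : nat) (m : Z) (alpha beta : R) (f : C -> C) : C -> C :=
  quotient (Theta p n m alpha beta f) (fun z => (z ^ p)%C).

Definition bound_on (p n : nat) (m : Z) (alpha beta mu gamma kappa : R)
    (f : C -> C) (rho : R) : Prop :=
  forall z, in_disc z -> Cmod z < rho ->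
    Re ((1 - mu) * power (Theta_quot p n m alpha beta f) (1 / gamma) z
        + mu * quotient (Theta p n (m + 1) alpha beta f)
                        (Theta p n m alpha beta f) z)%C
    > mu + (1 - mu) * kappa.

Definition smallest_positive_root (P : R -> R) (r : R) : Prop :=
  0 < r /\ P r = 0 /\ forall s, 0 < s -> P s = 0 -> r <= s.

Definition extremal_rhs (n : nat) (gamma kappa : R) : C -> C :=
  power (fun z => ((1 + (1 - 2 * kappa) * z ^ n) / (1 - z ^ n))%C) gamma.

(* (Theta f / z^p)^(1/n) = ((1 + (1 - 2 kappa) z^n) / (1 - z^n))^gamma.
   Zero-freeness is what gives the power on the left a meaning. *)
Definition extremal_root (p n : nat) (m : Z) (alpha beta gamma kappa : R)
    (f : C -> C) : Prop :=
  normalized p n f /\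
  (forall z, in_disc z -> Theta_quot p n m alpha beta f z <> RtoC 0) /\
  forall z, in_disc z ->
    power (Theta_quot p n m alpha beta f) (1 / INR n) z
    = extremal_rhs n gamma kappa z.

(* Theta f / z^p = ((1 + (1 - 2 kappa) z^n) / (1 - z^n))^gamma.  It agrees with
   the previous equation for n = 1; for n > 1 only this one is compatible with
   the subordination hypothesis. *)
Definition extremal (p n : nat) (m : Z) (alpha beta gamma kappa : R)
    (f : C -> C) : Prop :=
  normalized p n f /\
  forall z, in_disc z ->
    Theta_quot p n m alpha beta f z = extremal_rhs n gamma kappa z.

(* Main.v *)
Require Import Defs.
From Stdlib Require Import Lra Lia Psatz.

(* Write the hypothesis as Theta^m f / z^p = q^gamma with q = kappa + (1 - kappa) (1 + phi) / (1 - phi),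
   where phi maps the disc into itself and vanishes to order n at 0.  Since
   Theta^(m+1) f / Theta^m f = 1 + beta gamma / (alpha + p beta) * z q' / q, the claim is
   (1 - mu) Re (q - kappa) + mu beta gamma / (alpha + p beta) Re (z q' / q) > 0.  With r = |z| the
   Schwarz lemma gives |phi| <= r^n, the Schwarz-Pick lemma for phi / z^n gives
   |z phi'| <= n r^n (1 - |phi|^2) / (1 - r^(2n)), and together they bound the left side below by a
   positive multiple of the polynomial of the statement.  At z^n = - rad^n all these bounds are
   equalities for phi = z^n.

   Both Schwarz lemmas come from a maximum principle proved without integration: Theta^m f / z^p is
   a power series, so phi is twice complex differentiable, and real parts of such functions,
   perturbed by a strictly subharmonic term, have no interior maximum by the second derivative test. *)

(** * Complex derivatives *)

(** Write T for Theta^m f / z^p. [analytic] grants one complex derivative, while the second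
    derivative test asks for two: T has them as a power series, and solving T' / T = gamma q' / q
    for phi' passes them on to phi. The Schwarz-Pick quotient is undefined at the point a of the
    estimate, and phi / z^n at 0, so the maximum principle tolerates exactly these two punctures.
    Powers and coefficients are picked by [epsilon]; every use of a power goes through uniqueness of
    logarithms, and every use of coefficients of a constructed function through an identity theorem.
    Existence of extremal functions is settled on coefficients: those of ((1 + c u) / (1 - u))^s
    come from a first order differential equation, u is replaced by z^n, and the weights of the
    operator are inverted. The extremal equation with exponent 1/n amounts to T = ((1 + c z^n) / (1
    - z^n))^(n gamma), so both extremal equations are cases of an exponent N gamma, with N = 1 or N
    = n. *)

Definition Cder (f : C -> C) (z l : C) : Prop :=
  @is_derive C_AbsRing (AbsRing_NormedModule C_AbsRing) f z l.

(** Both targets carry the norm [Cmod] but different uniform structures. [Cder] views the ring as a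
    module over itself, the setting of Coquelicot's product and chain rules. *)
Lemma Cder_is_derive f z l :
  @is_derive C_AbsRing C_NormedModule f z l <-> Cder f z l.
Proof.
split; intros [[P1 P2 P3] H]; (split; [split; [exact P1|exact P2|exact P3] | exact H]).
Qed.

Lemma Cder_analytic f : (forall z, in_disc z -> exists l, Cder f z l) <-> analytic f.
Proof.
split; intros H z Hz; destruct (H z Hz) as [l Hl]; exists l;
  now apply Cder_is_derive.
Qed.

Lemma Cder_eps f z l :
  Cder f z l <-> forall eps, 0 < eps -> exists d, 0 < d /\
    forall h, Cmod h < d -> Cmod (f (z + h) - f z - l * h)%C <= eps * Cmod h.
Proof.
split.
- intros [_ H] eps Heps.
  destruct (H z (fun P HP => HP) (mkposreal eps Heps)) as [d Hd].
  exists d; split; [apply cond_pos|]; intros h Hh.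
  assert (B : @ball (AbsRing_UniformSpace C_AbsRing) z d (z + h)%C).
  { unfold ball; simpl; unfold AbsRing_ball; simpl.
    change (Cmod ((z + h) - z)%C < d).
    now replace ((z + h) - z)%C with h by ring. }
  specialize (Hd _ B).
  change (Cmod ((f (z + h) - f z) - ((z + h) - z) * l)%C <= eps * Cmod ((z + h) - z)%C) in Hd.
  replace ((z + h) - z)%C with h in Hd by ring.
  now replace (f (z + h) - f z - l * h)%C with ((f (z + h) - f z) - h * l)%C by ring.
- intros H; split; [apply (@is_linear_scal_l C_AbsRing (AbsRing_NormedModule C_AbsRing))|].
  intros x Hx eps.
  assert (E : z = x) by (apply (@is_filter_lim_locally_unique C_AbsRing (AbsRing_NormedModule C_AbsRing)), Hx).
  subst x.
  destruct (H eps (cond_pos eps)) as [d [Hd H']].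
  exists (mkposreal d Hd).
  cut (forall y : C, Cmod (y - z)%C < d ->
    Cmod ((f y - f z) - (y - z) * l)%C <= eps * Cmod (y - z)%C); [easy|].
  intros y Hy; change (Cmod ((f y - f z) - (y - z) * l)%C <= eps * Cmod (y - z)%C).
  specialize (H' _ Hy).
  replace (z + (y - z))%C with y in H' by ring.
  now replace ((f y - f z) - (y - z) * l)%C with (f y - f z - l * (y - z))%C by ring.
Qed.

Lemma Cder_const c z : Cder (fun _ => c) z 0.
Proof. apply (@is_derive_const C_AbsRing (AbsRing_NormedModule C_AbsRing)). Qed.

Lemma Cder_id z : Cder (fun x => x) z 1.
Proof. apply (@is_derive_id C_AbsRing). Qed.

Lemma Cder_plus f g z a b :
  Cder f z a -> Cder g z b -> Cder (fun x => f x + g x)%C z (a + b)%C.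
Proof. apply (@is_derive_plus C_AbsRing (AbsRing_NormedModule C_AbsRing)). Qed.

Lemma Cder_minus f g z a b :
  Cder f z a -> Cder g z b -> Cder (fun x => f x - g x)%C z (a - b)%C.
Proof. apply (@is_derive_minus C_AbsRing (AbsRing_NormedModule C_AbsRing)). Qed.

Lemma Cder_mult f g z a b :
  Cder f z a -> Cder g z b -> Cder (fun x => f x * g x)%C z (a * g z + f z * b)%C.
Proof.
intros Ha Hb; apply (@is_derive_mult C_AbsRing f g z a b Ha Hb).
intros n m; apply Cmult_comm.
Qed.

Lemma Cder_comp f g z a b :
  Cder f (g z) a -> Cder g z b -> Cder (fun x => f (g x)) z (a * b)%C.
Proof.
intros Ha Hb; rewrite Cmult_comm.
apply (@is_derive_comp C_AbsRing (AbsRing_NormedModule C_AbsRing) f g z a b Ha Hb).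
Qed.

Lemma Cder_eq f z a b : Cder f z a -> a = b -> Cder f z b.
Proof. now intros H <-. Qed.

Lemma Cder_ext f g z a :
  (forall x, f x = g x) -> Cder f z a -> Cder g z a.
Proof. apply (@is_derive_ext C_AbsRing (AbsRing_NormedModule C_AbsRing)). Qed.

Lemma Cder_ext_loc f g z a d :
  0 < d -> (forall x, Cmod (x - z)%C < d -> f x = g x) -> Cder f z a -> Cder g z a.
Proof.
intros Hd E; apply (@is_derive_ext_loc C_AbsRing (AbsRing_NormedModule C_AbsRing)).
exists (mkposreal d Hd); intros y Hy; apply E, Hy.
Qed.

Lemma Cder_unique f z a b : Cder f z a -> Cder f z b -> a = b.
Proof.
intros Ha Hb; apply Cder_is_derive in Ha; apply Cder_is_derive in Hb.
rewrite <- (is_C_derive_unique _ _ _ Ha); now apply is_C_derive_unique.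
Qed.

Definition Ccont (f : C -> C) (z : C) : Prop :=
  forall eps, 0 < eps -> exists d, 0 < d /\
    forall x, Cmod (x - z)%C < d -> Cmod (f x - f z)%C < eps.

Lemma Cder_Ccont f z l : Cder f z l -> Ccont f z.
Proof.
intros H eps Heps.
destruct (proj1 (Cder_eps f z l) H 1 Rlt_0_1) as [d [Hd H']].
assert (Hl := Cmod_ge_0 l).
exists (Rmin d (eps / (2 + Cmod l))); split.
{ apply Rmin_glb_lt; auto; apply Rdiv_lt_0_compat; lra. }
intros x Hx.
assert (H1 : Cmod (x - z)%C < d) by (eapply Rlt_le_trans; [apply Hx|apply Rmin_l]).
assert (H2 : Cmod (x - z)%C < eps / (2 + Cmod l)) by (eapply Rlt_le_trans; [apply Hx|apply Rmin_r]).
specialize (H' _ H1).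
replace (z + (x - z))%C with x in H' by ring.
apply Rlt_div_r in H2; [|lra].
replace (f x - f z)%C with ((f x - f z - l * (x - z)) + l * (x - z))%C by ring.
eapply Rle_lt_trans; [apply Cmod_triangle|]; rewrite Cmod_mult.
assert (H3 := Cmod_ge_0 (x - z)%C). nra.
Qed.

Lemma Cder_inv_id (z : C) : z <> RtoC 0 -> Cder (fun x => / x)%C z (- / (z * z))%C.
Proof.
intros Hz; apply Cder_eps; intros eps Heps.
assert (Hm := proj1 (Cmod_gt_0 z) Hz); set (m := Cmod z) in *.
assert (Hm3 : 0 < m * m * m) by (repeat apply Rmult_lt_0_compat; auto).
(* The remainder is h^2 / (z^2 (z + h)). The first bound keeps |z + h| >= m / 2, and the second then
   makes the remainder at most eps |h|. *)
exists (Rmin (m / 2) (eps * (m * m * m) / 2)); split.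
{ apply Rmin_glb_lt; [lra|]. assert (0 < eps * (m*m*m)) by (apply Rmult_lt_0_compat; auto). lra. }
intros h Hh.
assert (H1 : Cmod h < m / 2) by (eapply Rlt_le_trans; [apply Hh|apply Rmin_l]).
assert (H2 : Cmod h < eps * (m*m*m) / 2) by (eapply Rlt_le_trans; [apply Hh|apply Rmin_r]).
assert (H3 : m / 2 <= Cmod (z + h)%C).
{ assert (T := Cmod_triangle (z + h)%C (- h)%C).
  rewrite Cmod_opp in T; replace (z + h + - h)%C with z in T by ring.
  fold m in T; lra. }
assert (Hzh : (z + h)%C <> RtoC 0) by (apply Cmod_gt_0; lra).
replace (/ (z + h) - / z - - / (z * z) * h)%C with (h * h * / (z * z * (z + h)))%C
  by (field; split; auto).
rewrite !Cmod_mult, Cmod_inv, !Cmod_mult by (apply Cmult_neq_0; [apply Cmult_neq_0|]; auto).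
fold m. rewrite (Rmult_comm eps), Rmult_assoc.
apply Rmult_le_compat_l; [apply Cmod_ge_0|].
apply Rle_div_l; [apply Rlt_gt, Rmult_lt_0_compat; [nra|lra]|].
assert (m * m * (m / 2) <= m * m * Cmod (z + h)%C) by (apply Rmult_le_compat_l; nra).
assert (eps * (m * m * (m / 2)) <= eps * (m * m * Cmod (z + h)%C)) by (apply Rmult_le_compat_l; lra).
lra.
Qed.

Lemma Cder_inv (f : C -> C) (z a : C) :
  f z <> RtoC 0 -> Cder f z a -> Cder (fun x => / f x)%C z (- a / (f z * f z))%C.
Proof.
intros Hz H; eapply Cder_eq; [apply (Cder_comp (fun x => / x)%C f); [now apply Cder_inv_id|exact H]|].
field; auto.
Qed.

Lemma Cder_div (f g : C -> C) (z a b : C) :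
  g z <> RtoC 0 -> Cder f z a -> Cder g z b ->
  Cder (fun x => f x / g x)%C z ((a * g z - f z * b) / (g z * g z))%C.
Proof.
intros Hz Ha Hb; eapply Cder_eq.
apply Cder_mult; [apply Ha|apply Cder_inv; [exact Hz|apply Hb]].
cbv beta; field; auto.
Qed.

Lemma Cder_scal c f z a : Cder f z a -> Cder (fun x => c * f x)%C z (c * a)%C.
Proof.
intros H; eapply Cder_eq; [apply Cder_mult; [apply Cder_const|apply H]|cbv beta; ring].
Qed.

Lemma Cder_pow f z a n :
  Cder f z a -> Cder (fun x => f x ^ n)%C z (RtoC (INR n) * f z ^ (n - 1) * a)%C.
Proof.
intros H; induction n as [|n IH].
- eapply Cder_eq; [apply (Cder_ext (fun _ => RtoC 1)); [reflexivity|apply Cder_const]|].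
  change (RtoC (INR 0)) with (RtoC 0); ring.
- eapply Cder_eq; [apply (Cder_mult f (fun x => f x ^ n)%C); [apply H|apply IH]|]; cbv beta.
  destruct n as [|n]; [simpl; ring|].
  replace (S (S n) - 1)%nat with (S n) by lia.
  replace (S n - 1)%nat with n by lia.
  rewrite (S_INR (S n)), RtoC_plus; simpl (_ ^ _)%C; ring.
Qed.

Lemma Rabs_Im_le (z : C) : Rabs (Im z) <= Cmod z.
Proof. eapply Rle_trans; [apply Rmax_r|apply (Rmax_Cmod z)]. Qed.

(** Restriction to a real line brings in the real tools: the mean value theorem here, and later the
    second derivative test in two directions. *)
Lemma Cder_line f (z h l : C) (t : R) :
  Cder f (z + RtoC t * h)%C l ->
  is_derive (fun s : R => Re (f (z + RtoC s * h)%C)) t (Re (l * h)%C) /\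
  is_derive (fun s : R => Im (f (z + RtoC s * h)%C)) t (Im (l * h)%C).
Proof.
intros H.
assert (K : forall eps, 0 < eps -> exists d, 0 < d /\ forall s : R, Rabs (s - t) < d ->
   Cmod (f (z + RtoC s * h) - f (z + RtoC t * h) - l * (RtoC (s - t) * h))%C <= eps * Rabs (s - t)).
{ intros eps Heps.
  assert (Hh := Cmod_ge_0 h).
  destruct (proj1 (Cder_eps _ _ _) H (eps / (Cmod h + 1))) as [d [Hd H']].
  { apply Rdiv_lt_0_compat; lra. }
  exists (d / (Cmod h + 1)); split; [apply Rdiv_lt_0_compat; lra|].
  intros s Hs; apply Rlt_div_r in Hs; [|lra].
  assert (E : Cmod (RtoC (s - t) * h)%C = Rabs (s - t) * Cmod h)
    by now rewrite Cmod_mult, Cmod_R.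
  assert (P := Rabs_pos (s - t)).
  specialize (H' (RtoC (s - t) * h)%C); rewrite E in H'.
  replace (z + RtoC t * h + RtoC (s - t) * h)%C with (z + RtoC s * h)%C in H'
    by (rewrite RtoC_minus; ring).
  eapply Rle_trans; [apply H'; nra|].
  replace (eps / (Cmod h + 1) * (Rabs (s - t) * Cmod h))
    with (eps * Rabs (s - t) * (Cmod h / (Cmod h + 1))) by (field; lra).
  rewrite <- (Rmult_1_r (eps * Rabs (s - t))) at 2.
  apply Rmult_le_compat_l; [nra|].
  apply Rle_div_l; lra. }
split; split; try apply (@is_linear_scal_l R_AbsRing R_NormedModule);
  intros x Hx eps; assert (E : t = x) by (apply is_filter_lim_locally_unique, Hx);
  subst x; destruct (K eps (cond_pos eps)) as [d [Hd K']];
  exists (mkposreal d Hd); intros s Hs;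
  change (Rabs (s - t) < d) in Hs; specialize (K' s Hs).
- change (Rabs ((Re (f (z + RtoC s * h)%C) - Re (f (z + RtoC t * h)%C)) - (s - t) * Re (l * h)%C) <= eps * Rabs (s - t)).
  eapply Rle_trans; [|apply K'].
  eapply Rle_trans; [|apply re_le_Cmod].
  apply Req_le; f_equal.
  generalize (f (z + RtoC s * h)%C) (f (z + RtoC t * h)%C); clear; intros [a b] [c d].
  destruct l, h; simpl; ring.
- change (Rabs ((Im (f (z + RtoC s * h)%C) - Im (f (z + RtoC t * h)%C)) - (s - t) * Im (l * h)%C) <= eps * Rabs (s - t)).
  eapply Rle_trans; [|apply K'].
  eapply Rle_trans; [|apply Rabs_Im_le].
  apply Req_le; f_equal.
  generalize (f (z + RtoC s * h)%C) (f (z + RtoC t * h)%C); clear; intros [a b] [c d].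
  destruct l, h; simpl; ring.
Qed.

Lemma C_eq (a b : C) : Re a = Re b -> Im a = Im b -> a = b.
Proof. destruct a, b; simpl; now intros -> ->. Qed.

Lemma Cmod_scale (t : R) (z : C) : 0 <= t <= 1 -> Cmod (RtoC t * z)%C <= Cmod z.
Proof.
intros Ht; rewrite Cmod_mult, Cmod_R, Rabs_pos_eq by lra.
assert (H := Cmod_ge_0 z); nra.
Qed.

(** The mean value theorem is applied on the segment from 0 to z, separately to real and imaginary
    part, since it fails for complex values. *)
Lemma Cder_zero_const f (r : R) z :
  (forall x, Cmod x < r -> Cder f x 0) -> Cmod z < r -> f z = f (RtoC 0).
Proof.
intros H Hz.
assert (D : forall t : R, 0 <= t <= 1 ->
   is_derive (fun s : R => Re (f (0 + RtoC s * z)%C)) t 0 /\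
   is_derive (fun s : R => Im (f (0 + RtoC s * z)%C)) t 0).
{ intros t Ht.
  destruct (Cder_line f 0 z 0 t) as [H1 H2].
  { apply H; rewrite Cplus_0_l.
    apply Rle_lt_trans with (2 := Hz), Cmod_scale, Ht. }
  rewrite Cmult_0_l in H1, H2; now split. }
replace (f z) with (f (0 + RtoC 1 * z)%C) by (f_equal; ring).
replace (f (RtoC 0)) with (f (0 + RtoC 0 * z)%C) by (f_equal; ring).
assert (M : forall g : R -> R, (forall t, 0 <= t <= 1 -> is_derive g t 0) -> g 1 = g 0).
{ intros g Hg.
  destruct (MVT_gen g 0 1 (fun _ => 0)) as [c [_ Hc]].
  - rewrite Rmin_left, Rmax_right by lra; intros x Hx; apply Hg; lra.
  - rewrite Rmin_left, Rmax_right by lra; intros x Hx.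
    apply continuity_pt_filterlim, (@ex_derive_continuous R_AbsRing R_NormedModule); eexists; apply Hg; lra.
  - lra. }
apply C_eq.
- apply (M (fun s => Re (f (0 + RtoC s * z)%C))); intros t Ht; apply D, Ht.
- apply (M (fun s => Im (f (0 + RtoC s * z)%C))); intros t Ht; apply D, Ht.
Qed.

(** * Exponential and logarithm *)

Lemma Cmod_le_Re_Im (z : C) : Cmod z <= Rabs (Re z) + Rabs (Im z).
Proof.
replace z with (RtoC (Re z) + Ci * RtoC (Im z))%C at 1 by (apply C_eq; simpl; ring).
eapply Rle_trans; [apply Cmod_triangle|].
rewrite Cmod_mult, Cmod_Ci, !Cmod_R; lra.
Qed.

Lemma Cexp_plus (a b : C) : Cexp (a + b)%C = (Cexp a * Cexp b)%C.
Proof.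
unfold Cexp; destruct a as [x y], b as [u v]; simpl.
rewrite exp_plus, cos_plus, sin_plus.
apply C_eq; simpl; ring.
Qed.

Lemma Cexp_RtoC (x : R) : Cexp (RtoC x) = RtoC (exp x).
Proof.
unfold Cexp; simpl; rewrite cos_0, sin_0; apply C_eq; simpl; ring.
Qed.

Lemma Cexp_0 : Cexp (RtoC 0) = RtoC 1.
Proof. now rewrite Cexp_RtoC, exp_0. Qed.

Lemma Cmod_Cexp (z : C) : Cmod (Cexp z) = exp (Re z).
Proof.
unfold Cexp; rewrite Cmod_mult, Cmod_R, Rabs_pos_eq by (left; apply exp_pos).
replace (Cmod (cos (Im z), sin (Im z))) with 1; [ring|].
unfold Cmod; simpl; symmetry; rewrite <- sqrt_1; f_equal.
rewrite sqrt_1, !Rmult_1_r; assert (H := sin2_cos2 (Im z)); unfold Rsqr in H; lra.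
Qed.

Lemma Cexp_nz (z : C) : Cexp z <> RtoC 0.
Proof. apply Cmod_gt_0; rewrite Cmod_Cexp; apply exp_pos. Qed.

Lemma Cexp_opp (z : C) : Cexp (- z)%C = (/ Cexp z)%C.
Proof.
assert (H := Cexp_nz z).
assert (E : (Cexp z * Cexp (- z) = 1)%C) by (rewrite <- Cexp_plus, Cplus_opp_r; apply Cexp_0).
replace (Cexp (- z)%C) with (/ Cexp z * (Cexp z * Cexp (- z)))%C by (field; auto).
rewrite E; ring.
Qed.

Lemma Cexp_pow (z : C) (n : nat) : (Cexp z ^ n)%C = Cexp (RtoC (INR n) * z)%C.
Proof.
induction n as [|n IH].
- simpl; rewrite Cmult_0_l; symmetry; apply Cexp_0.
- rewrite Cpow_S, IH, S_INR, RtoC_plus, <- Cexp_plus; f_equal; ring.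
Qed.

Lemma little_o_of_derive (f : R -> R) (l : R) :
  is_derive f 0 l -> forall eps, 0 < eps -> exists d, 0 < d /\
    forall x, Rabs x < d -> Rabs (f x - f 0 - x * l) <= eps * Rabs x.
Proof.
intros [_ H] eps Heps.
destruct (H 0 (fun P HP => HP) (mkposreal eps Heps)) as [d Hd].
exists d; split; [apply cond_pos|]; intros x Hx.
assert (B : ball 0 d x) by (unfold ball; simpl; unfold AbsRing_ball, abs, minus, plus, opp; simpl; now rewrite Ropp_0, Rplus_0_r).
specialize (Hd _ B).
change (Rabs (f x - f 0 - (x - 0) * l) <= eps * Rabs (x - 0)) in Hd.
now rewrite Rminus_0_r in Hd.
Qed.

Lemma Cder_Cexp_0 : Cder Cexp 0 1.
Proof.
apply Cder_eps; intros eps0 Heps0.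
(* The errors of real and imaginary part come out as 3 eps r and 5 eps r, which [eps0 / 10] covers;
   [eps <= 1] keeps |x| below 1 and exp x below 3. *)
set (eps := Rmin (eps0 / 10) 1).
assert (He0 : eps <= eps0 / 10) by apply Rmin_l.
assert (He1 : eps <= 1) by apply Rmin_r.
assert (Heps : 0 < eps) by (apply Rmin_glb_lt; lra).
destruct (little_o_of_derive exp 1) with (eps := eps) as [d1 [Hd1 H1]]; auto.
{ auto_derive; auto; rewrite exp_0; ring. }
destruct (little_o_of_derive cos 0) with (eps := eps) as [d2 [Hd2 H2]]; auto.
{ auto_derive; auto; rewrite sin_0; ring. }
destruct (little_o_of_derive sin 1) with (eps := eps) as [d3 [Hd3 H3]]; auto.
{ auto_derive; auto; rewrite cos_0; ring. }
set (d := Rmin (Rmin d1 d2) (Rmin d3 eps)).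
assert (L1 : d <= d1) by (unfold d; eapply Rle_trans; [apply Rmin_l|apply Rmin_l]).
assert (L2 : d <= d2) by (unfold d; eapply Rle_trans; [apply Rmin_l|apply Rmin_r]).
assert (L3 : d <= d3) by (unfold d; eapply Rle_trans; [apply Rmin_r|apply Rmin_l]).
assert (L4 : d <= eps) by (unfold d; eapply Rle_trans; [apply Rmin_r|apply Rmin_r]).
exists d; split; [unfold d; apply Rmin_glb_lt; apply Rmin_glb_lt; assumption|].
intros h Hh; rewrite Cexp_0, Cplus_0_l, Cmult_1_l.
destruct h as [x y].
assert (Hx : Rabs x <= Cmod (x, y)) by apply (re_le_Cmod (x, y)).
assert (Hy : Rabs y <= Cmod (x, y)) by apply (Rabs_Im_le (x, y)).
specialize (H1 x ltac:(lra)); specialize (H2 y ltac:(lra)); specialize (H3 y ltac:(lra)).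
rewrite exp_0, Rmult_1_r in H1; rewrite cos_0, Rmult_0_r, Rminus_0_r in H2.
rewrite sin_0, Rmult_1_r, Rminus_0_r in H3.
set (r := Cmod (x, y)) in *.
eapply Rle_trans; [apply Cmod_le_Re_Im|]; simpl.
assert (C1 : Rabs (cos y) <= 1) by (apply Rabs_le, COS_bound).
assert (Px := Rabs_pos x); assert (Py := Rabs_pos y).
assert (E1 : Rabs (exp x - 1) <= 2 * Rabs x).
{ replace (exp x - 1) with ((exp x - 1 - x) + x) by ring.
  eapply Rle_trans; [apply Rabs_triang|]; nra. }
assert (E2 : Rabs (exp x) <= 3).
{ replace (exp x) with ((exp x - 1) + 1) by ring.
  eapply Rle_trans; [apply Rabs_triang|]; rewrite Rabs_R1; lra. }
assert (A : Rabs (exp x * cos y - 0 * sin y + - (1) + - x) <= 3 * eps * r).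
{ replace (exp x * cos y - 0 * sin y + - (1) + - x) with ((exp x - 1 - x) * cos y + (1 + x) * (cos y - 1)) by ring.
  eapply Rle_trans; [apply Rabs_triang|]; rewrite !Rabs_mult.
  assert (Rabs (1 + x) <= 2) by (eapply Rle_trans; [apply Rabs_triang|]; rewrite Rabs_R1; lra).
  assert (Q1 := Rabs_pos (exp x - 1 - x)); assert (Q2 := Rabs_pos (cos y - 1)).
  assert (Rabs (exp x - 1 - x) * Rabs (cos y) <= eps * r * 1).
  { apply Rmult_le_compat; auto; try apply Rabs_pos; nra. }
  assert (Rabs (1 + x) * Rabs (cos y - 1) <= 2 * (eps * r)).
  { apply Rmult_le_compat; auto; try apply Rabs_pos; nra. }
  lra. }
assert (B : Rabs (exp x * sin y + 0 * cos y + - (0) + - y) <= 5 * eps * r).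
{ replace (exp x * sin y + 0 * cos y + - (0) + - y) with (exp x * (sin y - y) + (exp x - 1) * y) by ring.
  eapply Rle_trans; [apply Rabs_triang|]; rewrite !Rabs_mult.
  assert (Rabs (exp x) * Rabs (sin y - y) <= 3 * (eps * r)).
  { apply Rmult_le_compat; auto; try apply Rabs_pos; nra. }
  assert (Rabs (exp x - 1) * Rabs y <= (2 * eps) * r).
  { apply Rmult_le_compat; auto; try apply Rabs_pos; lra. }
  lra. }
assert (0 <= r) by apply Cmod_ge_0.
assert (eps * r <= eps0 / 10 * r) by (apply Rmult_le_compat_r; auto).
assert (0 <= eps0 * r) by (apply Rmult_le_pos; lra).
lra.
Qed.

Lemma Cder_Cexp (z : C) : Cder Cexp z (Cexp z).
Proof.
apply (Cder_ext (fun x => Cexp z * Cexp (x - z))%C).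
{ intros x; rewrite <- Cexp_plus; f_equal; ring. }
eapply Cder_eq.
- apply Cder_scal, (Cder_comp Cexp (fun x => x - z)%C).
  + replace (z - z)%C with (RtoC 0) by ring; apply Cder_Cexp_0.
  + apply Cder_minus; [apply Cder_id|apply Cder_const].
- ring.
Qed.

(** The arctangent gives the principal argument only for Re z > 0. That half plane contains 1 + a w
    for |a| <= 1 and |w| < 1, and other logarithms are assembled from ratios lying in it. *)
Definition Clog (z : C) : C := (ln (Cmod z), atan (Im z / Re z)).

Lemma Cexp_Clog (z : C) : 0 < Re z -> Cexp (Clog z) = z.
Proof.
intros Hz; destruct z as [x y]; simpl in Hz.
assert (Hm : 0 < Cmod (x, y)).
{ apply Cmod_gt_0; intros E; injection E; intros; lra. }
unfold Cexp, Clog; simpl; rewrite exp_ln by auto.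
rewrite cos_atan, sin_atan.
assert (E : sqrt (1 + (y / x)²) = Cmod (x, y) / x).
{ replace (1 + (y / x)²) with ((x ^ 2 + y ^ 2) / (x * x)) by (unfold Rsqr; field; lra).
  rewrite sqrt_div_alt by nra.
  now rewrite sqrt_square by lra. }
rewrite E.
apply C_eq; simpl; field; lra.
Qed.

Lemma Clog_1 : Clog (RtoC 1) = RtoC 0.
Proof.
unfold Clog; rewrite Cmod_1, ln_1; simpl.
replace (0 / 1) with 0 by field; now rewrite atan_0.
Qed.

Lemma continuous_C_eps (f : C -> R) (z : C) :
  @continuous C_UniformSpace R_UniformSpace f z ->
  forall eps, 0 < eps -> exists d, 0 < d /\
    forall x, Cmod (x - z)%C < d -> Rabs (f x - f z) < eps.
Proof.
intros H eps Heps.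
destruct (proj1 (filterlim_locally f (f z)) H (mkposreal eps Heps)) as [d Hd].
exists d; split; [apply cond_pos|]; intros x Hx.
apply Hd; split.
- eapply Rle_lt_trans; [|apply Hx]; apply (re_le_Cmod (x - z)%C).
- eapply Rle_lt_trans; [|apply Hx]; apply (Rabs_Im_le (x - z)%C).
Qed.

Lemma eps_continuous_C (f : C -> R) (z : C) :
  (forall eps, 0 < eps -> exists d, 0 < d /\
    forall x, Cmod (x - z)%C < d -> Rabs (f x - f z) < eps) ->
  @continuous C_UniformSpace R_UniformSpace f z.
Proof.
intros H; apply filterlim_locally; intros eps.
destruct (H eps (cond_pos eps)) as [d [Hd H']].
assert (Hd2 : 0 < d / 2) by lra.
exists (mkposreal _ Hd2); intros x [B1 B2]; apply H'.
change (Rabs (Re x - Re z) < d / 2) in B1; change (Rabs (Im x - Im z) < d / 2) in B2.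
eapply Rle_lt_trans; [apply Cmod_le_Re_Im|]; simpl; unfold Rminus in *; unfold Re, Im in *; lra.
Qed.

Lemma continuous_Cmod (z : C) : @continuous C_UniformSpace R_UniformSpace Cmod z.
Proof.
apply eps_continuous_C; intros eps Heps; exists eps; split; auto.
intros x Hx; eapply Rle_lt_trans; [|apply Hx].
assert (T1 := Cmod_triangle (x - z)%C z).
assert (T2 := Cmod_triangle (z - x)%C x).
replace (x - z + z)%C with x in T1 by ring.
replace (z - x + x)%C with z in T2 by ring.
replace (z - x)%C with (- (x - z))%C in T2 by ring; rewrite Cmod_opp in T2.
apply Rabs_le; lra.
Qed.

Lemma Ccont_Clog (z : C) : 0 < Re z -> Ccont Clog z.
Proof.
intros Hz.
assert (Hm : 0 < Cmod z) by (eapply Rlt_le_trans; [|apply re_le_Cmod]; apply Rabs_pos_lt; lra).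
assert (C1 : @continuous C_UniformSpace R_UniformSpace (fun x => ln (Cmod x)) z).
{ apply (@continuous_comp C_UniformSpace R_UniformSpace R_UniformSpace Cmod ln).
  - apply continuous_Cmod.
  - apply (@ex_derive_continuous R_AbsRing R_NormedModule); auto_derive; auto. }
assert (C2 : @continuous C_UniformSpace R_UniformSpace (fun x => atan (Im x / Re x)) z).
{ apply (@continuous_comp C_UniformSpace R_UniformSpace R_UniformSpace (fun x => Im x / Re x) atan).
  - apply (@continuous_mult C_UniformSpace R_AbsRing (fun x => Im x) (fun x => / Re x)).
    + apply continuous_snd.
    + apply (@continuous_comp C_UniformSpace R_UniformSpace R_UniformSpace (fun x => Re x) Rinv).
      * apply continuous_fst.
      * apply (@ex_derive_continuous R_AbsRing R_NormedModule); auto_derive; lra.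
  - apply (@ex_derive_continuous R_AbsRing R_NormedModule); auto_derive; auto. }
intros eps Heps.
destruct (continuous_C_eps _ _ C1 (eps / 2)) as [d1 [Hd1 K1]]; [lra|].
destruct (continuous_C_eps _ _ C2 (eps / 2)) as [d2 [Hd2 K2]]; [lra|].
exists (Rmin d1 d2); split; [now apply Rmin_glb_lt|].
intros x Hx.
specialize (K1 x (Rlt_le_trans _ _ _ Hx (Rmin_l _ _))).
specialize (K2 x (Rlt_le_trans _ _ _ Hx (Rmin_r _ _))).
eapply Rle_lt_trans; [apply Cmod_le_Re_Im|].
simpl; unfold Rminus in *; lra.
Qed.

(** Continuity of [g] makes the increment k = g (z + h) - g z small, so that the expansion of [f] at
    [g z] may be evaluated at k and solved for it. *)
Lemma Cder_inverse (f g : C -> C) (z l : C) (d0 : R) :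
  0 < d0 -> (forall x, Cmod (x - z)%C < d0 -> f (g x) = x) -> Ccont g z ->
  l <> RtoC 0 -> Cder f (g z) l -> Cder g z (/ l)%C.
Proof.
intros Hd0 Hfg Hg Hl Hf; apply Cder_eps; intros eps Heps.
assert (Hm := proj1 (Cmod_gt_0 l) Hl); set (m := Cmod l) in *.
(* The first bound yields m |k| <= 2 |h|, the second turns the error e |k| / m into at most eps
   |h|. *)
set (e := Rmin (m / 2) (eps * (m * m) / 2)).
assert (He1 : e <= m / 2) by apply Rmin_l.
assert (He2 : e <= eps * (m * m) / 2) by apply Rmin_r.
assert (He : 0 < e).
{ apply Rmin_glb_lt; [lra|]; assert (0 < eps * (m * m)) by (repeat apply Rmult_lt_0_compat; auto); lra. }
destruct (proj1 (Cder_eps _ _ _) Hf e He) as [d1 [Hd1 K1]].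
destruct (Hg d1 Hd1) as [d2 [Hd2 K2]].
exists (Rmin d0 d2); split; [now apply Rmin_glb_lt|].
intros h Hh.
assert (Eh : (z + h - z = h)%C) by ring.
specialize (Hfg (z + h)%C ltac:(rewrite Eh; eapply Rlt_le_trans; [apply Hh|apply Rmin_l])) as F1.
specialize (Hfg z ltac:(replace (z - z)%C with (RtoC 0) by ring; now rewrite Cmod_0)) as F2.
specialize (K2 (z + h)%C ltac:(rewrite Eh; eapply Rlt_le_trans; [apply Hh|apply Rmin_r])).
set (k := (g (z + h) - g z)%C) in *.
specialize (K1 k K2).
replace (g z + k)%C with (g (z + h)%C) in K1 by (unfold k; ring).
rewrite F1, F2, Eh in K1.
assert (Hk : m * Cmod k <= 2 * Cmod h).
{ assert (T := Cmod_triangle (- (h - l * k))%C h).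
  rewrite Cmod_opp in T; replace (- (h - l * k) + h)%C with (l * k)%C in T by ring.
  rewrite Cmod_mult in T; fold m in T.
  assert (P := Cmod_ge_0 k). nra. }
replace (k - / l * h)%C with (- ((h - l * k) / l))%C by (field; auto).
rewrite Cmod_opp, Cmod_div by auto; fold m.
apply Rle_div_l; auto.
assert (P := Cmod_ge_0 k); assert (Q := Cmod_ge_0 h).
assert (e * Cmod k <= eps * (m * m) / 2 * Cmod k) by (apply Rmult_le_compat_r; auto).
assert (eps * m * (m * Cmod k) <= eps * m * (2 * Cmod h)) by (apply Rmult_le_compat_l; [nra|auto]).
lra.
Qed.

Lemma Cder_Clog (z : C) : 0 < Re z -> Cder Clog z (/ z)%C.
Proof.
intros Hz.
assert (Hz0 : z <> RtoC 0) by (intros ->; simpl in Hz; lra).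
apply (Cder_inverse Cexp Clog z z (Re z)); auto.
- intros x Hx; apply Cexp_Clog.
  assert (H := re_le_Cmod (x - z)%C).
  assert (H1 := Rle_lt_trans _ _ _ H Hx); apply Rabs_lt_between in H1; simpl in H1.
  unfold Re in *; lra.
- now apply Ccont_Clog.
- rewrite <- (Cexp_Clog z) at 2 by auto; apply Cder_Cexp.
Qed.

(** The radius is a parameter because logarithms of a general zero-free function are first built on
    smaller discs and then glued. *)
Definition log_on (r : R) (g L : C -> C) : Prop :=
  (forall z, Cmod z < r -> exists l, Cder L z l) /\ L (RtoC 0) = RtoC 0 /\
  forall z, Cmod z < r -> Cexp (L z) = g z.

Lemma is_log_log_on g L : is_log g L <-> log_on 1 g L.
Proof.
unfold is_log, log_on; rewrite <- Cder_analytic; reflexivity.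
Qed.

(* exp (L1 - L2) = 1 forces (L1 - L2)' = 0. *)
Lemma log_on_unique r g L1 L2 :
  log_on r g L1 -> log_on r g L2 -> forall z, Cmod z < r -> L1 z = L2 z.
Proof.
intros (D1 & Z1 & E1) (D2 & Z2 & E2) z Hz.
assert (E : (L1 z - L2 z = L1 0 - L2 0)%C).
{ apply (Cder_zero_const (fun x => L1 x - L2 x)%C r); auto.
  intros x Hx; destruct (D1 x Hx) as [l1 H1]; destruct (D2 x Hx) as [l2 H2].
  assert (Dd := Cder_minus _ _ _ _ _ H1 H2).
  assert (De := Cder_comp Cexp _ _ _ _ (Cder_Cexp _) Dd); cbv beta in De.
  assert (Dc : Cder (fun x => Cexp (L1 x - L2 x)%C) x 0).
  { apply (Cder_ext_loc (fun _ => RtoC 1) _ x 0 (r - Cmod x)); [lra| |apply Cder_const].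
    intros y Hy.
    assert (Hyr : Cmod y < r).
    { assert (T := Cmod_triangle (y - x)%C x); replace (y - x + x)%C with y in T by ring; lra. }
    unfold Cminus; rewrite Cexp_plus, Cexp_opp, E1, E2 by auto.
    rewrite <- (E1 y Hyr). field; apply Cexp_nz. }
  assert (K := Cder_unique _ _ _ _ De Dc).
  eapply Cder_eq; [apply Dd|].
  replace (l1 - l2)%C with (/ Cexp (L1 x - L2 x) * (Cexp (L1 x - L2 x) * (l1 - l2)))%C
    by (field; apply Cexp_nz).
  rewrite K; ring. }
rewrite Z1, Z2 in E.
replace (L1 z) with (L1 z - L2 z + L2 z)%C by ring; rewrite E; ring.
Qed.

(** The logarithm inside [power] is an unspecified choice; uniqueness identifies it on the disc with
    whichever logarithm is at hand. *)
Lemma power_log g L s z :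
  is_log g L -> in_disc z -> power g s z = Cexp (RtoC s * L z)%C.
Proof.
intros HL Hz; unfold power; do 2 f_equal.
apply (log_on_unique 1 g); auto; apply is_log_log_on; auto.
apply epsilon_spec; now exists L.
Qed.

Lemma in_disc_1p (a : R) (z : C) :
  -1 <= a <= 1 -> in_disc z -> 0 < Re (1 + RtoC a * z)%C.
Proof.
unfold in_disc; intros Ha Hz.
assert (H := re_le_Cmod z); assert (H' := Rle_lt_trans _ _ _ H Hz).
apply Rabs_lt_between in H'; destruct z as [x y]; simpl in *.
rewrite Rmult_0_l, Rminus_0_r; destruct (Rle_dec 0 x); [assert (0 <= (a + 1) * x)|assert (0 <= (1 - a) * - x)]; try apply Rmult_le_pos; lra.
Qed.

Lemma Re_pos_nz (z : C) : 0 < Re z -> z <> RtoC 0.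
Proof. intros H ->; simpl in H; lra. Qed.

Definition mlog (A B : R) (z : C) : C :=
  (Clog (1 + RtoC A * z) - Clog (1 + RtoC B * z))%C.

Lemma Cder_1p (a : R) (z : C) : Cder (fun x => 1 + RtoC a * x)%C z (RtoC a).
Proof.
eapply Cder_eq; [apply Cder_plus; [apply Cder_const|apply Cder_scal, Cder_id]|ring].
Qed.

Lemma Cder_mlog (A B : R) (z : C) :
  -1 <= A <= 1 -> -1 <= B <= 1 -> in_disc z ->
  Cder (mlog A B) z (RtoC (A - B) / ((1 + RtoC A * z) * (1 + RtoC B * z)))%C.
Proof.
intros HA HB Hz.
assert (PA := in_disc_1p A z HA Hz); assert (PB := in_disc_1p B z HB Hz).
assert (NA := Re_pos_nz _ PA); assert (NB := Re_pos_nz _ PB).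
eapply Cder_eq.
- apply Cder_minus; (apply (Cder_comp Clog (fun x => 1 + _ * x)%C); [now apply Cder_Clog|apply Cder_1p]).
- rewrite RtoC_minus; field; auto.
Qed.

Lemma mlog_0 A B : mlog A B (RtoC 0) = RtoC 0.
Proof.
unfold mlog; replace (1 + A * 0)%C with (RtoC 1) by ring.
replace (1 + B * 0)%C with (RtoC 1) by ring; rewrite Clog_1; ring.
Qed.

Lemma Cexp_mlog A B z :
  -1 <= A <= 1 -> -1 <= B <= 1 -> in_disc z -> Cexp (mlog A B z) = mobius A B z.
Proof.
intros HA HB Hz; unfold mlog, mobius, Cminus.
rewrite Cexp_plus, Cexp_opp, !Cexp_Clog by now apply in_disc_1p.
reflexivity.
Qed.

Lemma is_log_mobius (A B : R) (g w : C -> C) :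
  -1 <= A <= 1 -> -1 <= B <= 1 -> analytic w ->
  (forall z, in_disc z -> in_disc (w z)) -> w (RtoC 0) = RtoC 0 ->
  (forall z, in_disc z -> g z = mobius A B (w z)) ->
  is_log g (fun z => mlog A B (w z)).
Proof.
intros HA HB Dw Hw W0 Hg; split; [|split].
- apply Cder_analytic; intros z Hz.
  destruct (proj2 (Cder_analytic w) Dw z Hz) as [l Hl].
  eexists; apply (Cder_comp (mlog A B) w); [apply Cder_mlog; auto|apply Hl].
- rewrite W0; apply mlog_0.
- intros z Hz; rewrite Cexp_mlog by auto; symmetry; auto.
Qed.

(** * Complex power series *)

Lemma Re_sum_n (u : nat -> C) N :
  Re (@sum_n C_AbelianMonoid u N) = sum_n (fun k => Re (u k)) N.
Proof.
induction N as [|N IH]; [now rewrite !sum_O|].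
rewrite !sum_Sn; unfold plus; simpl; now rewrite <- IH.
Qed.

Lemma Im_sum_n (u : nat -> C) N :
  Im (@sum_n C_AbelianMonoid u N) = sum_n (fun k => Im (u k)) N.
Proof.
induction N as [|N IH]; [now rewrite !sum_O|].
rewrite !sum_Sn; unfold plus; simpl; now rewrite <- IH.
Qed.

Lemma C_is_series_Re_Im (u : nat -> C) (l : C) :
  C_is_series u l <->
  is_series (fun k => Re (u k)) (Re l) /\ is_series (fun k => Im (u k)) (Im l).
Proof.
unfold C_is_series, is_series; split.
- intros H.
  split; apply filterlim_locally; intros eps;
    destruct (proj1 (filterlim_locally _ _) H eps) as [N HN]; exists N; intros n Hn;
    destruct (HN n Hn) as [B1 B2].
  + rewrite <- Re_sum_n; exact B1.
  + rewrite <- Im_sum_n; exact B2.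
- intros [H1 H2]; apply filterlim_locally; intros eps.
  destruct (proj1 (filterlim_locally _ _) H1 eps) as [N1 HN1].
  destruct (proj1 (filterlim_locally _ _) H2 eps) as [N2 HN2].
  exists (Nat.max N1 N2); intros n Hn; split.
  + specialize (HN1 n ltac:(lia)); rewrite <- Re_sum_n in HN1; exact HN1.
  + specialize (HN2 n ltac:(lia)); rewrite <- Im_sum_n in HN2; exact HN2.
Qed.

Lemma C_is_series_unique (u : nat -> C) (l : C) : C_is_series u l -> C_Series u = l.
Proof.
intros H; apply C_is_series_Re_Im in H; destruct H as [H1 H2].
unfold C_Series; rewrite (is_series_unique _ _ H1), (is_series_unique _ _ H2).
now destruct l.
Qed.

Lemma ex_series_Rle (a b : nat -> R) :
  (forall n, Rabs (a n) <= b n) -> ex_series b -> ex_series a.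
Proof. intros H; apply (@ex_series_le R_AbsRing R_CompleteNormedModule); exact H. Qed.

Lemma C_is_series_abs (u : nat -> C) :
  ex_series (fun k => Cmod (u k)) -> C_is_series u (C_Series u).
Proof.
intros H; apply C_is_series_Re_Im; split; apply Series_correct;
  (eapply ex_series_Rle; [|apply H]); intros k; [apply re_le_Cmod|apply Rabs_Im_le].
Qed.

(** The factor 2 comes from estimating real and imaginary parts separately; it is harmless in the
    remainder estimate for power series. *)
Lemma Cmod_C_Series (u : nat -> C) :
  ex_series (fun k => Cmod (u k)) ->
  Cmod (C_Series u) <= 2 * Series (fun k => Cmod (u k)).
Proof.
intros H; eapply Rle_trans; [apply Cmod_le_Re_Im|]; simpl.
assert (K : forall f : nat -> R, (forall k, Rabs (f k) <= Cmod (u k)) ->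
  Rabs (Series f) <= Series (fun k => Cmod (u k))).
{ intros f Hf.
  eapply Rle_trans; [apply Series_Rabs; eapply ex_series_Rle; [|apply H]|].
  - intros n; rewrite Rabs_Rabsolu; apply Hf.
  - apply Series_le; [|apply H]; intros n; split; [apply Rabs_pos|apply Hf]. }
assert (K1 := K _ (fun k => re_le_Cmod (u k))).
assert (K2 := K _ (fun k => Rabs_Im_le (u k))).
lra.
Qed.

Lemma C_is_series_plus (u v : nat -> C) (a b : C) :
  C_is_series u a -> C_is_series v b ->
  C_is_series (fun k => u k + v k)%C (a + b)%C.
Proof. apply (@is_series_plus C_AbsRing C_NormedModule). Qed.

Lemma C_is_series_scal (u : nat -> C) (c a : C) :
  C_is_series u a -> C_is_series (fun k => c * u k)%C (c * a)%C.
Proof. apply (@is_series_scal C_AbsRing C_NormedModule). Qed.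

Lemma C_is_series_ext (u v : nat -> C) (a : C) :
  (forall k, u k = v k) -> C_is_series u a -> C_is_series v a.
Proof. apply (@is_series_ext C_AbsRing C_NormedModule). Qed.

(** This says that the radius of convergence is at least 1. As a growth condition it is visibly
    stable under shifts and under multiplication by the index, hence under termwise
    differentiation. *)
Definition disc_coeffs (a : nat -> C) : Prop :=
  forall r, 0 < r < 1 -> exists M, forall k, Cmod (a k) * r ^ k <= M.

Definition PS (a : nat -> C) (z : C) : C := C_Series (fun k => a k * z ^ k)%C.

(** Comparison with a geometric series of ratio x / r, for an r strictly between x and 1. *)
Lemma disc_coeffs_abs a (x : R) :
  disc_coeffs a -> 0 <= x < 1 -> ex_series (fun k => Cmod (a k) * x ^ k).
Proof.
intros Ha Hx; set (r := (x + 1) / 2).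
assert (Hr : 0 < r < 1) by (unfold r; lra).
destruct (Ha r Hr) as [M HM].
apply ex_series_Rle with (b := fun k => M * (x / r) ^ k).
- intros k; rewrite Rabs_pos_eq by (apply Rmult_le_pos; [apply Cmod_ge_0|apply pow_le; lra]).
  replace (Cmod (a k) * x ^ k) with ((Cmod (a k) * r ^ k) * (x / r) ^ k).
  + apply Rmult_le_compat_r; [apply pow_le, Rdiv_le_0_compat; lra|apply HM].
  + unfold Rdiv; rewrite Rpow_mult_distr, pow_inv.
    assert (r ^ k <> 0) by (apply pow_nonzero; lra); field; auto.
- apply (@ex_series_scal_l R_AbsRing R_NormedModule M (fun k => (x / r) ^ k)), ex_series_geom.
  rewrite Rabs_pos_eq by (apply Rdiv_le_0_compat; lra).
  apply Rlt_div_l; unfold r; lra.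
Qed.

Lemma PS_abs a (z : C) :
  disc_coeffs a -> Cmod z < 1 -> ex_series (fun k => Cmod (a k * z ^ k)%C).
Proof.
intros Ha Hz; apply (ex_series_ext (fun k => Cmod (a k) * Cmod z ^ k)).
- intros k; now rewrite Cmod_mult, Cmod_pow.
- apply disc_coeffs_abs; auto; split; auto; apply Cmod_ge_0.
Qed.

Lemma PS_is_series a (z : C) :
  disc_coeffs a -> Cmod z < 1 -> C_is_series (fun k => a k * z ^ k)%C (PS a z).
Proof. intros; now apply C_is_series_abs, PS_abs. Qed.

Lemma disc_coeffs_ext a b : (forall k, a k = b k) -> disc_coeffs a -> disc_coeffs b.
Proof.
intros E H r Hr; destruct (H r Hr) as [M HM]; exists M; intros k; now rewrite <- E.
Qed.

Lemma disc_coeffs_le a b :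
  (forall k, Cmod (b k) <= Cmod (a k)) -> disc_coeffs a -> disc_coeffs b.
Proof.
intros E H r Hr; destruct (H r Hr) as [M HM]; exists M; intros k.
eapply Rle_trans; [|apply (HM k)].
apply Rmult_le_compat_r; auto; apply pow_le; lra.
Qed.

Lemma pow_linear_bound (x : R) :
  0 < x < 1 -> exists M, forall k, INR (S k) * x ^ k <= M.
Proof.
intros Hx; set (h := / x - 1).
assert (Hh : 0 < h).
{ unfold h; assert (1 < / x) by (rewrite <- Rinv_1; apply Rinv_lt_contravar; lra); lra. }
exists (1 + / h); intros k.
(* [poly] is Bernoulli's inequality 1 + k h <= (1 + h)^k, with 1 + h = 1 / x. *)
assert (B := poly k h Hh).
replace (1 + h) with (/ x) in B by (unfold h; ring).
rewrite pow_inv in B.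
assert (Hp : 0 < x ^ k) by (apply pow_lt; lra).
assert (Hk := pos_INR k).
assert (E : (1 + INR k * h) * x ^ k <= 1).
{ apply (Rmult_le_compat_r (x ^ k)) in B; [|lra].
  now rewrite Rinv_l in B by lra. }
assert (x ^ k <= 1) by (rewrite <- (pow1 k); apply pow_incr; lra).
rewrite S_INR.
assert (INR k * x ^ k <= / h).
{ apply Rmult_le_reg_r with h; [auto|]; rewrite Rinv_l by lra; nra. }
lra.
Qed.

(** Passing from r to a larger s < 1 leaves a factor (r / s)^k, which absorbs the linear factor. *)
Lemma disc_coeffs_S a :
  disc_coeffs a -> disc_coeffs (fun k => RtoC (INR (S k)) * a k)%C.
Proof.
intros H r Hr; set (s := (r + 1) / 2).
assert (Hs : 0 < s < 1) by (unfold s; lra).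
destruct (H s Hs) as [M HM].
assert (Hx : 0 < r / s < 1).
{ split; [apply Rdiv_lt_0_compat; lra|apply Rlt_div_l; unfold s; lra]. }
destruct (pow_linear_bound _ Hx) as [K HK].
exists (K * M); intros k.
rewrite Cmod_mult, Cmod_R, Rabs_pos_eq by apply pos_INR.
replace (INR (S k) * Cmod (a k) * r ^ k)
  with ((INR (S k) * (r / s) ^ k) * (Cmod (a k) * s ^ k)).
- apply Rmult_le_compat; auto.
  + apply Rmult_le_pos; [apply pos_INR|apply pow_le; lra].
  + apply Rmult_le_pos; [apply Cmod_ge_0|apply pow_le; lra].
- unfold Rdiv; rewrite Rpow_mult_distr, pow_inv.
  assert (s ^ k <> 0) by (apply pow_nonzero; lra); field; auto.
Qed.

Lemma disc_coeffs_scal c a : disc_coeffs a -> disc_coeffs (fun k => c * a k)%C.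
Proof.
intros H r Hr; destruct (H r Hr) as [M HM]; exists (Cmod c * M); intros k.
rewrite Cmod_mult, Rmult_assoc; apply Rmult_le_compat_l; auto; apply Cmod_ge_0.
Qed.

Lemma disc_coeffs_plus a b :
  disc_coeffs a -> disc_coeffs b -> disc_coeffs (fun k => a k + b k)%C.
Proof.
intros Ha Hb r Hr; destruct (Ha r Hr) as [M HM]; destruct (Hb r Hr) as [N HN].
exists (M + N); intros k.
eapply Rle_trans; [|apply Rplus_le_compat; [apply (HM k)|apply (HN k)]].
rewrite <- Rmult_plus_distr_r; apply Rmult_le_compat_r; [apply pow_le; lra|apply Cmod_triangle].
Qed.

Lemma disc_coeffs_shift N a : disc_coeffs (fun k => a (N + k)%nat) <-> disc_coeffs a.
Proof.
split; intros H r Hr; destruct (H r Hr) as [M HM].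
- assert (F : exists M0, forall k, (k < N)%nat -> Cmod (a k) * r ^ k <= M0).
  { clear -Hr; induction N as [|N [M0 IH]]; [exists 0; intros; lia|].
    exists (Rmax M0 (Cmod (a N) * r ^ N)); intros k Hk.
    destruct (Nat.eq_dec k N) as [->|]; [apply Rmax_r|].
    eapply Rle_trans; [apply IH; lia|apply Rmax_l]. }
  destruct F as [M0 HM0].
  exists (Rmax M0 (M * r ^ N)); intros k.
  destruct (Nat.lt_ge_cases k N) as [L|L].
  + eapply Rle_trans; [now apply HM0|apply Rmax_l].
  + eapply Rle_trans; [|apply Rmax_r].
    replace k with (N + (k - N))%nat at 1 2 by lia.
    rewrite pow_add.
    specialize (HM (k - N)%nat).
    assert (0 < r ^ N) by (apply pow_lt; lra).
    replace (N + (k - N))%nat with k in * by lia.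
    rewrite (Rmult_comm (r ^ N)), <- Rmult_assoc; apply Rmult_le_compat_r; lra.
- exists (M / r ^ N); intros k.
  assert (0 < r ^ N) by (apply pow_lt; lra).
  apply (Rle_div_r (Cmod (a (N + k)%nat) * r ^ k)); auto.
  specialize (HM (N + k)%nat); rewrite pow_add in HM; nra.
Qed.

Lemma PS_ext a b z : (forall k, a k = b k) -> PS a z = PS b z.
Proof.
intros E; unfold PS, C_Series; f_equal; apply Series_ext; intros k; now rewrite E.
Qed.

Lemma PS_plus a b z : disc_coeffs a -> disc_coeffs b -> Cmod z < 1 ->
  PS (fun k => a k + b k)%C z = (PS a z + PS b z)%C.
Proof.
intros Ha Hb Hz; apply C_is_series_unique.
eapply C_is_series_ext; [|apply C_is_series_plus; apply PS_is_series; eauto].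
intros k; cbv beta; ring.
Qed.

Lemma PS_scal c a z : disc_coeffs a -> Cmod z < 1 ->
  PS (fun k => c * a k)%C z = (c * PS a z)%C.
Proof.
intros Ha Hz; apply C_is_series_unique.
eapply C_is_series_ext; [|apply C_is_series_scal; apply PS_is_series; eauto].
intros k; cbv beta; ring.
Qed.

Lemma C_is_series_decr (u : nat -> C) (l : C) :
  C_is_series (fun k => u (S k)) l -> C_is_series u (u O + l)%C.
Proof.
intros H; apply (@is_series_decr_1 C_AbsRing C_NormedModule).
match goal with |- is_series _ ?x => replace x with l; [exact H|] end.
unfold plus, opp; simpl; ring.
Qed.

Lemma PS_decr a z : disc_coeffs a -> Cmod z < 1 ->
  PS a z = (a O + z * PS (fun k => a (S k)) z)%C.
Proof.
intros Ha Hz; apply C_is_series_unique.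
replace (a O) with (a O * z ^ 0)%C by (simpl; ring).
apply (C_is_series_decr (fun k => a k * z ^ k)%C).
eapply C_is_series_ext; [|apply C_is_series_scal, PS_is_series; [|apply Hz]].
- intros k; rewrite Cpow_S; cbv beta; ring.
- now apply (disc_coeffs_shift 1 a).
Qed.

Lemma PS_0 a : disc_coeffs a -> PS a (RtoC 0) = a O.
Proof.
intros Ha; rewrite PS_decr by (auto; rewrite Cmod_0; lra); ring.
Qed.

Definition dPS (a : nat -> C) (k : nat) : C := (RtoC (INR (S k)) * a (S k))%C.

Lemma disc_coeffs_dPS a : disc_coeffs a -> disc_coeffs (dPS a).
Proof.
intros Ha; apply (disc_coeffs_S (fun k => a (S k))), (disc_coeffs_shift 1 a), Ha.
Qed.

Lemma disc_coeffs_INR a : disc_coeffs a -> disc_coeffs (fun k => RtoC (INR k) * a k)%C.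
Proof.
intros Ha; apply disc_coeffs_le with (2 := disc_coeffs_S a Ha).
intros k; rewrite !Cmod_mult, !Cmod_R, !Rabs_pos_eq by apply pos_INR.
apply Rmult_le_compat_r; [apply Cmod_ge_0|rewrite S_INR; lra].
Qed.

Lemma PS_dPS_mult a z : disc_coeffs a -> Cmod z < 1 ->
  (z * PS (dPS a) z)%C = PS (fun k => RtoC (INR k) * a k)%C z.
Proof.
intros Ha Hz; rewrite (PS_decr (fun k => RtoC (INR k) * a k)%C)
  by auto using disc_coeffs_INR.
change (INR 0) with 0; unfold dPS; ring.
Qed.

(** The remainders satisfy R_(k+1) = (z + h) R_k + (k + 1) h^2 z^k. The factor s on the left stands
    for s^(k-1) on the right, which would be awkward at k = 0. *)
Lemma Cpow_remainder (z h : C) (s : R) (k : nat) :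
  Cmod z <= s -> Cmod (z + h)%C <= s -> 0 <= s ->
  Cmod ((z + h) ^ S k - z ^ S k - RtoC (INR (S k)) * z ^ k * h)%C * s
    <= INR (S k) ^ 2 * Cmod h ^ 2 * s ^ k.
Proof.
intros Hz Hzh Hs; induction k as [|k IH].
- replace ((z + h) ^ 1 - z ^ 1 - RtoC (INR 1) * z ^ 0 * h)%C with (RtoC 0)
    by (simpl; ring).
  rewrite Cmod_0, Rmult_0_l; simpl; assert (H := Cmod_ge_0 h); nra.
- set (R1 := ((z + h) ^ S k - z ^ S k - RtoC (INR (S k)) * z ^ k * h)%C) in *.
  replace ((z + h) ^ S (S k) - z ^ S (S k) - RtoC (INR (S (S k))) * z ^ S k * h)%C
    with ((z + h) * R1 + RtoC (INR (S k)) * (h * h) * z ^ k)%C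
    by (unfold R1; rewrite (S_INR (S k)), RtoC_plus, !Cpow_S; ring).
  assert (T := Cmod_triangle ((z + h) * R1)%C (RtoC (INR (S k)) * (h * h) * z ^ k)%C).
  rewrite !Cmod_mult, Cmod_R, Cmod_pow, (Rabs_pos_eq (INR (S k))) in T by apply pos_INR.
  assert (P := Cmod_ge_0 R1); assert (Q := Cmod_ge_0 h).
  assert (N := pos_INR (S k)); set (m := INR (S k)) in *.
  assert (Pz := Cmod_ge_0 z).
  assert (Z : Cmod z ^ k <= s ^ k) by (apply pow_incr; lra).
  assert (Sk : 0 <= s ^ k) by now apply pow_le.
  apply Rle_trans with ((Cmod (z + h)%C * Cmod R1 + m * (Cmod h * Cmod h) * Cmod z ^ k) * s);
    [apply Rmult_le_compat_r; auto|].
  assert (A : Cmod (z + h)%C * (Cmod R1 * s) <= s * (m ^ 2 * Cmod h ^ 2 * s ^ k)).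
  { apply Rmult_le_compat; auto; [apply Cmod_ge_0|nra]. }
  assert (B : m * (Cmod h * Cmod h) * Cmod z ^ k * s <= m * (Cmod h * Cmod h) * s ^ k * s).
  { apply Rmult_le_compat_r; auto; apply Rmult_le_compat_l; auto; nra. }
  rewrite (S_INR (S k)); fold m; simpl (s ^ S k).
  assert (0 <= Cmod h ^ 2 * s ^ k * s) by (repeat apply Rmult_le_pos; auto; nra).
  nra.
Qed.

(** The termwise remainders sum to at most 2 K |h|^2 / s, where K is the sum of |a_(k+1)| (k + 1)^2
    s^k; it is finite because [disc_coeffs] survives two multiplications by the index. *)
Lemma Cder_PS a z : disc_coeffs a -> Cmod z < 1 -> Cder (PS a) z (PS (dPS a) z).
Proof.
intros Ha Hz; assert (Pz := Cmod_ge_0 z).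
set (s := (1 + Cmod z) / 2).
assert (Hs : 0 < s < 1) by (unfold s; lra).
assert (Hzs : Cmod z < s) by (unfold s; lra).
assert (HA : ex_series (fun k => Cmod (a (S k)) * INR (S k) ^ 2 * s ^ k)).
{ apply (ex_series_ext (fun k => Cmod (RtoC (INR (S k)) * (RtoC (INR (S k)) * a (S k)))%C * s ^ k)).
  - intros k; rewrite !Cmod_mult, Cmod_R, Rabs_pos_eq by apply pos_INR.
    match goal with |- @eq _ ?x ?y => change (@eq R x y) end; ring.
  - apply disc_coeffs_abs; [|lra].
    apply disc_coeffs_S, disc_coeffs_dPS, Ha. }
set (K := Series (fun k => Cmod (a (S k)) * INR (S k) ^ 2 * s ^ k)).
assert (HK : 0 <= K).
{ rewrite <- (Rmult_0_l (Series (fun _ => 0))), <- Series_scal_l.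
  apply Series_le; auto; intros k; split; [lra|].
  rewrite Rmult_0_l; repeat apply Rmult_le_pos; try apply Cmod_ge_0; try apply pow_le; try lra; apply pos_INR. }
apply Cder_eps; intros eps Heps.
exists (Rmin (s - Cmod z) (eps * s / (2 * K + 1))); split.
{ apply Rmin_glb_lt; [lra|]; apply Rdiv_lt_0_compat; [apply Rmult_lt_0_compat|]; lra. }
intros h Hh.
assert (H1 := Rlt_le_trans _ _ _ Hh (Rmin_l _ _)).
assert (H2 := Rlt_le_trans _ _ _ Hh (Rmin_r _ _)).
assert (Hzh : Cmod (z + h)%C < s) by (eapply Rle_lt_trans; [apply Cmod_triangle|lra]).
set (u := fun k => (a (S k) * ((z + h) ^ S k - z ^ S k - RtoC (INR (S k)) * z ^ k * h))%C).
assert (Hu : forall k, Cmod (u k) * s <= (Cmod (a (S k)) * INR (S k) ^ 2 * s ^ k) * Cmod h ^ 2).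
{ intros k; unfold u; rewrite Cmod_mult, Rmult_assoc.
  replace (Cmod (a (S k)) * INR (S k) ^ 2 * s ^ k * Cmod h ^ 2)
    with (Cmod (a (S k)) * (INR (S k) ^ 2 * Cmod h ^ 2 * s ^ k)) by ring.
  apply Rmult_le_compat_l; [apply Cmod_ge_0|].
  apply Cpow_remainder; lra. }
assert (Hu' : forall k, Cmod (u k) <= (Cmod h ^ 2 / s) * (Cmod (a (S k)) * INR (S k) ^ 2 * s ^ k)).
{ intros k; replace (Cmod h ^ 2 / s * (Cmod (a (S k)) * INR (S k) ^ 2 * s ^ k))
    with ((Cmod (a (S k)) * INR (S k) ^ 2 * s ^ k) * Cmod h ^ 2 / s) by (field; lra).
  apply Rle_div_r; [lra|apply Hu]. }
assert (Eu : ex_series (fun k => Cmod (u k))).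
{ eapply ex_series_Rle with (2 := @ex_series_scal_l R_AbsRing R_NormedModule (Cmod h ^ 2 / s) _ HA).
  intros k; rewrite Rabs_pos_eq by apply Cmod_ge_0; apply Hu'. }
assert (S1 : C_is_series u (PS a (z + h) - PS a z - PS (dPS a) z * h)%C).
{ rewrite !(PS_decr a) by (auto; lra).
  set (b := fun k => a (S k)).
  assert (Hb : disc_coeffs b) by apply (disc_coeffs_shift 1 a), Ha.
  replace (a O + (z + h) * PS b (z + h) - (a O + z * PS b z) - PS (dPS a) z * h)%C
    with ((z + h) * PS b (z + h) + ((- z) * PS b z + (- h) * PS (dPS a) z))%C by ring.
  eapply C_is_series_ext;
    [|apply C_is_series_plus; [apply C_is_series_scal, PS_is_series; [exact Hb|lra]|
       apply C_is_series_plus; apply C_is_series_scal, PS_is_series; [exact Hb|lra|apply disc_coeffs_dPS, Ha|lra]]].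
  intros k; unfold u, b, dPS; rewrite !Cpow_S; cbv beta; ring. }
rewrite <- (C_is_series_unique _ _ S1).
eapply Rle_trans; [apply Cmod_C_Series, Eu|].
assert (Le : Series (fun k => Cmod (u k)) <= Cmod h ^ 2 / s * K).
{ unfold K; rewrite <- Series_scal_l; apply Series_le.
  - intros k; split; [apply Cmod_ge_0|apply Hu'].
  - apply (@ex_series_scal_l R_AbsRing R_NormedModule), HA. }
assert (Q := Cmod_ge_0 h).
apply Rlt_div_r in H2; [|lra].
apply Rle_trans with (2 * (Cmod h ^ 2 / s * K)); [lra|].
replace (2 * (Cmod h ^ 2 / s * K)) with (Cmod h * (Cmod h * (2 * K)) / s) by (field; lra).
apply Rle_div_l; [lra|].
replace (eps * Cmod h * s) with (Cmod h * (eps * s)) by ring.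
apply Rmult_le_compat_l; auto.
lra.
Qed.

(** The terms of a convergent series are bounded, and at the real point r this is the required bound
    at radius r. *)
Lemma disc_coeffs_of_series a N :
  (forall x : R, 0 < x < 1 -> exists l, C_is_series (fun j => a (N + j)%nat * RtoC x ^ (N + j))%C l) ->
  disc_coeffs a.
Proof.
intros H; apply (disc_coeffs_shift N); intros r Hr.
destruct (H r Hr) as [l Hl].
assert (Hb : exists B, forall j, Cmod (a (N + j)%nat * RtoC r ^ (N + j))%C <= B).
{ apply C_is_series_Re_Im in Hl; destruct Hl as [H1 H2].
  assert (Bd : forall v : nat -> R, ex_series v -> exists B, forall j, Rabs (v j) <= B).
  { intros v Hv; assert (L := ex_series_lim_0 _ Hv).
    destruct (@filterlim_bounded R_AbsRing R_NormedModule v) as [B HB]; [exists 0; exact L|].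
    exists B; exact HB. }
  destruct (Bd _ (ex_intro _ _ H1)) as [B1 HB1].
  destruct (Bd _ (ex_intro _ _ H2)) as [B2 HB2].
  exists (B1 + B2); intros j; eapply Rle_trans; [apply Cmod_le_Re_Im|].
  apply Rplus_le_compat; auto. }
destruct Hb as [B HB].
exists (B / r ^ N); intros k.
assert (0 < r ^ N) by (apply pow_lt; lra).
apply (Rle_div_r (Cmod (a (N + k)%nat) * r ^ k)); auto.
specialize (HB k); rewrite Cmod_mult, Cmod_pow, Cmod_R, Rabs_pos_eq, pow_add in HB by lra.
nra.
Qed.

(** * Maximum principle *)

Definition C2 (S : C -> Prop) (f : C -> C) : Prop :=
  exists f1 f2, forall z, S z -> Cder f z (f1 z) /\ Cder f1 z (f2 z).

Definition open_C (S : C -> Prop) : Prop :=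
  forall z, S z -> exists d, 0 < d /\ forall w, Cmod (w - z)%C < d -> S w.

Definition unit_square (z : C) : Prop := -1 <= Re z <= 1 /\ -1 <= Im z <= 1.

Lemma disc_unit_square (w : C) : Cmod w <= 1 -> unit_square w.
Proof.
intros Hw; split; apply Rabs_le_between;
  (eapply Rle_trans; [|apply Hw]); [apply re_le_Cmod|apply Rabs_Im_le].
Qed.

(** Compactness is used in the form of [compactness_value_2d], which covers rectangles; hence the
    square around the closed disc. Coordinates closer than rad / 2 give a modulus below rad. *)
Lemma lebesgue_number (rad : C -> R) : (forall z, 0 < rad z) ->
  exists d, 0 < d /\ forall w, unit_square w ->
    exists z, unit_square z /\ Cmod (w - z)%C < rad z /\ d <= rad z.
Proof.
intros Hrad.
assert (Hr2 : forall x y, 0 < rad (x, y) / 2) by (intros x y; assert (K := Hrad (x, y)); lra).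
destruct (compactness_value_2d (-1) 1 (-1) 1 (fun x y => mkposreal _ (Hr2 x y))) as [d Hd].
exists d; split; [apply cond_pos|]; intros [x y] [Hx Hy].
destruct (Classical_Prop.NNPP _ (Hd x y Hx Hy)) as (p & q & Hp & Hq & B1 & B2 & B3).
simpl in *; exists (p, q); split; [split; auto|]; assert (K := Hrad (p, q)); split; [|lra].
eapply Rle_lt_trans; [apply Cmod_le_Re_Im|]; simpl.
unfold Rminus in *; lra.
Qed.

(** Upper semicontinuity suffices for a maximum and spares lower estimates near the punctures. The
    maximiser is sought in the square and may lie outside the disc. *)
Lemma usc_max (v : C -> R) :
  (forall z eps, 0 < eps -> exists d, 0 < d /\
     forall w, Cmod (w - z)%C < d -> v w < v z + eps) ->
  exists z, forall w, Cmod w <= 1 -> v w <= v z.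
Proof.
intros H.
set (Q := unit_square).
assert (Cov := lebesgue_number); assert (Disc := disc_unit_square); fold Q in Cov, Disc.
set (E := fun y => exists z, Q z /\ v z = y).
assert (Bd : bound E).
{ destruct (choice (fun z d => 0 < d /\ forall w, Cmod (w - z)%C < d -> v w < v z + 1)
    (fun z => H z 1 Rlt_0_1)) as [r Hr].
  (* Radii at most 1 / (1 + |v z|) turn the Lebesgue number d into the upper bound 1 / d for v. *)
  destruct (Cov (fun z => Rmin (r z) (/ (1 + Rabs (v z))))) as [d [Hd K]].
  { intros z; apply Rmin_glb_lt; [apply Hr|].
    apply Rinv_0_lt_compat; assert (P := Rabs_pos (v z)); lra. }
  exists (/ d); intros y (w & Qw & <-).
  destruct (K w Qw) as (z & _ & K1 & K2).
  assert (V : v w < v z + 1) by (apply Hr; eapply Rlt_le_trans; [apply K1|apply Rmin_l]).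
  assert (P := Rabs_pos (v z)); assert (P' := Rle_abs (v z)).
  assert (K3 := Rle_trans _ _ _ K2 (Rmin_r _ _)).
  apply Rinv_le_contravar in K3; auto.
  rewrite Rinv_inv in K3; lra. }
assert (Ne : exists y, E y).
{ exists (v 0), 0; split; auto; apply Disc; rewrite Cmod_0; lra. }
destruct (completeness E Bd Ne) as [s [Ub Lub]].
destruct (classic (exists z, Q z /\ v z = s)) as [(z & Qz & Hz)|Hn].
{ exists z; intros w Hw; rewrite Hz; apply Ub; exists w; auto. }
exfalso.
assert (Lt : forall z, Q z -> v z < s).
{ intros z Qz; destruct (Ub (v z)) as [L|L]; auto; [now exists z|].
  exfalso; apply Hn; now exists z. }
destruct (choice (fun z d => 0 < d /\ (Q z -> forall w, Cmod (w - z)%C < d -> v w < v z + (s - v z) / 2)))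
  as [r Hr].
{ intros z; destruct (classic (Q z)) as [Qz|Nq].
  - assert (K := Lt z Qz); destruct (H z ((s - v z) / 2)) as (d & Hd & Hd'); [lra|].
    exists d; auto.
  - exists 1; split; [lra|]; now intros. }
(* If the supremum s is not attained, radii at most (s - v z) / 2 force v <= s - d on the whole
   square. *)
destruct (Cov (fun z => if excluded_middle_informative (Q z) then Rmin (r z) ((s - v z) / 2) else 1))
  as [d [Hd K]].
{ intros z; destruct (excluded_middle_informative (Q z)) as [Qz|Nq]; [|lra].
  apply Rmin_glb_lt; [apply Hr|]; assert (L := Lt z Qz); lra. }
assert (L : s <= s - d); [|lra].
apply Lub; intros y (w & Qw & <-).
destruct (K w Qw) as (z & Qz & K1 & K2).
destruct (excluded_middle_informative (Q z)) as [_|Nq]; [|easy].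
assert (V := proj2 (Hr z) Qz w (Rlt_le_trans _ _ _ K1 (Rmin_l _ _))).
assert (K3 := Rle_trans _ _ _ K2 (Rmin_r _ _)).
lra.
Qed.

(** The first derivative vanishes at 0, so a positive [c] makes [g1] positive just to the right of
    0, and by the mean value theorem [g] would exceed [g 0] there. *)
Lemma second_derivative_at_max (g g1 : R -> R) (c d : R) :
  0 < d -> (forall t, Rabs t < d -> is_derive g t (g1 t)) -> is_derive g1 0 c ->
  (forall t, Rabs t < d -> g t <= g 0) -> c <= 0.
Proof.
intros Hd Hg Hg1 Hmax.
assert (H0 : Rabs 0 < d) by now rewrite Rabs_R0.
assert (Z : g1 0 = 0).
{ assert (D0 := Hg 0 H0); apply is_derive_Reals in D0.
  assert (E := deriv_maximum g (- d) d 0 (exist _ _ D0)); unfold derive_pt in E; simpl in E; apply E; try lra.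
  intros x H1 H2; apply Hmax, Rabs_lt_between; lra. }
apply Rnot_lt_le; intros Hc.
destruct (little_o_of_derive g1 c Hg1 (c / 2)) as [e [He K]]; [lra|].
set (t := Rmin d e / 2).
assert (Hmin : 0 < Rmin d e) by now apply Rmin_glb_lt.
assert (Htd : t < d) by (assert (L := Rmin_l d e); unfold t; lra).
assert (Hte : t < e) by (assert (L := Rmin_r d e); unfold t; lra).
assert (Ht : 0 < t) by (unfold t; lra).
destruct (MVT_cor2 g g1 0 t Ht) as [s [E Hs]].
{ intros s Hs; apply is_derive_Reals, Hg; rewrite Rabs_pos_eq; lra. }
assert (Ks := K s ltac:(rewrite Rabs_pos_eq; lra)).
rewrite Z, Rminus_0_r, (Rabs_pos_eq s) in Ks by lra.
apply Rabs_le_between in Ks.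
assert (Hm := Hmax t ltac:(rewrite Rabs_pos_eq; lra)).
assert (0 < g1 s) by nra.
nra.
Qed.

(** This is ln |z|^2 + ln |z - a|^2 + |z|^2, written in real coordinates so that [auto_derive]
    applies along horizontal and vertical lines. *)
Definition barrier (a z : C) : R :=
  ln (Re z ^ 2 + Im z ^ 2) + ln ((Re z - Re a) ^ 2 + (Im z - Im a) ^ 2)
  + (Re z ^ 2 + Im z ^ 2).

Lemma sq_pos_of_neq (z a : C) : z <> a -> 0 < (Re z - Re a) ^ 2 + (Im z - Im a) ^ 2.
Proof.
intros H.
assert (0 <= (Re z - Re a) ^ 2) by apply pow2_ge_0.
assert (0 <= (Im z - Im a) ^ 2) by apply pow2_ge_0.
destruct (Req_dec (Re z) (Re a)) as [E1|N1].
- destruct (Req_dec (Im z) (Im a)) as [E2|N2]; [exfalso; apply H, C_eq; auto|].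
  assert (0 < (Im z - Im a) ^ 2) by (apply pow2_gt_0; lra); lra.
- assert (0 < (Re z - Re a) ^ 2) by (apply pow2_gt_0; lra); lra.
Qed.

(* Re F and both logarithms of barrier are harmonic, so Re F + e * barrier has Laplacian 4 e > 0. *)
Lemma no_interior_max (S : C -> Prop) (F : C -> C) (a z : C) (e : R) :
  open_C S -> C2 S F -> S z -> z <> RtoC 0 -> z <> a -> 0 < e ->
  (forall w, S w -> Re (F w) + e * barrier a w <= Re (F z) + e * barrier a z) -> False.
Proof.
intros OS (F1 & F2 & D) Sz Nz Na He Hmax.
destruct (OS z Sz) as (d0 & Hd0 & HS).
set (d := Rmin d0 (Rmin (Cmod z) (Cmod (z - a)%C))).
assert (Hd : 0 < d).
{ unfold d; repeat apply Rmin_glb_lt; auto; apply Cmod_gt_0; auto.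
  intros E; apply Na; replace z with (z - a + a)%C by ring; rewrite E; ring. }
assert (Ld0 : d <= d0) by apply Rmin_l.
assert (Ld1 : d <= Cmod z) by (unfold d; eapply Rle_trans; [apply Rmin_r|apply Rmin_l]).
assert (Ld2 : d <= Cmod (z - a)%C) by (unfold d; eapply Rle_trans; [apply Rmin_r|apply Rmin_r]).
assert (Near : forall h : C, Cmod h < d -> S (z + h)%C /\ (z + h)%C <> RtoC 0 /\ (z + h)%C <> a).
{ intros h Hh; split; [|split].
  - apply HS; replace (z + h - z)%C with h by ring; lra.
  - intros E; replace z with (z + h - h)%C in Ld1 by ring; rewrite E in Ld1.
    replace (0 - h)%C with (- h)%C in Ld1 by ring; rewrite Cmod_opp in Ld1; lra.
  - intros E; replace (z - a)%C with (z + h - a - h)%C in Ld2 by ring; rewrite E in Ld2.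
    replace (a - a - h)%C with (- h)%C in Ld2 by ring; rewrite Cmod_opp in Ld2; lra. }
set (x := Re z); set (y := Im z); set (p := Re a); set (q := Im a).
assert (Px := sq_pos_of_neq z 0 Nz); simpl in Px; rewrite !Rminus_0_r in Px.
assert (Pa := sq_pos_of_neq z a Na); fold x y p q in Pa; fold x y in Px.
assert (A : Re (F2 z) + e * (2 * (y ^ 2 - x ^ 2) / (x ^ 2 + y ^ 2) ^ 2
    + 2 * ((y - q) ^ 2 - (x - p) ^ 2) / ((x - p) ^ 2 + (y - q) ^ 2) ^ 2 + 2) <= 0).
{ apply (second_derivative_at_max
    (fun t => Re (F (z + RtoC t * 1)%C) + e * (ln ((x + t) ^ 2 + y ^ 2) + ln ((x + t - p) ^ 2 + (y - q) ^ 2) + ((x + t) ^ 2 + y ^ 2)))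
    (fun t => Re (F1 (z + RtoC t * 1)%C * 1)%C + e * (2 * (x + t) / ((x + t) ^ 2 + y ^ 2) + 2 * (x + t - p) / ((x + t - p) ^ 2 + (y - q) ^ 2) + 2 * (x + t))) _ d); auto.
  - intros t Ht.
    assert (Hm : Cmod (RtoC t * 1)%C < d) by now rewrite Cmult_1_r, Cmod_R.
    destruct (Near _ Hm) as (S1 & N1 & N2).
    assert (Q1 := sq_pos_of_neq _ _ N1); assert (Q2 := sq_pos_of_neq _ _ N2).
    fold p q in Q2; change (Re (RtoC 0)) with 0 in Q1; change (Im (RtoC 0)) with 0 in Q1.
    rewrite !Rminus_0_r in Q1.
    replace (Re (z + RtoC t * 1)%C) with (x + t) in Q1, Q2 by (unfold x, Re, Im; simpl; ring).
    replace (Im (z + RtoC t * 1)%C) with y in Q1, Q2 by (unfold y, Re, Im; simpl; ring).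
    apply (@is_derive_plus R_AbsRing R_NormedModule).
    + apply (Cder_line F z 1 (F1 (z + RtoC t * 1)%C) t), D, S1.
    + auto_derive.
      * repeat split; try apply Rgt_not_eq; simpl in *; lra.
      * field; split; apply Rgt_not_eq; lra.
  - apply (@is_derive_plus R_AbsRing R_NormedModule).
    + assert (K := proj1 (Cder_line F1 z 1 (F2 z) 0 ltac:(replace (z + 0 * 1)%C with z by ring; apply D, Sz))).
      rewrite Cmult_1_r in K.
      apply (is_derive_ext (fun s => Re (F1 (z + RtoC s * 1)%C))); [|exact K].
      intros t; f_equal; symmetry; apply Cmult_1_r.
    + auto_derive.
      * rewrite !Rplus_0_r; repeat split; apply Rgt_not_eq; simpl in *; lra.
      * rewrite !Rplus_0_r; field; split; apply Rgt_not_eq; lra.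
  - intros t Ht.
    assert (Hm : Cmod (RtoC t * 1)%C < d) by now rewrite Cmult_1_r, Cmod_R.
    destruct (Near _ Hm) as (S1 & _ & _).
    assert (M := Hmax _ S1).
    replace (z + 0 * 1)%C with z by ring.
    unfold barrier in M; fold x y p q in M.
    replace (Re (z + RtoC t * 1)%C) with (x + t) in M by (unfold x, Re, Im; simpl; ring).
    replace (Im (z + RtoC t * 1)%C) with y in M by (unfold y, Re, Im; simpl; ring).
    rewrite Rplus_0_r; exact M. }
(* In the direction [Ci] the second derivative of Re F is - Re F'', since i^2 = -1. *)
assert (B : - Re (F2 z) + e * (2 * (x ^ 2 - y ^ 2) / (x ^ 2 + y ^ 2) ^ 2
    + 2 * ((x - p) ^ 2 - (y - q) ^ 2) / ((x - p) ^ 2 + (y - q) ^ 2) ^ 2 + 2) <= 0).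
{ apply (second_derivative_at_max
    (fun t => Re (F (z + RtoC t * Ci)%C) + e * (ln (x ^ 2 + (y + t) ^ 2) + ln ((x - p) ^ 2 + (y + t - q) ^ 2) + (x ^ 2 + (y + t) ^ 2)))
    (fun t => Re (F1 (z + RtoC t * Ci)%C * Ci)%C + e * (2 * (y + t) / (x ^ 2 + (y + t) ^ 2) + 2 * (y + t - q) / ((x - p) ^ 2 + (y + t - q) ^ 2) + 2 * (y + t))) _ d); auto.
  - intros t Ht.
    assert (Hm : Cmod (RtoC t * Ci)%C < d) by now rewrite Cmod_mult, Cmod_Ci, Rmult_1_r, Cmod_R.
    destruct (Near _ Hm) as (S1 & N1 & N2).
    assert (Q1 := sq_pos_of_neq _ _ N1); assert (Q2 := sq_pos_of_neq _ _ N2).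
    fold p q in Q2; change (Re (RtoC 0)) with 0 in Q1; change (Im (RtoC 0)) with 0 in Q1.
    rewrite !Rminus_0_r in Q1.
    replace (Re (z + RtoC t * Ci)%C) with x in Q1, Q2 by (unfold x, Re, Im; simpl; ring).
    replace (Im (z + RtoC t * Ci)%C) with (y + t) in Q1, Q2 by (unfold y, Re, Im; simpl; ring).
    apply (@is_derive_plus R_AbsRing R_NormedModule).
    + apply (Cder_line F z Ci (F1 (z + RtoC t * Ci)%C) t), D, S1.
    + auto_derive.
      * repeat split; try apply Rgt_not_eq; simpl in *; lra.
      * field; split; apply Rgt_not_eq; lra.
  - apply (@is_derive_plus R_AbsRing R_NormedModule).
    + assert (K := proj2 (Cder_line F1 z Ci (F2 z) 0 ltac:(replace (z + 0 * Ci)%C with z by ring; apply D, Sz))).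
      replace (Im (F2 z * Ci)%C) with (Re (F2 z)) in K by (unfold Re, Im; simpl; ring).
      apply (is_derive_ext (fun s => - Im (F1 (z + RtoC s * Ci)%C))).
      { intros t; unfold Re, Im; simpl; ring. }
      apply (@is_derive_opp R_AbsRing R_NormedModule), K.
    + auto_derive.
      * rewrite !Rplus_0_r; repeat split; apply Rgt_not_eq; simpl in *; lra.
      * rewrite !Rplus_0_r; field; split; apply Rgt_not_eq; lra.
  - intros t Ht.
    assert (Hm : Cmod (RtoC t * Ci)%C < d) by now rewrite Cmod_mult, Cmod_Ci, Rmult_1_r, Cmod_R.
    destruct (Near _ Hm) as (S1 & _ & _).
    assert (M := Hmax _ S1).
    replace (z + 0 * Ci)%C with z by ring.
    unfold barrier in M; fold x y p q in M.
    replace (Re (z + RtoC t * Ci)%C) with x in M by (unfold x, Re, Im; simpl; ring).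
    replace (Im (z + RtoC t * Ci)%C) with (y + t) in M by (unfold y, Re, Im; simpl; ring).
    rewrite Rplus_0_r; exact M. }
(* The logarithms contribute opposite amounts in the two directions, as does F, so adding the two
   inequalities leaves 4 e <= 0. *)
assert (X : 2 * (y ^ 2 - x ^ 2) / (x ^ 2 + y ^ 2) ^ 2 = - (2 * (x ^ 2 - y ^ 2) / (x ^ 2 + y ^ 2) ^ 2))
  by (field; lra).
assert (Y : 2 * ((y - q) ^ 2 - (x - p) ^ 2) / ((x - p) ^ 2 + (y - q) ^ 2) ^ 2
  = - (2 * ((x - p) ^ 2 - (y - q) ^ 2) / ((x - p) ^ 2 + (y - q) ^ 2) ^ 2)) by (field; lra).
rewrite X, Y in A; nra.
Qed.

Lemma C2_Cder S f z : C2 S f -> S z -> exists l, Cder f z l.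
Proof. intros (f1 & f2 & H) Hz; exists (f1 z); apply H, Hz. Qed.

Lemma Ccont_Re (F : C -> C) z : Ccont F z -> forall eps, 0 < eps -> exists d, 0 < d /\
  forall w, Cmod (w - z)%C < d -> Rabs (Re (F w) - Re (F z)) < eps.
Proof.
intros H eps He; destruct (H eps He) as (d & Hd & K); exists d; split; auto.
intros w Hw; eapply Rle_lt_trans; [|apply (K w Hw)]; apply (re_le_Cmod (F w - F z)%C).
Qed.

Lemma continuous_barrier (a z : C) : z <> RtoC 0 -> z <> a ->
  forall eps, 0 < eps -> exists d, 0 < d /\
    forall w, Cmod (w - z)%C < d -> Rabs (barrier a w - barrier a z) < eps.
Proof.
intros N0 Na; apply continuous_C_eps.
assert (Px := sq_pos_of_neq z 0 N0); simpl in Px; rewrite !Rminus_0_r in Px.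
assert (Pa := sq_pos_of_neq z a Na).
assert (Sq : forall c : R, @continuous C_UniformSpace R_UniformSpace (fun x => (Re x - c) ^ 2) z).
{ intros c; apply (@continuous_comp C_UniformSpace R_UniformSpace R_UniformSpace (fun x => Re x) (fun t => (t - c) ^ 2)).
  - apply continuous_fst.
  - apply (@ex_derive_continuous R_AbsRing R_NormedModule); auto_derive; auto. }
assert (Sq' : forall c : R, @continuous C_UniformSpace R_UniformSpace (fun x => (Im x - c) ^ 2) z).
{ intros c; apply (@continuous_comp C_UniformSpace R_UniformSpace R_UniformSpace (fun x => Im x) (fun t => (t - c) ^ 2)).
  - apply continuous_snd.
  - apply (@ex_derive_continuous R_AbsRing R_NormedModule); auto_derive; auto. }
assert (Sum : forall c d : R, @continuous C_UniformSpace R_UniformSpace (fun x => (Re x - c) ^ 2 + (Im x - d) ^ 2) z).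
{ intros c d; apply (@continuous_plus C_UniformSpace R_AbsRing R_NormedModule); auto. }
assert (Sum0 : @continuous C_UniformSpace R_UniformSpace (fun x => Re x ^ 2 + Im x ^ 2) z).
{ apply (@continuous_ext C_UniformSpace R_UniformSpace (fun x => (Re x - 0) ^ 2 + (Im x - 0) ^ 2)); auto.
  intros x; now rewrite !Rminus_0_r. }
unfold barrier.
apply (@continuous_plus C_UniformSpace R_AbsRing R_NormedModule); auto.
apply (@continuous_plus C_UniformSpace R_AbsRing R_NormedModule).
- apply (@continuous_comp C_UniformSpace R_UniformSpace R_UniformSpace (fun x => Re x ^ 2 + Im x ^ 2) ln); auto.
  apply (@ex_derive_continuous R_AbsRing R_NormedModule); auto_derive; simpl; auto.
- apply (@continuous_comp C_UniformSpace R_UniformSpace R_UniformSpace (fun x => (Re x - Re a) ^ 2 + (Im x - Im a) ^ 2) ln); auto.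
  apply (@ex_derive_continuous R_AbsRing R_NormedModule); auto_derive; simpl; auto.
Qed.

Lemma Cmod_sq (z : C) : Re z ^ 2 + Im z ^ 2 = Cmod z ^ 2.
Proof. symmetry; apply Cmod2_alt. Qed.

Lemma Cmod_minus_sq (z a : C) : (Re z - Re a) ^ 2 + (Im z - Im a) ^ 2 = Cmod (z - a)%C ^ 2.
Proof. rewrite Cmod2_alt; f_equal; f_equal; simpl; ring. Qed.

Lemma ln_le_0 x : 0 < x <= 1 -> ln x <= 0.
Proof. intros H; rewrite <- ln_1; apply ln_le; lra. Qed.

Lemma ln_sq_small (K : R) : exists d, 0 < d /\ forall r, 0 < r < d -> ln (r ^ 2) < K.
Proof.
exists (Rmin 1 (exp K)); split; [apply Rmin_glb_lt; [lra|apply exp_pos]|].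
intros r Hr.
assert (r < 1) by (eapply Rlt_le_trans; [apply Hr|apply Rmin_l]).
assert (r < exp K) by (eapply Rlt_le_trans; [apply Hr|apply Rmin_r]).
rewrite <- (ln_exp K); apply ln_increasing; [apply pow_lt; lra|].
assert (r ^ 2 < r) by nra; lra.
Qed.

Definition punctured (a z : C) : Prop := in_disc z /\ z <> RtoC 0 /\ z <> a.

Lemma open_punctured a : open_C (punctured a).
Proof.
intros z (Hz & N0 & Na); unfold in_disc in Hz.
assert (P0 := proj1 (Cmod_gt_0 z) N0).
assert (Pa : 0 < Cmod (z - a)%C).
{ apply Cmod_gt_0; intros E; apply Na; replace z with (z - a + a)%C by ring; rewrite E; ring. }
exists (Rmin (1 - Cmod z) (Rmin (Cmod z) (Cmod (z - a)%C))); split.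
{ repeat apply Rmin_glb_lt; auto; lra. }
intros w Hw.
assert (L1 := Rlt_le_trans _ _ _ Hw (Rmin_l _ _)).
assert (L2 := Rlt_le_trans _ _ _ Hw (Rmin_r _ _)).
assert (L3 := Rlt_le_trans _ _ _ L2 (Rmin_l _ _)).
assert (L4 := Rlt_le_trans _ _ _ L2 (Rmin_r _ _)).
split; [|split].
- unfold in_disc; assert (T := Cmod_triangle (w - z)%C z); replace (w - z + z)%C with w in T by ring; lra.
- intros ->; replace (0 - z)%C with (- z)%C in L3 by ring; rewrite Cmod_opp in L3; lra.
- intros ->; replace (a - z)%C with (- (z - a))%C in L4 by ring; rewrite Cmod_opp in L4; lra.
Qed.

(* The barrier tends to -oo at 0 and at a, which makes the bounded singularities there invisible. *)
Lemma maximum_principle (a : C) (g : C -> C) (M : R) :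
  in_disc a -> C2 (punctured a) g ->
  (exists d K, 0 < d /\ forall z, punctured a z -> Cmod z < d -> Cmod (g z) <= K) ->
  (exists d K, 0 < d /\ forall z, punctured a z -> Cmod (z - a)%C < d -> Cmod (g z) <= K) ->
  (forall eps, 0 < eps -> exists rho, rho < 1 /\
     forall z, punctured a z -> rho < Cmod z -> Cmod (g z) <= M + eps) ->
  forall z, punctured a z -> Cmod (g z) <= M.
Proof.
intros Ha Hg (d0 & K0 & Hd0 & B0) (da & Ka & Hda & Ba) Hbd z0 Hz0.
apply Rnot_lt_le; intros Hlt.
(* The excess 4 [eta] is split evenly around [m] = M + 2 [eta]: near the rim |g| <= M + [eta], at
   [z0] |g| = [m] + 2 [eta], and the perturbation costs less than [eta] in both places. *)
set (eta := (Cmod (g z0) - M) / 4).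
assert (Heta : 0 < eta) by (unfold eta; lra).
destruct (Hbd eta Heta) as (rho0 & Hrho0 & Hb).
assert (Dz0 : Cmod z0 < 1) by apply Hz0.
assert (Da : Cmod a < 1) by apply Ha.
set (rho := (1 + Rmax rho0 (Rmax (Cmod z0) (Cmod a))) / 2).
assert (Hmx : Rmax rho0 (Rmax (Cmod z0) (Cmod a)) < 1) by (repeat apply Rmax_lub_lt; auto).
assert (R0 : rho0 < rho) by (unfold rho; assert (L := Rmax_l rho0 (Rmax (Cmod z0) (Cmod a))); lra).
assert (R1 : Cmod z0 < rho) by (unfold rho; assert (L := Rmax_r rho0 (Rmax (Cmod z0) (Cmod a)));
  assert (L' := Rmax_l (Cmod z0) (Cmod a)); lra).
assert (R2 : Cmod a < rho) by (unfold rho; assert (L := Rmax_r rho0 (Rmax (Cmod z0) (Cmod a)));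
  assert (L' := Rmax_r (Cmod z0) (Cmod a)); lra).
assert (R3 : rho < 1) by (unfold rho; lra).
assert (Pz := Cmod_ge_0 z0).
(* A unimodular factor rotating [g z0] onto the positive axis: Re (u g) <= |g| everywhere, with
   equality at [z0]. *)
set (u := (Cconj (g z0) / RtoC (Cmod (g z0)))%C).
assert (Gz : 0 <= Cmod (g z0)) by apply Cmod_ge_0.
destruct (Req_dec (Cmod (g z0)) 0) as [G0|Gn0].
{ (* Here M < 0, contradicting the bound near the boundary. *)
  set (t := (rho + 1) / 2).
  assert (Pt : punctured a (RtoC t)).
  { assert (E : Cmod (RtoC t) = t) by (rewrite Cmod_R, Rabs_pos_eq; unfold t; lra).
    split; [unfold in_disc; rewrite E; unfold t; lra|]; split; intros E'.
    - rewrite E', Cmod_0 in E; unfold t in E; lra.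
    - rewrite E' in E; unfold t in E; lra. }
  assert (Hbt := Hb _ Pt ltac:(rewrite Cmod_R, Rabs_pos_eq; unfold t; lra)).
  assert (P := Cmod_ge_0 (g (RtoC t))); unfold eta in Hbt; lra. }
assert (Gp : 0 < Cmod (g z0)) by lra.
assert (Gc : RtoC (Cmod (g z0)) <> RtoC 0) by (intros E; apply RtoC_inj in E; lra).
assert (Hu : Cmod u = 1).
{ unfold u; rewrite Cmod_div, Cmod_conj, Cmod_R, Rabs_pos_eq by auto; field; lra. }
assert (Huz : Re (u * g z0)%C = Cmod (g z0)).
{ replace (u * g z0)%C with (RtoC (Cmod (g z0))); [reflexivity|].
  unfold u; replace (Cconj (g z0) / RtoC (Cmod (g z0)) * g z0)%C
    with ((g z0 * Cconj (g z0)) / RtoC (Cmod (g z0)))%C by (field; auto).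
  rewrite <- Cmod2_conj; rewrite RtoC_pow; field; auto. }
set (F := fun z => (u * g z)%C).
assert (HF : C2 (punctured a) F).
{ destruct Hg as (g1 & g2 & D); exists (fun z => (u * g1 z)%C), (fun z => (u * g2 z)%C).
  intros z Hz; split; apply Cder_scal, D, Hz. }
assert (ReF : forall z, Re (F z) <= Cmod (g z)).
{ intros z; eapply Rle_trans; [apply Rle_abs|]; eapply Rle_trans; [apply re_le_Cmod|].
  unfold F; rewrite Cmod_mult, Hu; lra. }
set (m := M + 2 * eta).
assert (Hm : Cmod (g z0) = m + 2 * eta) by (unfold m, eta; lra).
assert (L4 : 0 < ln 4) by (rewrite <- ln_1; apply ln_increasing; lra).
(* On the punctured disc the barrier is at most ln 4 + 1, because |z - a| < 2. The two terms of the
   minimum keep [e * barrier] below [eta] there and above - [eta] at [z0]. *)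
set (e := Rmin (eta / (2 * (ln 4 + 1))) (eta / (Rabs (barrier a z0) + 1))).
assert (He1 : e * (ln 4 + 1) < eta).
{ apply Rle_lt_trans with (eta / (2 * (ln 4 + 1)) * (ln 4 + 1)).
  - apply Rmult_le_compat_r; [lra|apply Rmin_l].
  - replace (eta / (2 * (ln 4 + 1)) * (ln 4 + 1)) with (eta / 2) by (field; lra); lra. }
assert (Pb := Rabs_pos (barrier a z0)).
assert (He : 0 < e) by (unfold e; apply Rmin_glb_lt; apply Rdiv_lt_0_compat; lra).
assert (He2 : e * Rabs (barrier a z0) < eta).
{ apply Rlt_le_trans with (e * (Rabs (barrier a z0) + 1)); [apply Rmult_lt_compat_l; lra|].
  apply Rle_div_r; [lra|apply Rmin_r]. }
set (v := fun z => Re (F z) + e * barrier a z).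
assert (Vz0 : m < v z0).
{ unfold v; change (Re (F z0)) with (Re (u * g z0)%C); rewrite Huz.
  assert (A := Rabs_le_between (barrier a z0) (Rabs (barrier a z0))).
  destruct A as [A _]; specialize (A (Rle_refl _)); nra. }
assert (Bup : forall z, punctured a z ->
  barrier a z <= ln 4 + 1 /\ barrier a z <= ln (Cmod z ^ 2) + (ln 4 + 1) /\
  barrier a z <= ln (Cmod (z - a)%C ^ 2) + (ln 4 + 1)).
{ intros z (Hz & N0 & Na); unfold barrier; rewrite Cmod_minus_sq, Cmod_sq.
  unfold in_disc in *.
  assert (Pz0 := proj1 (Cmod_gt_0 z) N0).
  assert (Pa : 0 < Cmod (z - a)%C).
  { apply Cmod_gt_0; intros E; apply Na; replace z with (z - a + a)%C by ring; rewrite E; ring. }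
  assert (T := Cmod_triangle z (- a)%C); rewrite Cmod_opp in T; change (z + - a)%C with (z - a)%C in T.
  assert (l1 : ln (Cmod z ^ 2) <= 0) by (apply ln_le_0; split; [apply pow_lt; auto|nra]).
  assert (l2 : ln (Cmod (z - a)%C ^ 2) <= ln 4) by (apply ln_le; [apply pow_lt; auto|nra]).
  assert (Cmod z ^ 2 <= 1) by nra.
  lra. }
set (D := fun z => punctured a z /\ Cmod z < rho).
(* Cutting [v] off at [m] and extending by [m] gives a function on the whole plane that does not see
   the junk values at 0 and a. As [v z0] exceeds [m], a maximiser must lie in [D]. *)
set (vh := fun z => if excluded_middle_informative (D z) then Rmax (v z) m else m).
assert (Vcont : forall z, punctured a z -> forall eps, 0 < eps -> exists d, 0 < d /\
   forall w, Cmod (w - z)%C < d -> v w < v z + eps).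
{ intros z Hz eps Heps.
  destruct (C2_Cder _ _ _ HF Hz) as [l Hl].
  destruct (Ccont_Re F z (Cder_Ccont _ _ _ Hl) (eps / 2)) as (d1 & Hd1 & C1); [lra|].
  destruct (continuous_barrier a z (proj1 (proj2 Hz)) (proj2 (proj2 Hz)) (eps / 2 / e)) as (d2 & Hd2 & C2').
  { apply Rdiv_lt_0_compat; lra. }
  exists (Rmin d1 d2); split; [now apply Rmin_glb_lt|].
  intros w Hw.
  specialize (C1 w (Rlt_le_trans _ _ _ Hw (Rmin_l _ _))).
  specialize (C2' w (Rlt_le_trans _ _ _ Hw (Rmin_r _ _))).
  apply Rabs_lt_between in C1; apply Rabs_lt_between in C2'.
  assert (e * (barrier a w - barrier a z) < e * (eps / 2 / e)) by (apply Rmult_lt_compat_l; lra).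
  replace (e * (eps / 2 / e)) with (eps / 2) in H by (field; lra).
  unfold v; lra. }
assert (Vlow : forall z, (D z -> v z <= m) -> vh z = m).
{ intros z H; unfold vh; destruct (excluded_middle_informative (D z)); auto.
  apply Rmax_right; auto. }
assert (Vge : forall z, m <= vh z).
{ intros z; unfold vh; destruct (excluded_middle_informative (D z)); [apply Rmax_r|lra]. }
destruct (usc_max vh) as [zs Hzs].
{ intros z eps Heps.
  (* Where v <= m holds nearby, [vh] is locally constant. This covers 0 and a (the barrier wins over
     the bound for g), the rim, and everything beyond it. *)
  assert (Loc : (exists d, 0 < d /\ forall w, Cmod (w - z)%C < d -> D w -> v w <= m) ->
     exists d, 0 < d /\ forall w, Cmod (w - z)%C < d -> vh w < vh z + eps).
  { intros (d & Hd & H); exists d; split; auto; intros w Hw.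
    rewrite (Vlow w) by auto; assert (K := Vge z); lra. }
  destruct (Ceq_dec z 0) as [->|N0].
  { apply Loc.
    destruct (ln_sq_small ((m - K0) / e - (ln 4 + 1))) as (d & Hd & L).
    exists (Rmin d d0); split; [now apply Rmin_glb_lt|].
    intros w Hw (Pw & _); replace (w - 0)%C with w in Hw by ring.
    assert (Bw := B0 w Pw (Rlt_le_trans _ _ _ Hw (Rmin_r _ _))).
    assert (Lw := L (Cmod w) (conj (proj1 (Cmod_gt_0 w) (proj1 (proj2 Pw))) (Rlt_le_trans _ _ _ Hw (Rmin_l _ _)))).
    destruct (Bup w Pw) as (_ & U & _); assert (Rw := ReF w).
    assert (e * barrier a w <= e * ((m - K0) / e)) by (apply Rmult_le_compat_l; lra).
    replace (e * ((m - K0) / e)) with (m - K0) in H by (field; lra).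
    unfold v; lra. }
  destruct (Ceq_dec z a) as [->|Na].
  { apply Loc.
    destruct (ln_sq_small ((m - Ka) / e - (ln 4 + 1))) as (d & Hd & L).
    exists (Rmin d da); split; [now apply Rmin_glb_lt|].
    intros w Hw (Pw & _).
    assert (Bw := Ba w Pw (Rlt_le_trans _ _ _ Hw (Rmin_r _ _))).
    assert (Pwa : 0 < Cmod (w - a)%C).
    { apply Cmod_gt_0; intros E; apply (proj2 (proj2 Pw)); replace w with (w - a + a)%C by ring; rewrite E; ring. }
    assert (Lw := L _ (conj Pwa (Rlt_le_trans _ _ _ Hw (Rmin_l _ _)))).
    destruct (Bup w Pw) as (_ & _ & U); assert (Rw := ReF w).
    assert (e * barrier a w <= e * ((m - Ka) / e)) by (apply Rmult_le_compat_l; lra).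
    replace (e * ((m - Ka) / e)) with (m - Ka) in H by (field; lra).
    unfold v; lra. }
  destruct (Rlt_le_dec rho (Cmod z)) as [Out|In].
  { apply Loc; exists (Cmod z - rho); split; [lra|].
    intros w Hw (_ & Hw'); exfalso.
    assert (T := Cmod_triangle (- (w - z))%C w); rewrite Cmod_opp in T.
    replace (- (w - z) + w)%C with z in T by ring; lra. }
  assert (Pz' : punctured a z) by (split; [unfold in_disc; lra|auto]).
  destruct (Rlt_le_dec (Cmod z) rho) as [In'|Edge].
  - destruct (Vcont z Pz' eps Heps) as (d & Hd & H); exists d; split; auto.
    intros w Hw; specialize (H w Hw).
    assert (Ez : v z <= vh z).
    { unfold vh; destruct (excluded_middle_informative (D z)) as [_|n]; [apply Rmax_l|].
      exfalso; apply n; split; auto. }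
    assert (K := Vge z).
    unfold vh at 1; destruct (excluded_middle_informative (D w)); [apply Rmax_lub_lt|]; lra.
  - apply Loc.
    assert (V1 : v z < m).
    { unfold v; assert (X := Hb z Pz' ltac:(lra)); assert (Y := ReF z).
      destruct (Bup z Pz') as (U & _).
      assert (e * barrier a z <= e * (ln 4 + 1)) by (apply Rmult_le_compat_l; lra).
      unfold m; lra. }
    destruct (Vcont z Pz' (m - v z)) as (d & Hd & H); [lra|].
    exists d; split; auto; intros w Hw _; specialize (H w Hw); lra. }
assert (Top : m < vh zs).
{ apply Rlt_le_trans with (vh z0); [|apply Hzs; lra].
  unfold vh; destruct (excluded_middle_informative (D z0)) as [_|n].
  - eapply Rlt_le_trans; [apply Vz0|apply Rmax_l].
  - exfalso; apply n; split; auto. }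
unfold vh in Top at 1; destruct (excluded_middle_informative (D zs)) as [Ds|]; [|lra].
assert (Evs : vh zs = v zs).
{ unfold vh; destruct (excluded_middle_informative (D zs)); [|easy].
  apply Rmax_left; destruct (Rle_dec (v zs) m); [rewrite Rmax_right in Top|]; lra. }
destruct Ds as [Ps Hs].
apply (no_interior_max D F a zs e); auto.
- intros z (Pz' & Hz'); destruct (open_punctured a z Pz') as (d & Hd & K).
  exists (Rmin d (rho - Cmod z)); split; [apply Rmin_glb_lt; lra|].
  intros w Hw; split; [apply K; eapply Rlt_le_trans; [apply Hw|apply Rmin_l]|].
  assert (Hw' := Rlt_le_trans _ _ _ Hw (Rmin_r _ _)).
  assert (T := Cmod_triangle (w - z)%C z); replace (w - z + z)%C with w in T by ring; lra.
- destruct HF as (f1 & f2 & H); exists f1, f2; intros z (Pz' & _); auto.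
- split; auto.
- apply Ps.
- apply Ps.
- intros w Dw; change (v w <= v zs); rewrite <- Evs.
  eapply Rle_trans; [|apply (Hzs w)]; [|destruct Dw; lra].
  unfold vh; destruct (excluded_middle_informative (D w)); [apply Rmax_l|easy].
Qed.

(** * Schwarz-Pick estimates at a zero of order n *)

Lemma C2_sub (S T : C -> Prop) f : (forall z, T z -> S z) -> C2 S f -> C2 T f.
Proof. intros H (f1 & f2 & D); exists f1, f2; auto. Qed.

Lemma C2_const S c : C2 S (fun _ => c).
Proof. exists (fun _ => RtoC 0), (fun _ => RtoC 0); split; apply Cder_const. Qed.

Lemma C2_id S : C2 S (fun z => z).
Proof. exists (fun _ => RtoC 1), (fun _ => RtoC 0); split; [apply Cder_id|apply Cder_const]. Qed.

Lemma C2_plus S f g : C2 S f -> C2 S g -> C2 S (fun z => f z + g z)%C.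
Proof.
intros (f1 & f2 & F) (g1 & g2 & G); exists (fun z => f1 z + g1 z)%C, (fun z => f2 z + g2 z)%C.
intros z Hz; destruct (F z Hz), (G z Hz); split; now apply Cder_plus.
Qed.

Lemma C2_minus S f g : C2 S f -> C2 S g -> C2 S (fun z => f z - g z)%C.
Proof.
intros (f1 & f2 & F) (g1 & g2 & G); exists (fun z => f1 z - g1 z)%C, (fun z => f2 z - g2 z)%C.
intros z Hz; destruct (F z Hz), (G z Hz); split; now apply Cder_minus.
Qed.

Lemma C2_mult S f g : C2 S f -> C2 S g -> C2 S (fun z => f z * g z)%C.
Proof.
intros (f1 & f2 & F) (g1 & g2 & G); exists (fun z => f1 z * g z + f z * g1 z)%C.
eexists; intros z Hz; destruct (F z Hz) as [Fa Fb], (G z Hz) as [Ga Gb]; split.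
- apply Cder_mult; eauto.
- apply Cder_plus; apply Cder_mult; eauto.
Qed.

Lemma C2_inv S f : (forall z, S z -> f z <> RtoC 0) -> C2 S f -> C2 S (fun z => / f z)%C.
Proof.
intros Nz (f1 & f2 & F); exists (fun z => (RtoC 0 - f1 z) / (f z * f z))%C.
eexists; intros z Hz; destruct (F z Hz) as [Fa Fb]; split.
- eapply Cder_eq; [apply Cder_inv; eauto|]; field; auto.
- apply Cder_div; [apply Cmult_neq_0; auto| |apply Cder_mult; eauto].
  apply Cder_minus; [apply Cder_const|eauto].
Qed.

Lemma C2_div S f g : (forall z, S z -> g z <> RtoC 0) -> C2 S f -> C2 S g ->
  C2 S (fun z => f z / g z)%C.
Proof. intros; apply C2_mult; auto; now apply C2_inv. Qed.

Lemma C2_pow S f n : C2 S f -> C2 S (fun z => f z ^ n)%C.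
Proof.
intros H; induction n as [|n IH]; [exact (C2_const S (RtoC 1))|].
now apply (C2_mult S f (fun z => f z ^ n)%C).
Qed.

Lemma inv_pow_near_1 (n : nat) (eps : R) : 0 < eps ->
  exists rho, 0 < rho < 1 /\ forall r, rho < r < 1 -> 1 <= (1 + eps) * r ^ n.
Proof.
revert eps; induction n as [|n IH]; intros eps He.
- exists (1 / 2); split; [lra|]; intros; simpl; lra.
(* For e <= 1 one has (1 + e)^2 <= 1 + 3 e <= 1 + eps: one factor pays for r^n, the other for the
   additional r. *)
- set (e := Rmin (eps / 3) 1).
  assert (L1 : e <= eps / 3) by apply Rmin_l.
  assert (L2 : e <= 1) by apply Rmin_r.
  assert (Pe : 0 < e) by (apply Rmin_glb_lt; lra).
  destruct (IH e Pe) as (rho & Hrho & H).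
  exists (Rmax rho (/ (1 + e))); split.
  + split; [eapply Rlt_le_trans; [apply Hrho|apply Rmax_l]|].
    apply Rmax_lub_lt; [lra|]; rewrite <- Rinv_1; apply Rinv_lt_contravar; lra.
  + intros r (Hr1 & Hr2).
    assert (A := H r (conj (Rle_lt_trans _ _ _ (Rmax_l _ _) Hr1) Hr2)).
    assert (B := Rle_lt_trans _ _ _ (Rmax_r _ _) Hr1).
    assert (B' : 1 <= (1 + e) * r).
    { apply (Rmult_lt_compat_l (1 + e)) in B; [|lra]; rewrite Rinv_r in B; lra. }
    assert (0 < r ^ n) by (apply pow_lt; assert (Q := Rle_lt_trans _ _ _ (Rmax_l _ _) Hr1); lra).
    simpl.
    assert (1 * 1 <= ((1 + e) * r ^ n) * ((1 + e) * r)) by (apply Rmult_le_compat; lra).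
    assert ((1 + e) * (1 + e) <= 1 + eps) by nra.
    assert (0 < r) by (assert (Q := Rle_lt_trans _ _ _ (Rmax_l _ _) Hr1); lra).
    assert ((1 + e) * (1 + e) * (r * r ^ n) <= (1 + eps) * (r * r ^ n)).
    { apply Rmult_le_compat_r; auto; apply Rmult_le_pos; lra. }
    lra.
Qed.

(** The maximum principle is applied to phi / z^n with both punctures at 0. The order of vanishing
    bounds the quotient there, and near the unit circle |z|^n is close to 1. *)
Lemma schwarz_order (phi : C -> C) (n : nat) :
  C2 in_disc phi -> (forall z, in_disc z -> in_disc (phi z)) ->
  (exists d K, 0 < d /\ forall z, Cmod z < d -> Cmod (phi z) <= K * Cmod z ^ n) ->
  forall z, in_disc z -> z <> RtoC 0 -> Cmod (phi z / z ^ n)%C <= 1.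
Proof.
intros H2 Hd (d & K & Pd & HK) z Hz Nz.
assert (D0 : in_disc (RtoC 0)) by (unfold in_disc; rewrite Cmod_0; lra).
assert (Bd : exists d K, 0 < d /\ forall z, punctured 0 z -> Cmod z < d -> Cmod (phi z / z ^ n)%C <= K).
{ exists d, K; split; auto; intros w (Dw & Nw & _) Hw.
  rewrite Cmod_div, Cmod_pow by now apply Cpow_nz.
  apply Rle_div_l; [apply Rlt_gt, pow_lt, Cmod_gt_0, Nw|]; auto. }
apply (maximum_principle 0 (fun w => phi w / w ^ n)%C 1); auto.
- apply C2_div.
  + intros w (_ & Nw & _); now apply Cpow_nz.
  + apply (C2_sub in_disc); auto; intros w Hw; apply Hw.
  + apply (C2_pow _ (fun w => w)), C2_id.
- destruct Bd as (d' & K' & Hd' & HB); exists d', K'; split; auto; intros w Hw Hw'.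
  apply HB; auto; now replace (w - 0)%C with w in Hw' by ring.
- intros eps He; destruct (inv_pow_near_1 n eps He) as (rho & Hrho & H).
  exists rho; split; [lra|]; intros w (Dw & Nw & _) Hw.
  rewrite Cmod_div, Cmod_pow by now apply Cpow_nz.
  apply Rle_div_l; [apply Rlt_gt, pow_lt, Cmod_gt_0, Nw|].
  assert (A := Hd w Dw); unfold in_disc in A, Dw.
  assert (B := H (Cmod w) (conj Hw Dw)); lra.
- split; auto.
Qed.

(** The classical reason why (z - a) / (1 - conj a z) maps the disc to itself and has modulus
    tending to 1 at the circle; the Schwarz-Pick proof uses both facts. *)
Lemma Cmod_mobius_identity (a z : C) :
  Cmod (1 - Cconj a * z)%C ^ 2 = Cmod (z - a)%C ^ 2 + (1 - Cmod a ^ 2) * (1 - Cmod z ^ 2).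
Proof. rewrite !Cmod2_alt; destruct a, z; simpl; ring. Qed.

Lemma Cmod_minus_le_1_conj (a z : C) : Cmod a <= 1 -> Cmod z <= 1 ->
  Cmod (z - a)%C <= Cmod (1 - Cconj a * z)%C.
Proof.
intros Ha Hz; assert (Pa := Cmod_ge_0 a); assert (Pz := Cmod_ge_0 z).
assert (E := Cmod_mobius_identity a z).
assert (0 <= (1 - Cmod a ^ 2) * (1 - Cmod z ^ 2)) by (apply Rmult_le_pos; nra).
apply Rsqr_incr_0; try apply Cmod_ge_0; unfold Rsqr; nra.
Qed.

Lemma Cmod_minus_sym (a b : C) : Cmod (a - b)%C = Cmod (b - a)%C.
Proof. rewrite <- Cmod_opp; f_equal; ring. Qed.

Lemma Cmod_triangle_rev (a b : C) : Cmod a - Cmod b <= Cmod (a - b)%C.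
Proof.
assert (T := Cmod_triangle (a - b)%C b); replace (a - b + b)%C with a in T by ring; lra.
Qed.

(* The point 0 is excluded because psi will be phi z / z^n, which has a junk value there; the strict
   bound s < 1 keeps the denominator away from 0 and is removed in schwarz_pick. *)
Lemma schwarz_pick_aux (psi : C -> C) (s : R) (a l : C) :
  0 <= s < 1 -> C2 (punctured 0) psi ->
  (forall z, punctured 0 z -> Cmod (psi z) <= s) ->
  punctured 0 a -> Cder psi a l ->
  Cmod l * (1 - Cmod a ^ 2) <= 1 - Cmod (psi a) ^ 2.
Proof.
intros Hs H2 Hb Pa Dl.
destruct Pa as (Da & Na & _); unfold in_disc in Da.
assert (Ba : Cmod (psi a) <= s) by (apply Hb; split; auto).
assert (Ma := proj1 (Cmod_gt_0 a) Na); assert (Mp := Cmod_ge_0 (psi a)); assert (Ml := Cmod_ge_0 l).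
set (den := fun z => (1 - Cconj (psi a) * psi z)%C).
assert (Lden : forall z, punctured 0 z -> 1 - s <= Cmod (den z)).
{ intros z Hz; unfold den.
  eapply Rle_trans; [|apply Cmod_triangle_rev]; rewrite Cmod_1, Cmod_mult, Cmod_conj.
  assert (B := Hb z Hz); assert (P := Cmod_ge_0 (psi z)); nra. }
assert (Nden : forall z, punctured 0 z -> den z <> RtoC 0).
{ intros z Hz; apply Cmod_gt_0; assert (L := Lden z Hz); lra. }
assert (Sub : forall z, punctured a z -> punctured 0 z) by (intros z (A & B & _); split; auto).
assert (Nza : forall z, z <> a -> (z - a)%C <> RtoC 0).
{ intros z Hz E; apply Hz; replace z with (z - a + a)%C by ring; rewrite E; ring. }
(* The disc automorphism centred at [psi a], evaluated at [psi z], divided by the automorphism of z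
   centred at a. Letting z tend to a in |g| <= 1 gives the estimate for l = psi' (a). *)
set (g := fun z => ((psi z - psi a) * (1 - Cconj a * z) / ((z - a) * den z))%C).
assert (Mg : forall z, punctured a z ->
   Cmod (g z) = Cmod (psi z - psi a)%C * Cmod (1 - Cconj a * z)%C / (Cmod (z - a)%C * Cmod (den z))).
{ intros z Hz; unfold g; rewrite Cmod_div, !Cmod_mult; auto.
  apply Cmult_neq_0; [apply Nza, Hz|apply Nden; auto]. }
assert (L2 : forall z, in_disc z -> Cmod (1 - Cconj a * z)%C <= 2).
{ intros z Hz; unfold in_disc in Hz; unfold Cminus.
  eapply Rle_trans; [apply Cmod_triangle|].
  rewrite Cmod_opp, Cmod_1, Cmod_mult, Cmod_conj; assert (P := Cmod_ge_0 z); nra. }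
assert (Key : forall z, punctured a z -> Cmod (g z) <= 1).
{ apply (maximum_principle a g 1).
  - unfold in_disc; auto.
  - unfold g; apply C2_div.
    + intros z Hz; apply Cmult_neq_0; [apply Nza, Hz|apply Nden; auto].
    + apply C2_mult; apply C2_minus.
      * apply (C2_sub (punctured 0)); auto.
      * exact (C2_const _ (psi a)).
      * exact (C2_const _ (RtoC 1)).
      * apply C2_mult; [exact (C2_const _ (Cconj a))|apply C2_id].
    + apply C2_mult; apply C2_minus.
      * apply C2_id.
      * exact (C2_const _ a).
      * exact (C2_const _ (RtoC 1)).
      * apply C2_mult; [exact (C2_const _ (Cconj (psi a)))|apply (C2_sub (punctured 0)); auto].
  - exists (Cmod a / 2), (4 / (Cmod a / 2 * (1 - s))); split; [lra|].
    intros z Hz Hz'; rewrite Mg by auto.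
    assert (Q := Hb z (Sub z Hz)); assert (Q2 := L2 z (proj1 Hz)).
    assert (Q3 := Lden z (Sub z Hz)).
    assert (Q4 : Cmod a / 2 <= Cmod (z - a)%C).
    { rewrite Cmod_minus_sym; eapply Rle_trans; [|apply Cmod_triangle_rev]; lra. }
    assert (Q5 : Cmod (psi z - psi a)%C <= 2).
    { unfold Cminus; eapply Rle_trans; [apply Cmod_triangle|]; rewrite Cmod_opp; lra. }
    assert (0 < Cmod a / 2 * (1 - s)) by (apply Rmult_lt_0_compat; lra).
    assert (Cmod a / 2 * (1 - s) <= Cmod (z - a)%C * Cmod (den z)) by (apply Rmult_le_compat; lra).
    assert (Cmod (psi z - psi a)%C * Cmod (1 - Cconj a * z)%C <= 2 * 2).
    { apply Rmult_le_compat; auto; apply Cmod_ge_0. }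
    apply Rmult_le_compat.
    + apply Rmult_le_pos; apply Cmod_ge_0.
    + left; apply Rinv_0_lt_compat; lra.
    + lra.
    + apply Rinv_le_contravar; auto.
  - destruct (proj1 (Cder_eps _ _ _) Dl 1 Rlt_0_1) as (d & Hd & Kd).
    exists d, ((Cmod l + 1) * 2 / (1 - s)); split; auto.
    intros z Hz Hz'; rewrite Mg by auto.
    assert (Q2 := L2 z (proj1 Hz)); assert (Q3 := Lden z (Sub z Hz)).
    specialize (Kd _ Hz'); replace (a + (z - a))%C with z in Kd by ring.
    assert (P0 : 0 < Cmod (z - a)%C) by (apply Cmod_gt_0, Nza, Hz).
    assert (Q5 : Cmod (psi z - psi a)%C <= (Cmod l + 1) * Cmod (z - a)%C).
    { replace (psi z - psi a)%C with ((psi z - psi a - l * (z - a)) + l * (z - a))%C by ring.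
      eapply Rle_trans; [apply Cmod_triangle|]; rewrite Cmod_mult; lra. }
    replace (Cmod (psi z - psi a)%C * Cmod (1 - Cconj a * z)%C / (Cmod (z - a)%C * Cmod (den z)))
      with (Cmod (psi z - psi a)%C / Cmod (z - a)%C * Cmod (1 - Cconj a * z)%C * / Cmod (den z))
      by (field; split; lra).
    assert (0 <= Cmod (psi z - psi a)%C / Cmod (z - a)%C) by (apply Rdiv_le_0_compat; [apply Cmod_ge_0|auto]).
    apply Rmult_le_compat.
    + apply Rmult_le_pos; [auto|apply Cmod_ge_0].
    + left; apply Rinv_0_lt_compat; lra.
    + apply Rmult_le_compat; auto; [apply Cmod_ge_0|]. apply Rle_div_l; auto.
    + apply Rinv_le_contravar; lra.
  (* The first bound on |z| gives |z - a| >= c. The second gives (1 - |a|^2) (1 - |z|^2) <= 2 eps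
     c^2, hence |1 - conj a z| <= (1 + eps) |z - a| by the identity above. *)
  - intros eps He; set (c := (1 - Cmod a) / 2).
    assert (Hc : 0 < c) by (unfold c; lra).
    exists (Rmax ((1 + Cmod a) / 2) (1 - eps * c ^ 2)); split.
    { apply Rmax_lub_lt; [lra|]; assert (0 < eps * c ^ 2) by (apply Rmult_lt_0_compat; [auto|apply pow_lt; auto]); lra. }
    intros z Hz Hr; rewrite Mg by auto.
    assert (H1 := Rle_lt_trans _ _ _ (Rmax_l _ _) Hr); assert (H3 := Rle_lt_trans _ _ _ (Rmax_r _ _) Hr).
    assert (Dz := proj1 Hz); unfold in_disc in Dz.
    assert (P0 : c <= Cmod (z - a)%C) by (eapply Rle_trans; [|apply Cmod_triangle_rev]; unfold c; lra).
    assert (Q3 := Lden z (Sub z Hz)).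
    assert (Q4 : Cmod (psi z - psi a)%C <= Cmod (den z)).
    { apply Cmod_minus_le_1_conj; [lra|]; assert (Q := Hb z (Sub z Hz)); lra. }
    assert (Q5 : Cmod (1 - Cconj a * z)%C <= (1 + eps) * Cmod (z - a)%C).
    { apply Rsqr_incr_0; try apply Cmod_ge_0; [|apply Rmult_le_pos; lra].
      assert (E := Cmod_mobius_identity a z); unfold Rsqr.
      assert (A1 : (1 - Cmod a ^ 2) * (1 - Cmod z ^ 2) <= 1 * (2 * (1 - Cmod z))).
      { apply Rmult_le_compat; nra. }
      assert (A2 : c ^ 2 <= Cmod (z - a)%C ^ 2) by (apply pow_incr; lra).
      assert (eps * c ^ 2 <= eps * Cmod (z - a)%C ^ 2) by (apply Rmult_le_compat_l; lra).
      assert (0 <= eps * (eps * Cmod (z - a)%C ^ 2)) by (apply Rmult_le_pos; [lra|apply Rmult_le_pos; [lra|apply pow2_ge_0]]).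
      nra. }
    apply Rle_div_l; [apply Rlt_gt, Rmult_lt_0_compat; lra|].
    replace ((1 + eps) * (Cmod (z - a)%C * Cmod (den z))) with (Cmod (den z) * ((1 + eps) * Cmod (z - a)%C)) by ring.
    apply Rmult_le_compat; auto; apply Cmod_ge_0. }
(* Instead of a limit, one point z = a + t with small real t is inserted. The errors collected on
   the way stay below (2 |l| + 3) e, which explains the choice of e. *)
apply le_epsilon; intros e0 He0.
set (e := Rmin 1 (e0 / (2 * Cmod l + 3))).
assert (Le1 : e <= 1) by apply Rmin_l.
assert (Le2 : e <= e0 / (2 * Cmod l + 3)) by apply Rmin_r.
assert (Pe : 0 < e) by (apply Rmin_glb_lt; [lra|apply Rdiv_lt_0_compat; lra]).
destruct (proj1 (Cder_eps _ _ _) Dl e Pe) as (d & Hd & Kd).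
set (t := Rmin (Rmin d e) (Rmin (1 - Cmod a) (Cmod a)) / 2).
assert (Hmin : 0 < Rmin (Rmin d e) (Rmin (1 - Cmod a) (Cmod a))) by (repeat apply Rmin_glb_lt; lra).
assert (T1 := Rle_trans _ _ _ (Rmin_l _ _) (Rmin_l d e) : Rmin (Rmin d e) (Rmin (1 - Cmod a) (Cmod a)) <= d).
assert (T2 := Rle_trans _ _ _ (Rmin_l _ _) (Rmin_r d e) : Rmin (Rmin d e) (Rmin (1 - Cmod a) (Cmod a)) <= e).
assert (T3 := Rle_trans _ _ _ (Rmin_r _ _) (Rmin_l (1 - Cmod a) (Cmod a)) : Rmin (Rmin d e) (Rmin (1 - Cmod a) (Cmod a)) <= 1 - Cmod a).
assert (T4 := Rle_trans _ _ _ (Rmin_r _ _) (Rmin_r (1 - Cmod a) (Cmod a)) : Rmin (Rmin d e) (Rmin (1 - Cmod a) (Cmod a)) <= Cmod a).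
assert (Ht : 0 < t) by (unfold t; lra).
assert (Mt : Cmod (RtoC t) = t) by (rewrite Cmod_R, Rabs_pos_eq; lra).
set (z := (a + RtoC t)%C).
assert (Eza : (z - a)%C = RtoC t) by (unfold z; ring).
assert (Pz : punctured a z).
{ split; [|split].
  - unfold in_disc, z; eapply Rle_lt_trans; [apply Cmod_triangle|]; rewrite Mt; unfold t; lra.
  - apply Cmod_gt_0; assert (T := Cmod_triangle_rev a (- RtoC t)%C).
    rewrite Cmod_opp, Mt in T; replace (a - - RtoC t)%C with z in T by (unfold z; ring).
    unfold t in T; lra.
  - intros E; rewrite E in Eza; replace (a - a)%C with (RtoC 0) in Eza by ring.
    apply RtoC_inj in Eza; lra. }
assert (G := Key z Pz); rewrite Mg in G by auto; rewrite Eza, Mt in G.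
assert (Q3 := Lden z (Sub z Pz)).
apply Rle_div_l in G; [|apply Rlt_gt, Rmult_lt_0_compat; lra].
specialize (Kd (RtoC t) ltac:(rewrite Mt; unfold t; lra)); fold z in Kd; rewrite Mt in Kd.
set (D := (psi z - psi a)%C) in *.
assert (D1 : (Cmod l - e) * t <= Cmod D).
{ assert (T := Cmod_triangle_rev (l * RtoC t)%C (- (D - l * RtoC t))%C).
  rewrite Cmod_opp, Cmod_mult, Mt in T.
  replace (l * RtoC t - - (D - l * RtoC t))%C with D in T by ring; lra. }
assert (D2 : Cmod D <= (Cmod l + e) * t).
{ replace D with ((D - l * RtoC t) + l * RtoC t)%C by ring.
  eapply Rle_trans; [apply Cmod_triangle|]; rewrite Cmod_mult, Mt; lra. }
assert (D3 : Cmod (den z) <= 1 - Cmod (psi a) ^ 2 + Cmod D).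
{ unfold den; replace (psi z) with (psi a + D)%C by (unfold D; ring).
  replace (1 - Cconj (psi a) * (psi a + D))%C with (RtoC (1 - Cmod (psi a) ^ 2) + - (Cconj (psi a) * D))%C.
  - eapply Rle_trans; [apply Cmod_triangle|]; rewrite Cmod_opp, Cmod_mult, Cmod_conj, Cmod_R.
    rewrite Rabs_pos_eq by nra.
    assert (P := Cmod_ge_0 D); nra.
  - rewrite RtoC_minus, Cmod2_conj; ring. }
assert (D4 : 1 - Cmod a ^ 2 - t <= Cmod (1 - Cconj a * z)%C).
{ unfold z; replace (1 - Cconj a * (a + RtoC t))%C with (RtoC (1 - Cmod a ^ 2) - Cconj a * RtoC t)%C.
  - eapply Rle_trans; [|apply Cmod_triangle_rev]; rewrite Cmod_mult, Cmod_conj, Mt, Cmod_R.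
    rewrite Rabs_pos_eq by nra; nra.
  - rewrite RtoC_minus, Cmod2_conj; ring. }
assert (G' : Cmod D * Cmod (1 - Cconj a * z)%C <= t * Cmod (den z)) by lra.
set (al := 1 - Cmod a ^ 2) in *; set (be := 1 - Cmod (psi a) ^ 2) in *.
assert (Hal : al <= 1) by (unfold al; assert (0 <= Cmod a ^ 2) by apply pow2_ge_0; lra).
assert (Hal0 : t < al) by (unfold al, t; nra).
assert (F1 : (Cmod l - e) * t * (al - t) <= t * Cmod (den z)).
{ destruct (Rle_dec (Cmod l - e) 0) as [Neg|Pos].
  - apply Rle_trans with 0; [|apply Rmult_le_pos; lra].
    assert (0 <= (e - Cmod l) * t * (al - t)) by (repeat apply Rmult_le_pos; lra); lra.
  - eapply Rle_trans; [|apply G']; apply Rmult_le_compat; try lra; apply Rmult_le_pos; lra. }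
assert (F2 : (Cmod l - e) * (al - t) <= Cmod (den z)).
{ apply Rmult_le_reg_l with t; auto; lra. }
assert (Tt : t <= e) by (unfold t; lra).
assert (F3 : (2 * Cmod l + 3) * e <= e0) by (apply Rle_div_r in Le2; lra).
assert (Cmod l * t <= Cmod l * e) by (apply Rmult_le_compat_l; lra).
assert (e * t <= e) by nra.
assert (e * al <= e) by nra.
assert (0 <= e * t) by nra.
lra.
Qed.

Lemma schwarz_pick (psi : C -> C) (a l : C) :
  C2 (punctured 0) psi -> (forall z, punctured 0 z -> Cmod (psi z) <= 1) ->
  punctured 0 a -> Cder psi a l ->
  Cmod l * (1 - Cmod a ^ 2) <= 1 - Cmod (psi a) ^ 2.
Proof.
intros H2 Hb Pa Dl.
assert (Ml := Cmod_ge_0 l); assert (Mp := Cmod_ge_0 (psi a)); assert (Bp := Hb a Pa).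
assert (Da := proj1 Pa); unfold in_disc in Da; assert (Ma := Cmod_ge_0 a).
set (X := Cmod l * (1 - Cmod a ^ 2)).
assert (HX : 0 <= X) by (apply Rmult_le_pos; nra).
apply le_epsilon; intros e0 He0.
(* Shrinking psi by 1 - e costs e X on the left and at most 2 e on the right, together e (X + 2). *)
set (e := Rmin (1 / 2) (e0 / (X + 2))).
assert (Le1 : e <= 1 / 2) by apply Rmin_l.
assert (Le2 : e <= e0 / (X + 2)) by apply Rmin_r.
assert (Pe : 0 < e) by (apply Rmin_glb_lt; [lra|apply Rdiv_lt_0_compat; lra]).
apply Rle_div_r in Le2; [|lra].
set (s := 1 - e).
assert (A := schwarz_pick_aux (fun z => RtoC s * psi z)%C s a (RtoC s * l)%C).
assert (Hs : Cmod (RtoC s) = s) by (rewrite Cmod_R, Rabs_pos_eq; unfold s; lra).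
rewrite !Cmod_mult, Hs in A.
assert (B : s * Cmod l * (1 - Cmod a ^ 2) <= 1 - (s * Cmod (psi a)) ^ 2).
{ apply A; auto.
  - unfold s; lra.
  - apply C2_mult; [exact (C2_const _ (RtoC s))|auto].
  - intros z Hz; rewrite Cmod_mult, Hs; assert (K := Hb z Hz); unfold s; nra.
  - now apply Cder_scal. }
replace (s * Cmod l * (1 - Cmod a ^ 2)) with (X - e * X) in B by (unfold s, X; ring).
replace ((s * Cmod (psi a)) ^ 2) with (Cmod (psi a) ^ 2 - e * (2 - e) * Cmod (psi a) ^ 2) in B by (unfold s; ring).
assert (0 <= Cmod (psi a) ^ 2 <= 1) by nra.
assert (0 <= e * (2 - e) <= 2 * e) by nra.
assert (e * (2 - e) * Cmod (psi a) ^ 2 <= 2 * e * 1) by (apply Rmult_le_compat; lra).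
lra.
Qed.

(** G is 1 + r^2 + ... + r^(2n-2), characterised without division so that r = 1 is allowed. The last
    bound is r^(2j+1) + r^(2n-2j-1) <= 1 + r^(2n) summed over j < n. *)
Lemma geometric_bounds (r : R) (n : nat) : 0 <= r <= 1 ->
  exists G, (1 - r ^ 2) * G = 1 - r ^ (2 * n) /\ 0 <= G <= INR n /\
    2 * r * G <= INR n * (1 + r ^ (2 * n)).
Proof.
intros Hr; induction n as [|n (G & E & B1 & B2)].
- exists 0; simpl; lra.
- exists (1 + r ^ 2 * G).
  replace (2 * S n)%nat with (2 + 2 * n)%nat by lia; rewrite pow_add, S_INR.
  assert (0 <= r ^ 2 <= 1) by nra.
  set (R2 := r ^ 2) in *; set (Rn := r ^ (2 * n)) in *.
  split; [|split].
  + replace Rn with (1 - (1 - R2) * G) by lra; ring.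
  + split; nra.
  + assert (R2 * (2 * r * G) <= R2 * (INR n * (1 + Rn))) by (apply Rmult_le_compat_l; lra).
    assert (E2 : R2 = r * r) by (unfold R2; ring).
    assert (0 <= (1 - r) * (1 - r)) by nra.
    assert ((1 - R2) * R2 * G <= (1 - R2) * INR n).
    { rewrite Rmult_assoc; apply Rmult_le_compat_l; nra. }
    assert (R2 * Rn = R2 - (1 - R2) * R2 * G) by (replace Rn with (1 - (1 - R2) * G) by lra; ring).
    nra.
Qed.

(** With phi = z^n psi one has z phi' = z^n (n psi + z psi'). Put x = |psi| and use Schwarz-Pick for
    psi: after division by 1 - x the claim becomes r G (1 + x) <= n (1 + x r^(2n)). This is affine
    in x, so the cases x = 0 and x = 1 suffice, and these are the two bounds of
    [geometric_bounds]. *)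
Lemma schwarz_pick_order (phi : C -> C) (n : nat) (z l : C) : (1 <= n)%nat ->
  C2 in_disc phi -> (forall z, in_disc z -> in_disc (phi z)) ->
  (exists d K, 0 < d /\ forall z, Cmod z < d -> Cmod (phi z) <= K * Cmod z ^ n) ->
  in_disc z -> z <> RtoC 0 -> Cder phi z l ->
  Cmod (phi z) <= Cmod z ^ n /\
  Cmod (z * l)%C * (1 - Cmod z ^ (2 * n)) <= INR n * Cmod z ^ n * (1 - Cmod (phi z) ^ 2).
Proof.
intros Hn H2 Hd HK Hz Nz Dl.
set (psi := fun w => (phi w / w ^ n)%C).
assert (B : forall w, punctured 0 w -> Cmod (psi w) <= 1).
{ intros w (Dw & Nw & _); now apply schwarz_order. }
assert (P : punctured 0 z) by (split; auto).
assert (C2psi : C2 (punctured 0) psi).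
{ apply C2_div.
  + intros w (_ & Nw & _); now apply Cpow_nz.
  + apply (C2_sub in_disc); auto; intros w Hw; apply Hw.
  + apply (C2_pow _ (fun w => w)), C2_id. }
destruct (C2_Cder _ _ _ C2psi P) as [m Dm].
assert (SP := schwarz_pick psi z m C2psi B P Dm).
assert (Ephi : phi z = (z ^ n * psi z)%C) by (unfold psi; field; now apply Cpow_nz).
assert (El : l = (RtoC (INR n) * z ^ (n - 1) * 1 * psi z + z ^ n * m)%C).
{ apply (Cder_unique phi z); auto.
  apply (Cder_ext_loc (fun w => w ^ n * psi w)%C _ z _ (Cmod z)); [now apply Cmod_gt_0| |].
  - intros w Hw; unfold psi; field; apply Cpow_nz; intros ->.
    replace (0 - z)%C with (- z)%C in Hw by ring; rewrite Cmod_opp in Hw; lra.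
  - apply (Cder_mult (fun w => w ^ n)%C psi); auto; apply (Cder_pow (fun w => w)), Cder_id. }
assert (Bz := B z P).
unfold in_disc in Hz; assert (Pr := Cmod_ge_0 z); assert (Px := Cmod_ge_0 (psi z)); assert (Py := Cmod_ge_0 m).
set (r := Cmod z) in *; set (x := Cmod (psi z)) in *; set (y := Cmod m) in *.
assert (Rn : 0 <= r ^ n) by now apply pow_le.
assert (Ex : Cmod (phi z) = r ^ n * x) by now rewrite Ephi, Cmod_mult, Cmod_pow.
split; [rewrite Ex; nra|].
assert (Ezl : (z * l = z ^ n * (RtoC (INR n) * psi z + z * m))%C).
{ rewrite El; destruct n as [|n]; [lia|]; replace (S n - 1)%nat with n by lia.
  rewrite Cpow_S; ring. }
assert (M : Cmod (z * l)%C <= r ^ n * (INR n * x + r * y)).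
{ rewrite Ezl, Cmod_mult, Cmod_pow; apply Rmult_le_compat_l; auto.
  eapply Rle_trans; [apply Cmod_triangle|].
  rewrite !Cmod_mult, Cmod_R, Rabs_pos_eq by apply pos_INR; unfold r, x, y; lra. }
destruct (geometric_bounds r n ltac:(lra)) as (G & EG & BG & BG2).
assert (ER : r ^ (2 * n) = r ^ n * r ^ n) by (rewrite <- pow_add; f_equal; lia).
assert (R1 : r ^ n <= 1) by (rewrite <- (pow1 n); apply pow_incr; lra).
assert (Nn := pos_INR n).
set (Rn2 := r ^ (2 * n)) in *.
assert (HR : 0 <= Rn2 <= 1) by nra.
assert (S1 : (1 - Rn2) * (r * y) <= r * G * (1 - x ^ 2)).
{ rewrite <- EG; replace ((1 - r ^ 2) * G * (r * y)) with (r * G * (y * (1 - r ^ 2))) by ring.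
  apply Rmult_le_compat_l; auto; apply Rmult_le_pos; lra. }
assert (S2 : r * G <= INR n) by nra.
assert (S3 : r * G * (1 + x) <= INR n * (1 + x * Rn2)).
{ assert ((1 - x) * (r * G) <= (1 - x) * INR n) by (apply Rmult_le_compat_l; lra).
  assert (x * (2 * r * G) <= x * (INR n * (1 + Rn2))) by (apply Rmult_le_compat_l; lra).
  lra. }
assert (S4 : r * G * (1 - x ^ 2) <= (1 - x) * (INR n * (1 + x * Rn2))).
{ replace (r * G * (1 - x ^ 2)) with ((1 - x) * (r * G * (1 + x))) by ring.
  apply Rmult_le_compat_l; lra. }
rewrite Ex.
replace (1 - (r ^ n * x) ^ 2) with (1 - Rn2 * x ^ 2) by (rewrite ER; ring).
apply Rle_trans with (r ^ n * (INR n * x + r * y) * (1 - Rn2)); [apply Rmult_le_compat_r; lra|].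
replace (INR n * r ^ n * (1 - Rn2 * x ^ 2)) with (r ^ n * (INR n * (1 - Rn2 * x ^ 2))) by ring.
rewrite Rmult_assoc; apply Rmult_le_compat_l; auto.
lra.
Qed.

(** * Functions subordinate to a power of a half-plane map *)

(** Here [D] stands for z phi' and [t] for r^n. With V = |1 - phi|, P = |1 + c phi| and s = 1 -
    |phi|^2, the first term is (1 - mu) (1 - kappa) s / V^2 and the second at least - 2 delta (1 -
    kappa) |D| / (P V). It remains to see 2 delta |D| V < (1 - mu) s P, where s cancels against the
    bound for |D|. *)
Lemma half_plane_inequality (kappa mu delta t N : R) (phi D : C) :
  0 <= kappa < 1 -> mu < 1 -> 0 <= delta -> 0 <= t < 1 -> 0 <= N -> Cmod phi <= t ->
  Cmod D * (1 - t ^ 2) <= N * t * (1 - Cmod phi ^ 2) ->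
  2 * delta * N * t < (1 - mu) * (1 - t) * (1 - (1 - 2 * kappa) * t) ->
  0 < (1 - mu) * (Re (mobius (1 - 2 * kappa) (-1) phi) - kappa)
      + delta * Re (RtoC (2 - 2 * kappa) * D
                    / ((1 + RtoC (1 - 2 * kappa) * phi) * (1 + RtoC (-1) * phi)))%C.
Proof.
intros Hk Hmu Hdel Ht HN Hphi HD HQ.
set (c := 1 - 2 * kappa) in *.
assert (Px := Cmod_ge_0 phi); set (x := Cmod phi) in *.
assert (Dphi : in_disc phi) by (unfold in_disc; fold x; lra).
assert (N1 := Re_pos_nz _ (in_disc_1p c phi ltac:(unfold c; lra) Dphi)).
assert (N2 := Re_pos_nz _ (in_disc_1p (-1) phi ltac:(lra) Dphi)).
assert (P1 := proj1 (Cmod_gt_0 _) N1); assert (P2 := proj1 (Cmod_gt_0 _) N2).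
set (P := Cmod (1 + RtoC c * phi)%C) in *; set (V := Cmod (1 + RtoC (-1) * phi)%C) in *.
set (s := 1 - x ^ 2) in *.
assert (Hs : 0 < s) by (unfold s; nra).
assert (EV : V ^ 2 = (1 - Re phi) ^ 2 + Im phi ^ 2).
{ unfold V; rewrite Cmod2_alt; unfold Re, Im; simpl; ring. }
assert (Ex : x ^ 2 = Re phi ^ 2 + Im phi ^ 2) by apply Cmod2_alt.
assert (ERe : V ^ 2 * Re (mobius c (-1) phi) = kappa * V ^ 2 + (1 - kappa) * s).
{ assert (E : (RtoC (V ^ 2) * mobius c (-1) phi = (1 + RtoC c * phi) * Cconj (1 + RtoC (-1) * phi))%C).
  { unfold mobius, V; rewrite Cmod2_conj; field; auto. }
  apply (f_equal Re) in E.
  replace (Re (RtoC (V ^ 2) * mobius c (-1) phi)%C) with (V ^ 2 * Re (mobius c (-1) phi)) in E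
    by (unfold Re, Im; simpl; ring).
  rewrite E, EV; unfold s; rewrite Ex; unfold c, Re, Im; destruct phi; simpl; ring. }
assert (ERe2 : Re (mobius c (-1) phi) - kappa = (1 - kappa) * s / V ^ 2).
{ apply Rmult_eq_reg_l with (V ^ 2); [|apply pow_nonzero; lra].
  rewrite Rmult_minus_distr_l, ERe; field; lra. }
assert (HV : V <= 1 + x).
{ unfold V; eapply Rle_trans; [apply Cmod_triangle|].
  rewrite Cmod_1, Cmod_mult, Cmod_R; fold x; rewrite Rabs_left by lra; lra. }
assert (HPV : kappa * V ^ 2 + (1 - kappa) * s <= P * V).
{ rewrite <- ERe.
  assert (E : Cmod (mobius c (-1) phi) = P / V) by (unfold mobius, P, V; now rewrite Cmod_div).
  assert (L := Rle_trans _ _ _ (Rle_abs _) (re_le_Cmod (mobius c (-1) phi))); rewrite E in L.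
  apply (Rmult_le_compat_l (V ^ 2)) in L; [|apply pow2_ge_0].
  replace (V ^ 2 * (P / V)) with (P * V) in L by (field; lra); auto. }
(* The modulus P / V of q is at least Re q = kappa + (1 - kappa) s / V^2, and s / V^2 >= (1 - t) /
   (1 + t). The resulting bound is the value of q at phi = - t. *)
assert (HP : (1 - c * t) * V <= P * (1 + t)).
{ apply Rmult_le_reg_r with V; auto.
  assert (A : V ^ 2 * (1 - t) <= (1 + t) * s).
  { unfold s; assert (V ^ 2 <= (1 + x) ^ 2) by (apply pow_incr; lra).
    assert (V ^ 2 * (1 - t) <= (1 + x) ^ 2 * (1 - t)) by (apply Rmult_le_compat_r; lra).
    assert ((1 + x) * ((1 + x) * (1 - t)) <= (1 + x) * ((1 + t) * (1 - x))) by (apply Rmult_le_compat_l; nra).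
    nra. }
  assert (B : (1 - kappa) * (V ^ 2 * (1 - t)) <= (1 - kappa) * ((1 + t) * s)) by (apply Rmult_le_compat_l; lra).
  assert (B2 : (1 + t) * (kappa * V ^ 2 + (1 - kappa) * s) <= (1 + t) * (P * V)) by (apply Rmult_le_compat_l; lra).
  unfold c; nra. }
assert (PD := Cmod_ge_0 D).
assert (Main : 2 * delta * Cmod D * V < (1 - mu) * s * P).
{ apply Rmult_lt_reg_r with (1 - t ^ 2); [nra|].
  apply Rle_lt_trans with (2 * delta * N * t * (s * V)).
  - replace (2 * delta * Cmod D * V * (1 - t ^ 2)) with (2 * delta * V * (Cmod D * (1 - t ^ 2))) by ring.
    replace (2 * delta * N * t * (s * V)) with (2 * delta * V * (N * t * s)) by ring.
    apply Rmult_le_compat_l; auto; repeat apply Rmult_le_pos; lra.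
  - apply Rlt_le_trans with ((1 - mu) * (1 - t) * (1 - c * t) * (s * V)).
    + apply Rmult_lt_compat_r; auto; now apply Rmult_lt_0_compat.
    + replace ((1 - mu) * (1 - t) * (1 - c * t) * (s * V)) with ((1 - mu) * s * (1 - t) * ((1 - c * t) * V)) by ring.
      replace ((1 - mu) * s * P * (1 - t ^ 2)) with ((1 - mu) * s * (1 - t) * (P * (1 + t))) by ring.
      apply Rmult_le_compat_l; auto; repeat apply Rmult_le_pos; lra. }
set (X := (RtoC (2 - 2 * kappa) * D / ((1 + RtoC c * phi) * (1 + RtoC (-1) * phi)))%C).
assert (MX : Cmod X = 2 * (1 - kappa) * Cmod D / (P * V)).
{ unfold X; rewrite Cmod_div, !Cmod_mult, Cmod_R, Rabs_pos_eq by (try apply Cmult_neq_0; auto; lra).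
  unfold P, V; f_equal; ring. }
assert (LX : - Cmod X <= Re X).
{ assert (L := re_le_Cmod X); apply Rabs_le_between in L; lra. }
assert (LX2 : delta * (- Cmod X) <= delta * Re X) by (apply Rmult_le_compat_l; auto).
apply Rlt_le_trans with ((1 - mu) * (Re (mobius c (-1) phi) - kappa) + delta * (- Cmod X)); [|lra].
rewrite ERe2, MX.
replace ((1 - mu) * ((1 - kappa) * s / V ^ 2) + delta * - (2 * (1 - kappa) * Cmod D / (P * V)))
  with ((1 - kappa) * ((1 - mu) * s * P - 2 * delta * Cmod D * V) / (P * V ^ 2)) by (field; lra).
apply Rdiv_lt_0_compat; [apply Rmult_lt_0_compat; lra|].
apply Rmult_lt_0_compat; [auto|apply pow_lt; auto].
Qed.

Lemma Cder_Cexp_mlog (s A B : R) (w : C -> C) (z l : C) :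
  -1 <= A <= 1 -> -1 <= B <= 1 -> in_disc (w z) -> Cder w z l ->
  Cder (fun x => Cexp (RtoC s * mlog A B (w x))%C) z
    (Cexp (RtoC s * mlog A B (w z)) * (RtoC s * (RtoC (A - B) / ((1 + RtoC A * w z) * (1 + RtoC B * w z)) * l)))%C.
Proof.
intros HA HB Dw Dl.
apply (Cder_comp Cexp (fun x => RtoC s * mlog A B (w x))%C); [apply Cder_Cexp|].
apply Cder_scal, (Cder_comp (mlog A B) w); auto; now apply Cder_mlog.
Qed.

Section Subordinate_power.

Variables (s A B : R) (w T : C -> C).
Hypothesis s_pos : 0 < s.
Hypothesis A_bound : -1 <= A <= 1.
Hypothesis B_bound : -1 <= B <= 1.
Hypothesis lt_B_A : B < A.
Hypothesis w_analytic : analytic w.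
Hypothesis w_disc : forall z, in_disc z -> in_disc (w z).
Hypothesis w_0 : w (RtoC 0) = RtoC 0.
Hypothesis T_eq : forall z, in_disc z -> T z = Cexp (RtoC s * mlog A B (w z))%C.

Lemma in_disc_near (z : C) : in_disc z ->
  exists d, 0 < d /\ forall x, Cmod (x - z)%C < d -> in_disc x.
Proof.
unfold in_disc; intros Hz; exists (1 - Cmod z); split; [lra|]; intros x Hx.
assert (H := Cmod_triangle (x - z)%C z); replace (x - z + z)%C with x in H by ring; lra.
Qed.

Lemma Cder_subordinate_power z l : in_disc z -> Cder w z l ->
  Cder T z (T z * (RtoC s * (RtoC (A - B) / ((1 + RtoC A * w z) * (1 + RtoC B * w z)) * l)))%C.
Proof.
intros Hz Dl; destruct (in_disc_near z Hz) as (d & Hd & H).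
apply (Cder_ext_loc (fun x => Cexp (RtoC s * mlog A B (w x))%C) T z _ d Hd).
- intros x Hx; symmetry; apply T_eq, H, Hx.
- rewrite T_eq by auto; apply Cder_Cexp_mlog; auto.
Qed.

(** Only one derivative of [w] is given. Solving the formula for T' for w' expresses w' through T',
    T and w, all differentiable. *)
Lemma C2_subordinator : C2 in_disc T -> C2 in_disc w.
Proof.
intros (T1 & T2 & HT).
assert (NT : forall z, in_disc z -> T z <> RtoC 0) by (intros z Hz; rewrite T_eq by auto; apply Cexp_nz).
assert (NA : forall z, in_disc z -> (1 + RtoC A * w z)%C <> RtoC 0)
  by (intros z Hz; apply Re_pos_nz, in_disc_1p; auto).
assert (NB : forall z, in_disc z -> (1 + RtoC B * w z)%C <> RtoC 0)
  by (intros z Hz; apply Re_pos_nz, in_disc_1p; auto).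
assert (Nc : RtoC s <> RtoC 0) by (intros E; apply RtoC_inj in E; lra).
assert (Nd : RtoC (A - B) <> RtoC 0) by (intros E; apply RtoC_inj in E; lra).
exists (fun z => T1 z * ((1 + RtoC A * w z) * (1 + RtoC B * w z)) / (RtoC s * RtoC (A - B) * T z))%C.
assert (D1 : forall z, in_disc z -> Cder w z (T1 z * ((1 + RtoC A * w z) * (1 + RtoC B * w z)) / (RtoC s * RtoC (A - B) * T z))%C).
{ intros z Hz; destruct (proj2 (Cder_analytic w) w_analytic z Hz) as [l Hl].
  assert (E := Cder_unique _ _ _ _ (proj1 (HT z Hz)) (Cder_subordinate_power z l Hz Hl)).
  eapply Cder_eq; [apply Hl|]; rewrite E; field; repeat split; auto. }
assert (Dw : forall a z, in_disc z -> exists l, Cder (fun x => 1 + RtoC a * w x)%C z l).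
{ intros a z Hz; eexists; apply Cder_plus; [apply (Cder_const (RtoC 1))|apply Cder_scal, D1, Hz]. }
assert (D2 : forall z, in_disc z -> exists l, Cder (fun z => T1 z * ((1 + RtoC A * w z) * (1 + RtoC B * w z)) / (RtoC s * RtoC (A - B) * T z))%C z l).
{ intros z Hz; destruct (HT z Hz) as [H1 H2]; destruct (Dw A z Hz) as [a Ha], (Dw B z Hz) as [b Hb].
  eexists; apply Cder_div.
  - repeat apply Cmult_neq_0; auto.
  - apply Cder_mult; [apply H2|apply Cder_mult; [apply Ha|apply Hb]].
  - apply Cder_scal, H1. }
destruct (choice (fun z l => in_disc z -> Cder (fun z => T1 z * ((1 + RtoC A * w z) * (1 + RtoC B * w z)) / (RtoC s * RtoC (A - B) * T z))%C z l)) as [f2 Hf2].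
{ intros z; destruct (classic (in_disc z)) as [Hz|Hz].
  - destruct (D2 z Hz) as [l Hl]; now exists l.
  - now exists (RtoC 0). }
exists f2; intros z Hz; split; auto.
Qed.

(** The map u -> exp (s [mlog] u) has the nonzero derivative s (A - B) at 0, so near 0 |w| is at
    most 2 / (s (A - B)) times |T - 1|. *)
Lemma subordinator_order n :
  (exists d K, 0 < d /\ forall z, Cmod z < d -> Cmod (T z - 1)%C <= K * Cmod z ^ n) ->
  exists d K, 0 < d /\ forall z, Cmod z < d -> Cmod (w z) <= K * Cmod z ^ n.
Proof.
intros (d & K & Hd & HK).
assert (D0 : in_disc (RtoC 0)) by (unfold in_disc; rewrite Cmod_0; lra).
set (E := fun u => Cexp (RtoC s * mlog A B u)%C).
assert (W00 : ((1 + RtoC A * 0) * (1 + RtoC B * 0) = 1)%C) by ring.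
assert (DE : Cder E (RtoC 0) (RtoC (s * (A - B)))).
{ eapply Cder_eq; [apply (Cder_Cexp_mlog s A B (fun x => x)); auto; apply Cder_id|].
  cbv beta; rewrite mlog_0; replace (RtoC s * 0)%C with (RtoC 0) by ring; rewrite Cexp_0.
  rewrite RtoC_mult, W00; field. }
assert (Pc : 0 < s * (A - B)) by (apply Rmult_lt_0_compat; lra).
destruct (proj1 (Cder_eps _ _ _) DE (s * (A - B) / 2)) as (e & He & HE); [lra|].
destruct (proj2 (Cder_analytic w) w_analytic _ D0) as [l Hl].
destruct (Cder_Ccont _ _ _ Hl e He) as (d2 & Hd2 & Cw).
exists (Rmin (Rmin d d2) 1), (2 * K / (s * (A - B))); split; [repeat apply Rmin_glb_lt; lra|].
intros z Hz.
assert (Z1 := Rlt_le_trans _ _ _ Hz (Rmin_r _ _)).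
assert (Z2 := Rlt_le_trans _ _ _ Hz (Rmin_l _ _)).
assert (Z3 := Rlt_le_trans _ _ _ Z2 (Rmin_l _ _)).
assert (Z4 := Rlt_le_trans _ _ _ Z2 (Rmin_r _ _)).
specialize (Cw z ltac:(replace (z - 0)%C with z by ring; auto)).
rewrite w_0 in Cw; replace (w z - 0)%C with (w z) in Cw by ring.
specialize (HE (w z) Cw); specialize (HK z Z3).
replace (0 + w z)%C with (w z) in HE by ring.
change (E (w z)) with (Cexp (RtoC s * mlog A B (w z))%C) in HE.
rewrite <- T_eq in HE by exact Z1.
replace (E (RtoC 0)) with (RtoC 1) in HE
  by (unfold E; rewrite mlog_0; replace (RtoC s * 0)%C with (RtoC 0) by ring; now rewrite Cexp_0).
assert (X := Cmod_triangle_rev (RtoC (s * (A - B)) * w z)%C (- (T z - 1 - RtoC (s * (A - B)) * w z))%C).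
replace (RtoC (s * (A - B)) * w z - - (T z - 1 - RtoC (s * (A - B)) * w z))%C with (T z - 1)%C in X by ring.
rewrite Cmod_opp, Cmod_mult, Cmod_R, Rabs_pos_eq in X by lra.
replace (2 * K / (s * (A - B)) * Cmod z ^ n) with (2 * (K * Cmod z ^ n) / (s * (A - B))) by (field; lra).
apply Rle_div_r; lra.
Qed.

End Subordinate_power.

(* The disc (1 + A z) / (1 + B z) lies in the half plane Re > kappa; the new subordinating function is
   phi = (1 - B) w / (2 + (1 + B) w). *)
Lemma subordinate_half_plane (A B kappa gamma : R) (F : C -> C) :
  -1 <= B -> B < A -> A <= 1 -> kappa = (1 - A) / (1 - B) ->
  subordinate F (power (mobius A B) gamma) ->
  exists phi, analytic phi /\ (forall z, in_disc z -> in_disc (phi z)) /\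
    phi (RtoC 0) = RtoC 0 /\
    forall z, in_disc z -> F z = Cexp (RtoC gamma * mlog (1 - 2 * kappa) (-1) (phi z))%C.
Proof.
intros HB HBA HA Hk (w & Dw & Hw & W0 & HF).
assert (HkA : (1 - B) * kappa = 1 - A) by (rewrite Hk; field; lra).
assert (Hk0 : 0 <= kappa < 1).
{ split; [rewrite Hk; apply Rdiv_le_0_compat; lra|rewrite Hk; apply Rlt_div_l; lra]. }
(* From |2 + (1 + B) w| >= 2 - (1 + B) = 1 - B the new function satisfies |phi| <= |w|. *)
assert (Nden : forall z, in_disc z -> (1 - B) <= Cmod (2 + RtoC (1 + B) * w z)%C).
{ intros z Hz; assert (H := Hw z Hz); unfold in_disc in H.
  assert (X := Cmod_triangle_rev 2 (- (RtoC (1 + B) * w z))%C).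
  rewrite Cmod_opp, Cmod_mult, !Cmod_R, !Rabs_pos_eq in X by lra.
  replace (2 - - (RtoC (1 + B) * w z))%C with (2 + RtoC (1 + B) * w z)%C in X by ring.
  assert (P := Cmod_ge_0 (w z)); nra. }
assert (Nz : forall z, in_disc z -> (2 + RtoC (1 + B) * w z)%C <> RtoC 0).
{ intros z Hz; apply Cmod_gt_0; assert (H := Nden z Hz); lra. }
set (phi := fun z => (RtoC (1 - B) * w z / (2 + RtoC (1 + B) * w z))%C).
assert (Dphi : analytic phi).
{ apply Cder_analytic; intros z Hz.
  destruct (proj2 (Cder_analytic w) Dw z Hz) as [l Hl].
  eexists; apply Cder_div; [auto|apply Cder_scal, Hl|].
  apply Cder_plus; [apply (Cder_const (RtoC 2))|apply Cder_scal, Hl]. }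
assert (Hphi : forall z, in_disc z -> in_disc (phi z)).
{ intros z Hz; assert (H := Hw z Hz); assert (H' := Nden z Hz); unfold in_disc in *.
  unfold phi; rewrite Cmod_div, Cmod_mult, Cmod_R, Rabs_pos_eq by (auto; lra).
  apply Rlt_div_l; [lra|]; assert (P := Cmod_ge_0 (w z)); nra. }
assert (P0 : phi (RtoC 0) = RtoC 0).
{ unfold phi; rewrite W0; replace (RtoC (1 - B) * 0)%C with (RtoC 0) by ring.
  unfold Cdiv; ring. }
assert (EM : forall z, in_disc z -> mobius A B (w z) = mobius (1 - 2 * kappa) (-1) (phi z)).
{ intros z Hz; unfold mobius.
  assert (N1 := Re_pos_nz _ (in_disc_1p B (w z) ltac:(lra) (Hw z Hz))).
  assert (N2 := Re_pos_nz _ (in_disc_1p (-1) (phi z) ltac:(lra) (Hphi z Hz))).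
  assert (N3 := Nz z Hz); rewrite RtoC_plus in N3.
  assert (E1 : ((1 + RtoC (-1) * phi z) * (2 + RtoC (1 + B) * w z) = 2 * (1 + RtoC B * w z))%C).
  { unfold phi; rewrite RtoC_minus, RtoC_plus; field; exact N3. }
  assert (E2 : ((1 + RtoC (1 - 2 * kappa) * phi z) * (2 + RtoC (1 + B) * w z) = 2 * (1 + RtoC A * w z))%C).
  { replace (RtoC A) with (RtoC (1 - (1 - B) * kappa)) by (f_equal; lra).
    unfold phi; rewrite !RtoC_minus, RtoC_plus, !RtoC_mult, !RtoC_minus; field; exact N3. }
  assert (N4 : RtoC 2 <> RtoC 0) by (intros X; apply RtoC_inj in X; lra).
  replace (1 + RtoC A * w z)%C with ((1 + RtoC (1 - 2 * kappa) * phi z) * (2 + RtoC (1 + B) * w z) / 2)%C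
    by (rewrite E2; field; auto).
  replace (1 + RtoC B * w z)%C with ((1 + RtoC (-1) * phi z) * (2 + RtoC (1 + B) * w z) / 2)%C
    by (rewrite E1; field; auto).
  field; repeat split; auto. }
exists phi; repeat split; auto.
intros z Hz; rewrite HF by auto.
assert (LAB : is_log (mobius A B) (mlog A B)).
{ apply (is_log_mobius A B (mobius A B) (fun z => z)); auto; try lra.
  apply Cder_analytic; intros x _; eexists; apply Cder_id. }
rewrite (power_log _ _ gamma _ LAB) by auto.
do 2 f_equal.
(* Equal Moebius values do not by themselves give equal powers; the two logarithms of the same
   function agree by uniqueness. *)
assert (L1 : is_log (fun z => mobius A B (w z)) (fun z => mlog A B (w z))).
{ apply is_log_mobius; auto; lra. }
assert (L2 : is_log (fun z => mobius A B (w z)) (fun z => mlog (1 - 2 * kappa) (-1) (phi z))).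
{ apply is_log_mobius; auto; lra. }
apply (log_on_unique 1 (fun z => mobius A B (w z))
  (fun z => mlog A B (w z)) (fun z => mlog (1 - 2 * kappa) (-1) (phi z))); auto; now apply is_log_log_on.
Qed.

Lemma half_plane_bound (n : nat) (kappa mu gamma b : R) (T phi : C -> C) (z l : C) :
  (1 <= n)%nat -> 0 <= kappa < 1 -> 0 < mu < 1 -> 0 < gamma -> 0 < b ->
  C2 in_disc T ->
  (exists d K, 0 < d /\ forall z, Cmod z < d -> Cmod (T z - 1)%C <= K * Cmod z ^ n) ->
  analytic phi -> (forall z, in_disc z -> in_disc (phi z)) -> phi (RtoC 0) = RtoC 0 ->
  (forall z, in_disc z -> T z = Cexp (RtoC gamma * mlog (1 - 2 * kappa) (-1) (phi z))%C) ->
  in_disc z -> z <> RtoC 0 -> Cder T z l ->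
  2 * (mu * b * gamma) * INR n * Cmod z ^ n
    < (1 - mu) * (1 - Cmod z ^ n) * (1 - (1 - 2 * kappa) * Cmod z ^ n) ->
  Re ((1 - RtoC mu) * mobius (1 - 2 * kappa) (-1) (phi z) + RtoC mu * (1 + RtoC b * (z * l) / T z))%C
    > mu + (1 - mu) * kappa.
Proof.
intros Hn Hk Hmu Hg Hb HT2 HTO Dphi Hphi P0 HT Hz Nz Dl HQ.
set (c := 1 - 2 * kappa) in *.
assert (C2phi : C2 in_disc phi).
{ apply (C2_subordinator gamma c (-1) phi T); auto; unfold c; lra. }
assert (Ord := subordinator_order gamma c (-1) phi T Hg ltac:(unfold c; lra) ltac:(lra) ltac:(unfold c; lra) Dphi P0 HT n HTO).
destruct (proj2 (Cder_analytic phi) Dphi z Hz) as [m Dm].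
destruct (schwarz_pick_order phi n z m Hn C2phi Hphi Ord Hz Nz Dm) as [S1 S2].
assert (El := Cder_unique _ _ _ _ Dl (Cder_subordinate_power gamma c (-1) phi T ltac:(unfold c; lra) ltac:(lra) Hphi HT z m Hz Dm)).
assert (NT : T z <> RtoC 0) by (rewrite HT by auto; apply Cexp_nz).
assert (N1 := Re_pos_nz _ (in_disc_1p c (phi z) ltac:(unfold c; lra) (Hphi z Hz))).
assert (N2 := Re_pos_nz _ (in_disc_1p (-1) (phi z) ltac:(lra) (Hphi z Hz))).
assert (Pz := Cmod_ge_0 z); unfold in_disc in Hz.
assert (Rn : 0 <= Cmod z ^ n) by now apply pow_le.
assert (Rn1 : Cmod z ^ n < 1).
{ destruct n as [|n']; [lia|]; simpl.
  assert (Cmod z ^ n' <= 1) by (rewrite <- (pow1 n'); apply pow_incr; lra).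
  assert (0 <= Cmod z ^ n') by now apply pow_le.
  nra. }
(* With phi' = m, the derivative of T gives b z T' / T = b gamma Y, so the weight in front of Re Y
   is delta = mu b gamma. *)
assert (K := half_plane_inequality kappa mu (mu * b * gamma) (Cmod z ^ n) (INR n) (phi z) (z * m)%C).
assert (K' := K Hk ltac:(lra) ltac:(repeat apply Rmult_le_pos; lra) (conj Rn Rn1) (pos_INR n) S1).
fold c in K'.
assert (K2 := K' ltac:(replace ((Cmod z ^ n) ^ 2) with (Cmod z ^ (2 * n)) by (rewrite Nat.mul_comm, pow_mult; reflexivity); exact S2) HQ).
set (Y := (RtoC (2 - 2 * kappa) * (z * m) / ((1 + RtoC c * phi z) * (1 + RtoC (-1) * phi z)))%C) in *.
assert (EY : (RtoC b * (z * l) / T z = RtoC (b * gamma) * Y)%C).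
{ rewrite El; unfold Y; replace (c - -1) with (2 - 2 * kappa) by (unfold c; ring).
  rewrite RtoC_mult; field; repeat split; auto. }
rewrite EY.
set (q := mobius c (-1) (phi z)) in *.
replace (Re ((1 - RtoC mu) * q + RtoC mu * (1 + RtoC (b * gamma) * Y))%C)
  with ((1 - mu) * Re q + mu + mu * b * gamma * Re Y) by (unfold Re, Im; simpl; ring).
lra.
Qed.

(** * The operator Theta *)

Section Theta_operator.

Variables (p n : nat) (alpha beta : R).
Hypothesis n_pos : (1 <= n)%nat.
Hypothesis beta_pos : 0 < beta.
Hypothesis den_pos : 0 < alpha + INR p * beta.

Definition weight (m : Z) (k : nat) : R :=
  powerRZ ((alpha + INR k * beta) / (alpha + INR p * beta)) m.

Lemma base_eq (j : nat) :
  (alpha + INR (p + j) * beta) / (alpha + INR p * beta)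
  = 1 + INR j * (beta / (alpha + INR p * beta)).
Proof. rewrite plus_INR; field; lra. Qed.

Lemma base_ge_1 (j : nat) :
  1 <= (alpha + INR (p + j) * beta) / (alpha + INR p * beta).
Proof.
rewrite base_eq; assert (0 <= INR j * (beta / (alpha + INR p * beta))); [|lra].
apply Rmult_le_pos; [apply pos_INR|apply Rdiv_le_0_compat; lra].
Qed.

Lemma weight_succ m j :
  weight (m + 1) (p + j) = weight m (p + j) * (1 + INR j * (beta / (alpha + INR p * beta))).
Proof.
unfold weight; assert (H := base_ge_1 j).
rewrite powerRZ_add by lra; rewrite powerRZ_1, base_eq; reflexivity.
Qed.

Lemma weight_opp m j : weight m (p + j) * weight (- m) (p + j) = 1.
Proof.
unfold weight; assert (H := base_ge_1 j).
rewrite <- powerRZ_add by lra; now rewrite Z.add_opp_diag_r.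
Qed.

Lemma disc_coeffs_linear_pow (s : nat -> R) (K : R) (a : nat -> C) (N : nat) :
  (forall j, Rabs (s j) <= K * INR (S j)) -> disc_coeffs a ->
  disc_coeffs (fun j => RtoC (s j ^ N) * a j)%C.
Proof.
intros Hs Ha; induction N as [|N IH].
- apply (disc_coeffs_ext a); auto; intros k; simpl; ring.
- apply disc_coeffs_le with (2 := disc_coeffs_scal (RtoC K) _ (disc_coeffs_S _ IH)).
  intros k; simpl pow; rewrite !Cmod_mult, !Cmod_R, Rabs_mult.
  replace (Rabs (s k) * Rabs (s k ^ N) * Cmod (a k)) with (Rabs (s k) * (Rabs (s k ^ N) * Cmod (a k))) by ring.
  rewrite <- (Rmult_assoc (Rabs K)); apply Rmult_le_compat_r.
  + apply Rmult_le_pos; [apply Rabs_pos|apply Cmod_ge_0].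
  + rewrite (Rabs_pos_eq (INR (S k))) by apply pos_INR.
    eapply Rle_trans; [apply Hs|]; apply Rmult_le_compat_r; [apply pos_INR|apply Rle_abs].
Qed.

(** Weights grow at most polynomially: the base grows linearly in j, its reciprocal is at most 1,
    and the sign of m decides which of the two is raised to a natural power. *)
Lemma disc_coeffs_weight m (a : nat -> C) :
  disc_coeffs a -> disc_coeffs (fun j => RtoC (weight m (p + j)) * a j)%C.
Proof.
intros Ha; set (b := beta / (alpha + INR p * beta)).
assert (Hb : 0 <= b) by (apply Rdiv_le_0_compat; lra).
assert (B1 : forall j, Rabs (1 + INR j * b) <= (1 + b) * INR (S j)).
{ intros j; assert (P := pos_INR j); rewrite S_INR, Rabs_pos_eq by nra; nra. }
assert (B2 : forall j, Rabs (/ (1 + INR j * b)) <= 1 * INR (S j)).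
{ intros j; assert (P := pos_INR j); assert (Q : 0 <= INR j * b) by nra.
  rewrite S_INR, Rabs_pos_eq by (left; apply Rinv_0_lt_compat; lra).
  assert (/ (1 + INR j * b) <= 1) by (rewrite <- Rinv_1; apply Rinv_le_contravar; lra); lra. }
destruct m as [|q|q].
- apply (disc_coeffs_ext a); auto; intros k; unfold weight; simpl; ring.
- apply (disc_coeffs_ext _ _ ) with (2 := disc_coeffs_linear_pow _ _ a (Pos.to_nat q) B1 Ha).
  intros k; unfold weight; rewrite base_eq; reflexivity.
- apply (disc_coeffs_ext _ _ ) with (2 := disc_coeffs_linear_pow _ _ a (Pos.to_nat q) B2 Ha).
  intros k; unfold weight; rewrite base_eq; simpl; fold b; now rewrite pow_inv.
Qed.

Lemma C2_PS a : disc_coeffs a -> C2 in_disc (PS a).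
Proof.
intros Ha; exists (PS (dPS a)), (PS (dPS (dPS a))); intros z Hz; split; apply Cder_PS; auto.
now apply disc_coeffs_dPS.
Qed.

(** The weight is indexed by [p + (n + j)], so that the lemmas on [weight m (p + j)] apply with
    [n + j] in place of j. *)
Definition theta_coeffs (m : Z) (f : C -> C) (j : nat) : C :=
  (RtoC (weight m (p + (n + j))) * coeff p n f (p + n + j)%nat)%C.

Definition theta_sum (m : Z) (f : C -> C) (z : C) : C :=
  (1 + z ^ n * PS (theta_coeffs m f) z)%C.

Lemma coeff_expands f : normalized p n f -> expands p n f (coeff p n f).
Proof. intros [_ H]; unfold coeff; now apply epsilon_spec. Qed.

Lemma disc_coeffs_coeff f : normalized p n f -> disc_coeffs (coeff p n f).
Proof.
intros H; apply (disc_coeffs_of_series _ (p + n)); intros x Hx.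
eexists; apply (coeff_expands f H); unfold in_disc; rewrite Cmod_R, Rabs_pos_eq; lra.
Qed.

Lemma disc_coeffs_theta m f : normalized p n f -> disc_coeffs (theta_coeffs m f).
Proof.
intros H.
assert (K := disc_coeffs_weight m (fun j => coeff p n f (p + j)%nat)).
assert (K2 := proj2 (disc_coeffs_shift n _) (K (proj2 (disc_coeffs_shift p _) (disc_coeffs_coeff f H)))).
apply (disc_coeffs_ext _ _) with (2 := K2); intros k; unfold theta_coeffs.
now rewrite Nat.add_assoc.
Qed.

Lemma Theta_eq m f z : normalized p n f -> in_disc z ->
  Theta p n m alpha beta f z = (z ^ p * theta_sum m f z)%C.
Proof.
intros Hf Hz; unfold Theta, theta_sum.
replace (z ^ p * (1 + z ^ n * PS (theta_coeffs m f) z))%C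
  with (z ^ p + z ^ (p + n) * PS (theta_coeffs m f) z)%C by (rewrite Cpow_add_r; ring).
f_equal; apply C_is_series_unique.
eapply C_is_series_ext; [|apply C_is_series_scal, PS_is_series; [apply (disc_coeffs_theta m f Hf)|apply Hz]].
intros k; unfold theta_coeffs, weight; cbv beta zeta.
rewrite (Cpow_add_r _ (p + n) k), Nat.add_assoc; ring.
Qed.

Lemma theta_sum_0 m f : theta_sum m f (RtoC 0) = RtoC 1.
Proof. unfold theta_sum; destruct n as [|n']; [lia|]; rewrite Cpow_S; ring. Qed.

Lemma Theta_quot_eq m f z : normalized p n f -> in_disc z ->
  Theta_quot p n m alpha beta f z = theta_sum m f z.
Proof.
intros Hf Hz; unfold Theta_quot, quotient; destruct (Ceq_dec z 0) as [->|Nz].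
- now rewrite theta_sum_0.
- rewrite Theta_eq by auto; field; now apply Cpow_nz.
Qed.

Lemma C2_theta_sum m f : normalized p n f -> C2 in_disc (theta_sum m f).
Proof.
intros Hf; apply C2_plus; [exact (C2_const _ (RtoC 1))|].
apply C2_mult; [apply (C2_pow _ (fun w => w)), C2_id|].
now apply C2_PS, disc_coeffs_theta.
Qed.

Lemma theta_sum_order m f : normalized p n f ->
  exists d K, 0 < d /\ forall z, Cmod z < d -> Cmod (theta_sum m f z - 1)%C <= K * Cmod z ^ n.
Proof.
intros Hf; set (a := theta_coeffs m f).
assert (Ha : disc_coeffs a) by now apply disc_coeffs_theta.
assert (D := Cder_PS a (RtoC 0) Ha ltac:(rewrite Cmod_0; lra)).
destruct (Cder_Ccont _ _ _ D 1 Rlt_0_1) as (d & Hd & H).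
exists d, (Cmod (PS a 0) + 1); split; auto; intros z Hz.
specialize (H z ltac:(replace (z - 0)%C with z by ring; auto)).
unfold theta_sum; fold a; replace (1 + z ^ n * PS a z - 1)%C with (PS a z * z ^ n)%C by ring.
rewrite Cmod_mult, Cmod_pow; apply Rmult_le_compat_r; [apply pow_le, Cmod_ge_0|].
assert (T := Cmod_triangle (PS a z - PS a 0)%C (PS a 0)).
replace (PS a z - PS a 0 + PS a 0)%C with (PS a z) in T by ring; lra.
Qed.

(** The operator 1 + b z d/dz multiplies z^(n+k) by 1 + b (n + k), the factor of [weight_succ]. This
    is where beta / (alpha + p beta) enters the polynomial of the theorem. *)
Lemma theta_sum_succ m f z l : normalized p n f -> in_disc z ->
  Cder (theta_sum m f) z l ->
  theta_sum (m + 1) f z = (theta_sum m f z + RtoC (beta / (alpha + INR p * beta)) * (z * l))%C.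
Proof.
intros Hf Hz Dl; set (a := theta_coeffs m f); set (b := beta / (alpha + INR p * beta)).
assert (Ha : disc_coeffs a) by now apply disc_coeffs_theta.
assert (El : (z * l = z ^ n * (RtoC (INR n) * PS a z + z * PS (dPS a) z))%C).
{ rewrite (Cder_unique _ _ _ (0 + (RtoC (INR n) * z ^ (n - 1) * 1 * PS a z + z ^ n * PS (dPS a) z))%C Dl).
  - destruct n as [|n']; [lia|]; replace (S n' - 1)%nat with n' by lia; rewrite Cpow_S; ring.
  - apply Cder_plus; [exact (Cder_const (RtoC 1) z)|].
    apply (Cder_mult (fun w => w ^ n)%C); [apply (Cder_pow (fun w => w)), Cder_id|now apply Cder_PS]. }
rewrite El, PS_dPS_mult by auto.
unfold theta_sum; fold a.
assert (E : PS (theta_coeffs (m + 1) f) z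
  = (PS a z + RtoC b * (RtoC (INR n) * PS a z + PS (fun k => RtoC (INR k) * a k) z))%C).
{ rewrite <- (PS_scal (RtoC (INR n))) by auto.
  assert (H1 := disc_coeffs_scal (RtoC (INR n)) a Ha); assert (H2 := disc_coeffs_INR a Ha).
  rewrite <- PS_plus by auto.
  assert (H3 := disc_coeffs_plus _ _ H1 H2).
  rewrite <- PS_scal by auto.
  rewrite <- PS_plus by (auto; now apply disc_coeffs_scal).
  apply PS_ext; intros k; unfold a, theta_coeffs.
  rewrite weight_succ; fold b; rewrite plus_INR, RtoC_mult, RtoC_plus, RtoC_mult, RtoC_plus; ring. }
rewrite E; ring.
Qed.

Lemma Theta_ratio m f z l : normalized p n f -> in_disc z -> z <> RtoC 0 ->
  theta_sum m f z <> RtoC 0 -> Cder (theta_sum m f) z l ->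
  quotient (Theta p n (m + 1) alpha beta f) (Theta p n m alpha beta f) z
  = (1 + RtoC (beta / (alpha + INR p * beta)) * (z * l) / theta_sum m f z)%C.
Proof.
intros Hf Hz Nz Nt Dl; unfold quotient; destruct (Ceq_dec z 0) as [E|_]; [easy|].
rewrite !Theta_eq, (theta_sum_succ m f z l) by auto.
field; split; auto; now apply Cpow_nz.
Qed.

Variables (m : Z) (A B kappa mu gamma rad : R).
Hypothesis A_B : -1 <= B /\ B < A /\ A <= 1.
Hypothesis kappa_eq : kappa = (1 - A) / (1 - B).
Hypothesis mu_range : 0 < mu < 1.
Hypothesis gamma_pos : 0 < gamma.
Hypothesis rad_spec : forall r, 0 < r < rad ->
  2 * (mu * (beta / (alpha + INR p * beta)) * gamma) * INR n * r ^ n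
    < (1 - mu) * (1 - r ^ n) * (1 - (1 - 2 * kappa) * r ^ n).

Lemma subordinate_bound f : normalized p n f ->
  subordinate (Theta_quot p n m alpha beta f) (power (mobius A B) gamma) ->
  bound_on p n m alpha beta mu gamma kappa f rad.
Proof.
intros Hf Hsub z Hz Hr.
destruct A_B as (HB & HBA & HA).
assert (Hk : 0 <= kappa < 1).
{ split; [rewrite kappa_eq; apply Rdiv_le_0_compat; lra|rewrite kappa_eq; apply Rlt_div_l; lra]. }
destruct (subordinate_half_plane A B kappa gamma _ HB HBA HA kappa_eq Hsub) as (phi & Dphi & Hphi & P0 & HF).
set (b := beta / (alpha + INR p * beta)) in *.
assert (Hb : 0 < b) by (apply Rdiv_lt_0_compat; lra).
assert (HT : forall z, in_disc z -> theta_sum m f z = Cexp (RtoC gamma * mlog (1 - 2 * kappa) (-1) (phi z))%C).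
{ intros x Hx; rewrite <- HF by auto; symmetry; now apply Theta_quot_eq. }
(* The exponent 1 / gamma cancels the gamma of this logarithm, so the first term of the bound is the
   half-plane map evaluated at phi. *)
assert (LT : is_log (Theta_quot p n m alpha beta f) (fun z => RtoC gamma * mlog (1 - 2 * kappa) (-1) (phi z))%C).
{ split; [|split].
  - apply Cder_analytic; intros x Hx; destruct (proj2 (Cder_analytic phi) Dphi x Hx) as [l Hl].
    eexists; apply Cder_scal, (Cder_comp (mlog _ _) phi); [apply Cder_mlog; auto; lra|apply Hl].
  - rewrite P0, mlog_0; ring.
  - intros x Hx; symmetry; auto. }
rewrite (power_log _ _ _ z LT) by auto.
replace (RtoC (1 / gamma) * (RtoC gamma * mlog (1 - 2 * kappa) (-1) (phi z)))%C
  with (mlog (1 - 2 * kappa) (-1) (phi z))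
  by (rewrite RtoC_div by lra; field; intros X; apply RtoC_inj in X; lra).
rewrite Cexp_mlog by (auto; lra).
destruct (Ceq_dec z 0) as [->|Nz].
(* At 0 both quotients are 1 by convention, and 1 > mu + (1 - mu) kappa because kappa < 1. *)
- unfold quotient; destruct (Ceq_dec 0 0) as [_|X]; [|easy].
  rewrite P0; unfold mobius.
  replace ((1 + RtoC (1 - 2 * kappa) * 0) / (1 + RtoC (-1) * 0))%C with (RtoC 1).
  + simpl; nra.
  + replace (1 + RtoC (1 - 2 * kappa) * 0)%C with (RtoC 1) by ring.
    replace (1 + RtoC (-1) * 0)%C with (RtoC 1) by ring; field.
- destruct (C2_Cder _ _ z (C2_theta_sum m f Hf) Hz) as [l Hl].
  rewrite (Theta_ratio m f z l) by (auto; rewrite HT by auto; apply Cexp_nz).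
  fold b.
  apply (half_plane_bound n kappa mu gamma b (theta_sum m f) phi z l); auto.
  + now apply C2_theta_sum.
  + now apply theta_sum_order.
  + apply rad_spec; split; auto; now apply Cmod_gt_0.
Qed.

End Theta_operator.

(** * Existence of logarithms *)

Section Logarithm.

Variable T : C -> C.
Hypothesis T_analytic : analytic T.
Hypothesis T_nz : forall z, in_disc z -> T z <> RtoC 0.
Hypothesis T_0 : T (RtoC 0) = RtoC 1.

(** Here |a - b| < |u| / 2 and |b| >= 3 |u| / 4, so a / b has distance less than 1 from 1. *)
Lemma Re_div_pos (a b u : C) : u <> RtoC 0 ->
  Cmod (a - u)%C < Cmod u / 4 -> Cmod (b - u)%C < Cmod u / 4 -> b <> RtoC 0 /\ 0 < Re (a / b)%C.
Proof.
intros Nu Ha Hb; assert (Pu := proj1 (Cmod_gt_0 u) Nu).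
assert (Lb : 3 / 4 * Cmod u <= Cmod b).
{ assert (X := Cmod_triangle_rev u (u - b)%C); rewrite (Cmod_minus_sym u b) in X.
  replace (u - (u - b))%C with b in X by ring; lra. }
assert (Nb : b <> RtoC 0) by (apply Cmod_gt_0; lra).
split; auto.
assert (Lab : Cmod (a - b)%C < Cmod u / 2).
{ replace (a - b)%C with ((a - u) + - (b - u))%C by ring.
  eapply Rle_lt_trans; [apply Cmod_triangle|]; rewrite Cmod_opp; lra. }
assert (L1 : Cmod ((a - b) / b)%C < 1).
{ rewrite Cmod_div by auto; apply Rlt_div_l; lra. }
assert (X := Rle_lt_trans _ _ _ (re_le_Cmod ((a - b) / b)%C) L1).
apply Rabs_lt_between in X.
replace (a / b)%C with (1 + (a - b) / b)%C by (field; auto).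
replace (Re (1 + (a - b) / b)%C) with (1 + Re ((a - b) / b)%C) by reflexivity.
lra.
Qed.

Lemma small_steps (r : R) : r < 1 -> exists d, 0 < d /\
  forall x y, Cmod y < r -> Cmod (x - y)%C < d -> Cmod x < 1 -> 0 < Re (T x / T y)%C.
Proof.
intros Hr.
(* The cover is of the whole square, but T is controlled only in the disc; a ball centred outside
   the closed disc of radius r is therefore chosen to miss it. The factor 2 leaves room for x next
   to y. *)
destruct (choice (fun u d => 0 < d /\ (Cmod u <= r -> forall x y,
    Cmod (x - u)%C < 2 * d -> Cmod (y - u)%C < d -> 0 < Re (T x / T y)%C)
    /\ (r < Cmod u -> forall y, Cmod (y - u)%C < d -> r < Cmod y))) as [rad Hrad].
{ intros u; destruct (Rle_lt_dec (Cmod u) r) as [Hu|Hu].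
  - assert (Du : in_disc u) by (unfold in_disc; lra).
    destruct (proj2 (Cder_analytic T) T_analytic u Du) as [l Hl].
    assert (Nu := T_nz u Du); assert (Pu := proj1 (Cmod_gt_0 _) Nu).
    destruct (Cder_Ccont _ _ _ Hl (Cmod (T u) / 4)) as (d & Hd & H); [lra|].
    exists (d / 2); split; [lra|split; [|lra]].
    intros _ x y Hx Hy; apply (Re_div_pos (T x) (T y) (T u)); auto; apply H; lra.
  - exists (Cmod u - r); split; [lra|split; [lra|]].
    intros _ y Hy; assert (X := Cmod_triangle_rev u (u - y)%C).
    rewrite (Cmod_minus_sym u y) in X; replace (u - (u - y))%C with y in X by ring; lra. }
destruct (lebesgue_number rad (fun z => proj1 (Hrad z))) as (d & Hd & K).
exists d; split; auto; intros x y Hy Hxy Hx.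
destruct (K y) as (u & _ & K1 & K2); [apply disc_unit_square; lra|].
destruct (Hrad u) as (Pu & H1 & H2).
destruct (Rle_lt_dec (Cmod u) r) as [Hu|Hu]; [|assert (X := H2 Hu y K1); lra].
apply (H1 Hu); auto.
replace (x - u)%C with ((x - y) + (y - u))%C by ring.
eapply Rle_lt_trans; [apply Cmod_triangle|lra].
Qed.

Fixpoint log_steps (h : R) (k : nat) (z : C) : C :=
  match k with
  | O => 0
  | S k => (log_steps h k z + Clog (T (RtoC (INR (S k) * h) * z) / T (RtoC (INR k * h) * z)))%C
  end.

(* The ratios T ((k + 1) h z) / T (k h z) lie in the right half plane and their product telescopes to
   T z / T 0, so their principal logarithms add up to a logarithm of T. *)
Lemma log_on_disc (r : R) : 0 < r < 1 -> exists L, log_on r T L.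
Proof.
intros Hr; destruct (small_steps r ltac:(lra)) as (d & Hd & H).
destruct (nfloor_ex (/ d)) as [N0 HN0]; [left; now apply Rinv_0_lt_compat|].
set (N := S N0); assert (PN : 0 < INR N) by (apply lt_0_INR; unfold N; lia).
set (h := / INR N).
assert (Hh : 0 < h) by now apply Rinv_0_lt_compat.
assert (Hhd : h < d).
{ rewrite <- (Rinv_inv d); apply Rinv_lt_contravar.
  - apply Rmult_lt_0_compat; auto; now apply Rinv_0_lt_compat.
  - unfold N; rewrite S_INR; lra. }
assert (HNh : INR N * h = 1) by (apply Rinv_r; lra).
assert (Sc : forall k, (k <= N)%nat -> 0 <= INR k * h <= 1).
{ intros k Hk; split; [apply Rmult_le_pos; [apply pos_INR|lra]|].
  rewrite <- HNh; apply Rmult_le_compat_r; [lra|now apply le_INR]. }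
assert (Disc : forall k z, (k <= N)%nat -> Cmod z < r -> Cmod (RtoC (INR k * h) * z)%C < r).
{ intros k z Hk Hz; eapply Rle_lt_trans; [apply Cmod_scale; auto|auto]. }
assert (Pos : forall k z, (k < N)%nat -> Cmod z < r ->
  0 < Re (T (RtoC (INR (S k) * h) * z) / T (RtoC (INR k * h) * z))%C).
{ intros k z Hk Hz; apply H.
  - apply Disc; auto; lia.
  - replace (RtoC (INR (S k) * h) * z - RtoC (INR k * h) * z)%C with (RtoC h * z)%C
      by (rewrite S_INR, !RtoC_mult, RtoC_plus; ring).
    rewrite Cmod_mult, Cmod_R, Rabs_pos_eq by lra; assert (P := Cmod_ge_0 z); nra.
  - apply Rlt_trans with r; [apply Disc; auto; lia|lra]. }
assert (Nz : forall k z, (k <= N)%nat -> Cmod z < r -> T (RtoC (INR k * h) * z)%C <> RtoC 0).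
{ intros k z Hk Hz; apply T_nz; unfold in_disc; assert (X := Disc k z Hk Hz); lra. }
assert (DT : forall k z, (k <= N)%nat -> Cmod z < r -> exists l, Cder (fun x => T (RtoC (INR k * h) * x)%C) z l).
{ intros k z Hk Hz; destruct (proj2 (Cder_analytic T) T_analytic (RtoC (INR k * h) * z)%C) as [l Hl].
  - unfold in_disc; assert (X := Disc k z Hk Hz); lra.
  - eexists; apply (Cder_comp T); [apply Hl|apply Cder_scal, Cder_id]. }
exists (log_steps h N); split; [|split].
- intros z Hz.
  assert (G : forall k, (k <= N)%nat -> exists l, Cder (log_steps h k) z l).
  { induction k as [|k IH]; intros Hk; [exists (RtoC 0); exact (Cder_const (RtoC 0) z)|].
    destruct IH as [l Hl]; [lia|].
    destruct (DT k z ltac:(lia) Hz) as [l1 H1]; destruct (DT (S k) z Hk Hz) as [l2 H2].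
    eexists; apply (Cder_plus (log_steps h k)); [apply Hl|].
    apply (Cder_comp Clog (fun x => T (RtoC (INR (S k) * h) * x) / T (RtoC (INR k * h) * x))%C).
    - apply Cder_Clog, Pos; auto.
    - apply Cder_div; [apply Nz; auto; lia|apply H2|apply H1]. }
  apply G; auto.
- assert (G : forall k, (k <= N)%nat -> log_steps h k (RtoC 0) = RtoC 0).
  { induction k as [|k IH]; intros Hk; auto; cbn [log_steps].
    rewrite IH by lia; rewrite !Cmult_0_r, T_0.
    replace (1 / 1)%C with (RtoC 1) by field; rewrite Clog_1; ring. }
  apply G; auto.
- intros z Hz.
  assert (G : forall k, (k <= N)%nat -> Cexp (log_steps h k z) = T (RtoC (INR k * h) * z)%C).
  { induction k as [|k IH]; intros Hk.
    - cbn [log_steps]; rewrite Cexp_0; replace (RtoC (INR 0 * h) * z)%C with (RtoC 0) by (rewrite Rmult_0_l; ring); auto.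
    - cbn [log_steps]; rewrite Cexp_plus, IH, Cexp_Clog by (try apply Pos; auto; lia).
      field; apply Nz; auto; lia. }
  rewrite G, HNh by auto; f_equal; ring.
Qed.

(** Each z uses the logarithm on the disc of radius (1 + |z|) / 2, and by uniqueness these agree
    where they overlap. The result gives meaning to a power of [Theta_quot] of which only the value
    is prescribed. *)
Lemma log_exists : exists L, is_log T L.
Proof.
destruct (choice (fun r L => 0 < r < 1 -> log_on r T L)) as [Lr HLr].
{ intros r; destruct (classic (0 < r < 1)) as [Hr|Hr].
  - destruct (log_on_disc r Hr) as [L HL]; now exists L.
  - exists (fun _ => RtoC 0); now intros. }
set (rho := fun z : C => (1 + Cmod z) / 2).
assert (Hrho : forall z, in_disc z -> 0 < rho z < 1 /\ Cmod z < rho z).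
{ intros z Hz; unfold in_disc in Hz; assert (P := Cmod_ge_0 z); unfold rho; lra. }
assert (Restr : forall r r' L, r' <= r -> log_on r T L -> log_on r' T L).
{ intros r r' L Hr (H1 & H2 & H3); repeat split; auto; intros z Hz; [apply H1|apply H3]; lra. }
assert (Agree : forall z r, in_disc z -> 0 < r < 1 -> Cmod z < r -> Lr (rho z) z = Lr r z).
{ intros z r Hz Hr Hzr; destruct (Hrho z Hz) as [R1 R2].
  apply (log_on_unique (Rmin r (rho z)) T).
  - apply (Restr (rho z)); [apply Rmin_r|auto].
  - apply (Restr r); [apply Rmin_l|auto].
  - now apply Rmin_glb_lt. }
exists (fun z => Lr (rho z) z); split; [|split].
- apply Cder_analytic; intros z Hz; destruct (Hrho z Hz) as [R1 R2].
  destruct (proj1 (HLr _ R1) z R2) as [l Hl]; exists l.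
  apply (Cder_ext_loc (Lr (rho z)) _ z l (rho z - Cmod z)); auto; [lra|].
  intros x Hx; assert (X : Cmod x < rho z).
  { assert (Y := Cmod_triangle (x - z)%C z); replace (x - z + z)%C with x in Y by ring; lra. }
  symmetry; apply Agree; auto; unfold in_disc; lra.
- destruct (Hrho (RtoC 0)) as [R1 R2]; [unfold in_disc; rewrite Cmod_0; lra|].
  apply (HLr _ R1).
- intros z Hz; destruct (Hrho z Hz) as [R1 R2]; now apply (HLr _ R1).
Qed.

End Logarithm.

(** * Power series of the extremal functions *)

Lemma eventually_bounded (u : nat -> R) (K : nat) (M : R) :
  (forall k, (K <= k)%nat -> u k <= M) -> exists M', forall k, u k <= M'.
Proof.
induction K as [|K IH]; intros H.
- exists M; intros k; apply H; lia.
- assert (exists M', forall k, (K <= k)%nat -> u k <= M') as [M' H'].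
  { exists (Rmax M (u K)); intros k Hk; destruct (Nat.eq_dec k K) as [->|N]; [apply Rmax_r|].
    eapply Rle_trans; [apply H; lia|apply Rmax_l]. }
  clear IH H; revert M' H'; induction K as [|K IH]; intros M' H'.
  + exists M'; intros k; apply H'; lia.
  + apply (IH (Rmax M' (u K))); intros k Hk; destruct (Nat.eq_dec k K) as [->|N]; [apply Rmax_r|].
    eapply Rle_trans; [apply H'; lia|apply Rmax_l].
Qed.

Section Mobius_power_series.

Variables (c s : R).
Hypothesis c_range : -1 < c <= 1.

(* First component: the coefficients g_k of G = ((1 + c u) / (1 - u))^s; second component: the
   coefficients of (1 + c u) G', shifted by one, in the recursion coming from
   (1 - u) (1 + c u) G' = s (1 + c) G. *)
Fixpoint mobius_power_rec (k : nat) : R * R :=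
  match k with
  | O => (1, 0)
  | S k => let (g, e) := mobius_power_rec k in
           (((e + s * (1 + c) * g) - c * INR k * g) / INR (S k), e + s * (1 + c) * g)
  end.

Definition mp_coeff (k : nat) : R := fst (mobius_power_rec k).
(** With the shift undone, this is the coefficient of u^k in (1 + c u) G'. *)
Definition mp_aux (k : nat) : R := snd (mobius_power_rec (S k)).

Lemma mp_aux_0 : mp_aux 0 = s * (1 + c).
Proof. unfold mp_aux; simpl; ring. Qed.

Lemma mp_aux_S k : mp_aux (S k) = mp_aux k + s * (1 + c) * mp_coeff (S k).
Proof.
unfold mp_aux, mp_coeff.
change (mobius_power_rec (S (S k))) with (let (g, e) := mobius_power_rec (S k) in
  (((e + s * (1 + c) * g) - c * INR (S k) * g) / INR (S (S k)), e + s * (1 + c) * g)).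
now destruct (mobius_power_rec (S k)).
Qed.

Lemma mp_coeff_S k : INR (S k) * mp_coeff (S k) = mp_aux k - c * INR k * mp_coeff k.
Proof.
unfold mp_aux, mp_coeff; cbn [mobius_power_rec]; destruct (mobius_power_rec k) as [g e].
cbn [fst snd]; field; apply not_0_INR; lia.
Qed.

(* With lam = 1 / r, the bounds k |g_k| <= X lam^k and |e_k| <= (lam - 1) X lam^k propagate as
   soon as s (1 + c) lam <= (lam - 1)^2 (k + 1). *)
Lemma disc_coeffs_mp : disc_coeffs (fun k => RtoC (mp_coeff k)).
Proof.
intros r Hr; set (lam := / r); set (eta := lam - 1).
assert (Hlam : 1 < lam) by (unfold lam; rewrite <- Rinv_1; apply Rinv_lt_contravar; lra).
assert (Heta : 0 < eta) by (unfold eta; lra).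
set (S0 := Rabs (s * (1 + c))).
assert (HS0 : 0 <= S0) by apply Rabs_pos.
destruct (nfloor_ex (S0 * lam / eta ^ 2)) as [K0 HK0].
{ apply Rdiv_le_0_compat; [nra|apply pow_lt; auto]. }
set (K := S K0).
assert (HK : forall k, (K <= k)%nat -> S0 * lam <= eta ^ 2 * INR (S k)).
{ intros k Hk; rewrite Rmult_comm with (r1 := eta ^ 2); apply (Rle_div_l (S0 * lam) (INR (S k)) (eta ^ 2)); [apply Rlt_gt, pow_lt; auto|].
  apply le_INR in Hk; unfold K in Hk; rewrite S_INR in *; lra. }
(* The sum of what the two invariants demand at the starting index K. *)
set (X := (INR K * Rabs (mp_coeff K) + Rabs (mp_aux K) / eta) / lam ^ K).
assert (Pl : forall k, 0 < lam ^ k) by (intros k; apply pow_lt; lra).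
assert (HX : 0 <= X).
{ apply Rdiv_le_0_compat; auto; apply Rplus_le_le_0_compat.
  - apply Rmult_le_pos; [apply pos_INR|apply Rabs_pos].
  - apply Rdiv_le_0_compat; [apply Rabs_pos|auto]. }
assert (Inv : forall j, INR (K + j) * Rabs (mp_coeff (K + j)) <= X * lam ^ (K + j) /\
   Rabs (mp_aux (K + j)) <= eta * X * lam ^ (K + j)).
{ induction j as [|j [I1 I2]].
  - rewrite Nat.add_0_r; unfold X.
    assert (P1 : 0 <= INR K * Rabs (mp_coeff K)) by (apply Rmult_le_pos; [apply pos_INR|apply Rabs_pos]).
    assert (P2 : 0 <= Rabs (mp_aux K)) by apply Rabs_pos.
    assert (P3 : 0 <= Rabs (mp_aux K) / eta) by (apply Rdiv_le_0_compat; auto).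
    assert (P4 := Pl K); split.
    + replace ((INR K * Rabs (mp_coeff K) + Rabs (mp_aux K) / eta) / lam ^ K * lam ^ K)
        with (INR K * Rabs (mp_coeff K) + Rabs (mp_aux K) / eta) by (field; lra); lra.
    + replace (eta * ((INR K * Rabs (mp_coeff K) + Rabs (mp_aux K) / eta) / lam ^ K) * lam ^ K)
        with (eta * (INR K * Rabs (mp_coeff K)) + Rabs (mp_aux K)) by (field; lra); nra.
  - replace (K + S j)%nat with (S (K + j)) by lia; set (k := (K + j)%nat) in *.
    assert (Pk := pos_INR k); assert (PSk : 0 < INR (S k)) by (apply lt_0_INR; lia).
    assert (A1 : INR (S k) * Rabs (mp_coeff (S k)) <= X * lam ^ S k).
    { rewrite <- (Rabs_pos_eq (INR (S k))), <- Rabs_mult, mp_coeff_S by lra.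
      unfold Rminus; eapply Rle_trans; [apply Rabs_triang|]; rewrite Rabs_Ropp, !Rabs_mult.
      rewrite (Rabs_pos_eq (INR k)) by auto.
      assert (Rabs c <= 1) by (apply Rabs_le; lra).
      assert (Rabs c * INR k * Rabs (mp_coeff k) <= 1 * (INR k * Rabs (mp_coeff k))).
      { rewrite Rmult_assoc; apply Rmult_le_compat_r; auto; apply Rmult_le_pos; auto; apply Rabs_pos. }
      change (lam ^ S k) with (lam * lam ^ k); unfold eta in I2; lra. }
    split; auto.
    rewrite mp_aux_S; eapply Rle_trans; [apply Rabs_triang|]; rewrite (Rabs_mult (s * (1 + c))); fold S0.
    assert (A2 : S0 * Rabs (mp_coeff (S k)) <= eta ^ 2 * X * lam ^ k).
    { apply Rmult_le_reg_l with (INR (S k)); auto.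
      apply Rle_trans with (S0 * (X * lam ^ S k)).
      - replace (INR (S k) * (S0 * Rabs (mp_coeff (S k)))) with (S0 * (INR (S k) * Rabs (mp_coeff (S k)))) by ring.
        now apply Rmult_le_compat_l.
      - replace (S0 * (X * lam ^ S k)) with ((S0 * lam) * (X * lam ^ k)) by (simpl; ring).
        replace (INR (S k) * (eta ^ 2 * X * lam ^ k)) with ((eta ^ 2 * INR (S k)) * (X * lam ^ k)) by ring.
        apply Rmult_le_compat_r; [apply Rmult_le_pos; auto; left; auto|].
        apply HK; unfold k; lia. }
    change (lam ^ S k) with (lam * lam ^ k).
    replace (eta ^ 2 * X * lam ^ k) with (eta * X * lam ^ k * (lam - 1)) in A2 by (unfold eta; ring).
    lra. }
apply (eventually_bounded _ K X); intros k Hk.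
replace k with (K + (k - K))%nat by lia; set (j := (k - K)%nat).
destruct (Inv j) as [I1 _]; rewrite Cmod_R.
assert (E : lam ^ (K + j) * r ^ (K + j) = 1).
{ rewrite <- Rpow_mult_distr; unfold lam; rewrite Rinv_l by lra; apply pow1. }
assert (P1 : 1 <= INR (K + j)) by (apply (le_INR 1); unfold K; lia).
assert (P2 := Rabs_pos (mp_coeff (K + j))).
assert (P3 : 0 < r ^ (K + j)) by (apply pow_lt; lra).
apply Rle_trans with (X * lam ^ (K + j) * r ^ (K + j)); [|rewrite Rmult_assoc, E; lra].
apply Rmult_le_compat_r; [lra|nra].
Qed.

(** With E = (1 + c z) G', the recursion [mp_aux_S] is the equation (1 - z) E = s (1 + c) G read
    coefficientwise. *)
Lemma PS_mp_ode z : in_disc z ->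
  ((1 + RtoC (-1) * z) * ((1 + RtoC c * z) * PS (dPS (fun k => RtoC (mp_coeff k))) z)
   = RtoC (s * (1 + c)) * PS (fun k => RtoC (mp_coeff k)) z)%C.
Proof.
intros Hz; set (g := fun k => RtoC (mp_coeff k)); assert (Hg : disc_coeffs g) by apply disc_coeffs_mp.
set (e := fun k => RtoC (mp_aux k)).
assert (Ee : forall k, (dPS g k + RtoC c * (RtoC (INR k) * g k))%C = e k).
{ intros k; unfold dPS, g, e; rewrite <- !RtoC_mult, <- RtoC_plus; f_equal; rewrite mp_coeff_S; ring. }
assert (H1 := disc_coeffs_dPS g Hg); assert (H2 := disc_coeffs_INR g Hg).
assert (H3 := disc_coeffs_scal (RtoC c) _ H2).
assert (He : disc_coeffs e) by (apply (disc_coeffs_ext _ _ Ee), disc_coeffs_plus; auto).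
assert (E1 : ((1 + RtoC c * z) * PS (dPS g) z = PS e z)%C).
{ rewrite <- (PS_ext _ _ z Ee), PS_plus, PS_scal, <- PS_dPS_mult by auto; ring. }
assert (HgS : disc_coeffs (fun k => g (S k))) by apply (disc_coeffs_shift 1 g), Hg.
assert (HeS : disc_coeffs (fun k => e (S k))) by apply (disc_coeffs_shift 1 e), He.
assert (HgS2 := disc_coeffs_scal (RtoC (s * (1 + c))) _ HgS).
assert (E2 : PS e z = (RtoC (s * (1 + c)) + z * (PS e z + RtoC (s * (1 + c)) * PS (fun k => g (S k)) z))%C).
{ rewrite (PS_decr e) at 1 by auto; f_equal; [unfold e; now rewrite mp_aux_0|].
  rewrite <- (PS_scal (RtoC (s * (1 + c)))) by auto; rewrite <- PS_plus by auto; f_equal.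
  apply PS_ext; intros k; unfold e, g; rewrite mp_aux_S, RtoC_plus, RtoC_mult; reflexivity. }
assert (E3 : PS g z = (1 + z * PS (fun k => g (S k)) z)%C) by (rewrite (PS_decr g) by auto; reflexivity).
rewrite E1, E3.
replace ((1 + RtoC (-1) * z) * PS e z)%C with (PS e z - z * PS e z)%C by (replace (RtoC (-1)) with (- RtoC 1)%C by (rewrite <- RtoC_opp; reflexivity); ring).
rewrite E2 at 1; ring.
Qed.

(** By the differential equation, G times exp (- s [mlog]) has derivative zero, and its value at 0
    is 1. *)
Lemma PS_mp z : in_disc z ->
  PS (fun k => RtoC (mp_coeff k)) z = Cexp (RtoC s * mlog c (-1) z)%C.
Proof.
intros Hz; set (g := fun k => RtoC (mp_coeff k)); assert (Hg : disc_coeffs g) by apply disc_coeffs_mp.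
set (H := fun x => (PS g x * Cexp (RtoC (- s) * mlog c (-1) x))%C).
assert (E : H z = H (RtoC 0)).
{ apply (Cder_zero_const H 1); auto; intros x Hx.
  assert (N1 := Re_pos_nz _ (in_disc_1p c x ltac:(lra) Hx)).
  assert (N2 := Re_pos_nz _ (in_disc_1p (-1) x ltac:(lra) Hx)).
  eapply Cder_eq; [apply Cder_mult; [apply Cder_PS; auto|apply (Cder_Cexp_mlog (- s) c (-1) (fun x => x)); auto; try lra; apply Cder_id]|].
  cbv beta; assert (O := PS_mp_ode x Hx); fold g in O.
  replace (PS (dPS g) x) with (RtoC (s * (1 + c)) * PS g x / ((1 + RtoC (-1) * x) * (1 + RtoC c * x)))%C
    by (rewrite <- O; field; auto).
  replace (c - -1) with (1 + c) by ring.
  rewrite RtoC_opp, RtoC_mult; field; auto. }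
unfold H in E; rewrite mlog_0 in E; replace (RtoC (- s) * 0)%C with (RtoC 0) in E by ring.
rewrite Cexp_0, PS_0 in E by auto.
change (g O) with (RtoC 1) in E.
replace (RtoC (- s) * mlog c (-1) z)%C with (- (RtoC s * mlog c (-1) z))%C in E by (rewrite RtoC_opp; ring).
rewrite Cexp_opp in E.
set (w := Cexp (RtoC s * mlog c (-1) z)%C) in *.
assert (Nw : w <> RtoC 0) by apply Cexp_nz.
replace (PS g z) with (PS g z * / w * w)%C by (field; auto).
rewrite E; ring.
Qed.

End Mobius_power_series.

Section Sparse_series.

Variables (n : nat) (g : nat -> C).
Hypothesis n_pos : (1 <= n)%nat.
Hypothesis g_coeffs : disc_coeffs g.

Definition sparse (j : nat) : C := if Nat.eqb (j mod n) 0 then g (j / n) else 0.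

Lemma sparse_mul k : sparse (n * k) = g k.
Proof.
unfold sparse; rewrite Nat.mul_comm, Nat.Div0.mod_mul, Nat.eqb_refl, Nat.div_mul by lia; reflexivity.
Qed.

Lemma sparse_gap k i : (0 < i < n)%nat -> sparse (n * k + i) = RtoC 0.
Proof.
intros Hi; unfold sparse.
replace (n * k + i)%nat with (i + k * n)%nat by lia.
rewrite Nat.Div0.mod_add, Nat.mod_small by lia.
destruct (Nat.eqb_spec i 0); [lia|reflexivity].
Qed.

Lemma disc_coeffs_sparse : disc_coeffs sparse.
Proof.
intros r Hr.
assert (Hn : 0 < r ^ n < 1).
{ split; [apply pow_lt; lra|]; apply pow_lt_1_compat; [lra|lia]. }
destruct (g_coeffs (r ^ n) Hn) as [M HM]; exists M; intros j.
assert (HM0 : 0 <= M).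
{ eapply Rle_trans; [|apply (HM O)]; apply Rmult_le_pos; [apply Cmod_ge_0|simpl; lra]. }
unfold sparse; destruct (Nat.eqb_spec (j mod n) 0) as [E|N].
- assert (Ej := Nat.div_mod_eq j n); rewrite E, Nat.add_0_r in Ej.
  rewrite Ej at 2; rewrite pow_mult; apply HM.
- rewrite Cmod_0; lra.
Qed.

(** The partial sum of the left series up to n k equals that of the right one up to k; a subsequence
    of a convergent sequence has the same limit, so no rearrangement occurs. *)
Lemma PS_sparse z : in_disc z -> PS sparse z = PS g (z ^ n)%C.
Proof.
intros Hz.
assert (Hzn : Cmod (z ^ n)%C < 1).
{ rewrite Cmod_pow; apply pow_lt_1_compat; [split; [apply Cmod_ge_0|exact Hz]|lia]. }
assert (S1 := PS_is_series sparse z disc_coeffs_sparse Hz).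
set (u := fun j => (sparse j * z ^ j)%C) in *.
set (v := fun k => (g k * (z ^ n) ^ k)%C).
assert (Gap : forall k i, (i < n)%nat -> @sum_n C_AbelianMonoid u (n * k + i) = @sum_n C_AbelianMonoid u (n * k)).
{ intros k; induction i as [|i IH]; intros Hi; [now rewrite Nat.add_0_r|].
  replace (n * k + S i)%nat with (S (n * k + i)) by lia; rewrite sum_Sn, IH by lia.
  replace (u (S (n * k + i))) with (RtoC 0).
  - apply Cplus_0_r.
  - unfold u; replace (S (n * k + i)) with (n * k + S i)%nat by lia; rewrite sparse_gap by lia; ring. }
assert (Sub : forall k, @sum_n C_AbelianMonoid u (n * k) = @sum_n C_AbelianMonoid v k).
{ induction k as [|k IH].
  - rewrite Nat.mul_0_r, !sum_O; unfold u, v; rewrite <- (sparse_mul 0), Nat.mul_0_r; simpl; ring.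
  - replace (n * S k)%nat with (S (n * k + (n - 1))) by lia.
    rewrite !sum_Sn, Gap, IH by lia; f_equal.
    unfold u, v; replace (S (n * k + (n - 1))) with (n * S k)%nat by lia.
    now rewrite sparse_mul, Cpow_mult_r. }
assert (S2 : C_is_series v (PS sparse z)).
{ unfold C_is_series, is_series.
  apply (filterlim_ext (fun k => @sum_n C_AbelianMonoid u (n * k))); [exact Sub|].
  apply (filterlim_comp _ _ _ (fun k => (n * k)%nat) (@sum_n C_AbelianMonoid u) eventually eventually).
  - intros P [N HN]; exists N; intros k Hk; apply HN; nia.
  - exact S1. }
rewrite <- (C_is_series_unique _ _ S2); reflexivity.
Qed.

End Sparse_series.

Lemma PS_vanish_0 (d : nat -> C) : disc_coeffs d ->
  (forall z, in_disc z -> z <> RtoC 0 -> PS d z = RtoC 0) -> d O = RtoC 0.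
Proof.
intros Hd H; destruct (Ceq_dec (PS d 0) 0) as [E|N]; [now rewrite <- PS_0|exfalso].
assert (D := Cder_PS d (RtoC 0) Hd ltac:(rewrite Cmod_0; lra)).
destruct (Cder_Ccont _ _ _ D (Cmod (PS d 0))) as (e & He & K); [now apply Cmod_gt_0|].
set (t := Rmin e 1 / 2).
assert (M1 := Rmin_l e 1); assert (M2 := Rmin_r e 1).
assert (M3 : 0 < Rmin e 1) by (apply Rmin_glb_lt; lra).
assert (Ht : Cmod (RtoC t) = t) by (rewrite Cmod_R, Rabs_pos_eq; unfold t; lra).
specialize (K (RtoC t)); rewrite H in K.
- replace (RtoC t - 0)%C with (RtoC t) in K by ring.
  replace (0 - PS d 0)%C with (- PS d 0)%C in K by ring; rewrite Cmod_opp, Ht in K.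
  assert (X := K ltac:(unfold t; lra)); lra.
- unfold in_disc; rewrite Ht; unfold t; lra.
- intros E; apply RtoC_inj in E; unfold t in E; lra.
Qed.

(** An identity theorem. Vanishing is asked for off 0 only, so dividing by z reproduces the
    hypothesis for the shifted coefficients and the induction goes on. *)
Lemma disc_coeffs_vanish (d : nat -> C) : disc_coeffs d ->
  (forall z, in_disc z -> z <> RtoC 0 -> PS d z = RtoC 0) -> forall k, d k = RtoC 0.
Proof.
intros Hd H k; revert d Hd H; induction k as [|k IH]; intros d Hd H; [now apply PS_vanish_0|].
apply (IH (fun j => d (S j))).
- now apply (disc_coeffs_shift 1 d).
- intros z Hz Nz; assert (E := H z Hz Nz); rewrite PS_decr, (PS_vanish_0 d) in E by auto.
  replace (PS (fun j => d (S j)) z) with ((0 + z * PS (fun j => d (S j)) z) / z)%C by (field; auto).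
  rewrite E; field; auto.
Qed.

(** * Sharpness *)

Section Extremal.

Variables (p n : nat) (alpha beta : R).
Hypothesis n_pos : (1 <= n)%nat.
Hypothesis beta_pos : 0 < beta.
Hypothesis den_pos : 0 < alpha + INR p * beta.

(** The weights are invertible, so the coefficients of f are those of b times the weights of
    exponent - m. That [coeff] picks these very coefficients follows from the identity theorem. *)
Lemma exists_with_Theta_quot (m : Z) (b : nat -> C) : disc_coeffs b ->
  exists f, normalized p n f /\
    forall z, in_disc z -> Theta_quot p n m alpha beta f z = (1 + z ^ n * PS b z)%C.
Proof.
intros Hb.
set (a := fun j => (RtoC (weight p alpha beta (- m) (p + (n + j))) * b j)%C).
assert (Ha : disc_coeffs a).
{ assert (K : disc_coeffs (fun i => b (i - n)%nat)).
  { apply (disc_coeffs_shift n); apply (disc_coeffs_ext b); auto; intros k; f_equal; lia. }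
  apply (disc_coeffs_weight p alpha beta beta_pos den_pos (- m)), (disc_coeffs_shift n) in K.
  apply (disc_coeffs_ext _ _) with (2 := K); intros k; unfold a; do 2 f_equal; lia. }
set (f := fun z => (z ^ p + z ^ (p + n) * PS a z)%C).
assert (Nf : normalized p n f).
{ split.
  - apply Cder_analytic; intros z Hz; eexists; apply Cder_plus.
    + apply (Cder_pow (fun w => w)), Cder_id.
    + apply (Cder_mult (fun w => w ^ (p + n))%C); [apply (Cder_pow (fun w => w)), Cder_id|now apply Cder_PS].
  - exists (fun k => a (k - (p + n))%nat); intros z Hz; unfold f.
    replace (z ^ p + z ^ (p + n) * PS a z - z ^ p)%C with (z ^ (p + n) * PS a z)%C by ring.
    eapply C_is_series_ext; [|apply C_is_series_scal, PS_is_series; [exact Ha|exact Hz]].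
    intros k; cbv beta; replace (p + n + k - (p + n))%nat with k by lia.
    rewrite (Cpow_add_r _ (p + n) k); ring. }
exists f; split; auto.
intros z Hz; rewrite Theta_quot_eq by auto; unfold theta_sum; do 2 f_equal.
set (a' := fun j => coeff p n f (p + n + j)%nat).
assert (Ha' : disc_coeffs a') by apply (disc_coeffs_shift (p + n)), (disc_coeffs_coeff p n f Nf).
assert (Hna := disc_coeffs_scal (- (1))%C _ Ha).
assert (E : forall j, (a' j + - (1) * a j)%C = RtoC 0).
{ apply disc_coeffs_vanish; [now apply disc_coeffs_plus|].
  intros x Hx Nx; rewrite PS_plus, PS_scal by auto.
  assert (S1 := C_is_series_unique _ _ (coeff_expands p n f Nf x Hx)).
  assert (S2 : C_is_series (fun j => coeff p n f (p + n + j)%nat * x ^ (p + n + j))%C (x ^ (p + n) * PS a' x)%C).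
  { eapply C_is_series_ext; [|apply C_is_series_scal, PS_is_series; [exact Ha'|exact Hx]].
    intros k; unfold a'; cbv beta; rewrite (Cpow_add_r _ (p + n) k); ring. }
  rewrite (C_is_series_unique _ _ S2) in S1; unfold f in S1.
  assert (Np : (x ^ (p + n))%C <> RtoC 0) by now apply Cpow_nz.
  replace (PS a' x) with (x ^ (p + n) * PS a' x / x ^ (p + n))%C by (field; auto).
  rewrite S1; field; auto. }
apply PS_ext; intros j; unfold theta_coeffs.
specialize (E j); unfold a' in E.
assert (Ea : coeff p n f (p + n + j)%nat = a j).
{ replace (coeff p n f (p + n + j)%nat) with (coeff p n f (p + n + j)%nat + - (1) * a j + a j)%C by ring.
  rewrite E; ring. }
rewrite Ea; unfold a; rewrite Cmult_assoc, <- RtoC_mult, weight_opp by auto; ring.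
Qed.

Lemma PS_gap (b : nat -> C) (N : nat) z : disc_coeffs b -> in_disc z ->
  (forall j, (0 < j <= N)%nat -> b j = RtoC 0) ->
  PS b z = (b O + z ^ S N * PS (fun j => b (S N + j)%nat) z)%C.
Proof.
intros Hb Hz; induction N as [|N IH]; intros H.
- rewrite PS_decr, Cpow_1_r by auto; reflexivity.
- rewrite IH by (intros; apply H; lia); f_equal.
  rewrite (PS_decr (fun j => b (S N + j)%nat)) by (auto; now apply (disc_coeffs_shift (S N) b)).
  rewrite Nat.add_0_r, H by lia.
  rewrite (PS_ext (fun k => b (S N + S k)%nat) (fun j => b (S (S N) + j)%nat)) by (intros k; f_equal; lia).
  rewrite (Cpow_S z (S N)); ring.
Qed.

Variables (m : Z) (kappa : R).
Hypothesis kappa_range : 0 <= kappa < 1.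

Let c := 1 - 2 * kappa.

Lemma c_range : -1 < c <= 1.
Proof. unfold c; lra. Qed.

(** The series of G(z^n) has constant term 1 and then a gap up to exponent n, hence the shape 1 +
    z^n b(z) that the operator can produce. *)
Lemma exists_mobius_power (s : R) : exists f, normalized p n f /\
  forall z, in_disc z -> Theta_quot p n m alpha beta f z = Cexp (RtoC s * mlog c (-1) (z ^ n))%C.
Proof.
set (g := fun k => RtoC (mp_coeff c s k)).
assert (Hg : disc_coeffs g) by apply (disc_coeffs_mp c s c_range).
assert (Hs : disc_coeffs (sparse n g)) by now apply disc_coeffs_sparse.
destruct (exists_with_Theta_quot m (fun j => sparse n g (n + j)%nat)) as (f & Nf & Hf).
{ now apply (disc_coeffs_shift n (sparse n g)). }
exists f; split; auto; intros z Hz; rewrite Hf by auto.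
assert (Hzn : in_disc (z ^ n)%C).
{ unfold in_disc; rewrite Cmod_pow; apply pow_lt_1_compat; [split; [apply Cmod_ge_0|exact Hz]|lia]. }
rewrite <- (PS_mp c s c_range) by auto; fold g.
rewrite <- PS_sparse by auto.
rewrite (PS_gap (sparse n g) (n - 1)) by (auto; intros j Hj; rewrite <- (sparse_gap n g n_pos 0 j) by lia; f_equal; lia).
replace (S (n - 1)) with n by lia; f_equal.
replace (sparse n g 0) with (g O) by (rewrite <- (sparse_mul n g n_pos 0); f_equal; lia); reflexivity.
Qed.

Lemma analytic_pow : analytic (fun z => z ^ n)%C.
Proof. apply Cder_analytic; intros z _; eexists; apply (Cder_pow (fun w => w)), Cder_id. Qed.

Lemma pow_in_disc z : in_disc z -> in_disc (z ^ n)%C.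
Proof.
intros Hz; unfold in_disc; rewrite Cmod_pow.
apply pow_lt_1_compat; [split; [apply Cmod_ge_0|exact Hz]|lia].
Qed.

Lemma pow_0_n : (RtoC 0 ^ n)%C = RtoC 0.
Proof. destruct n as [|n']; [lia|]; rewrite Cpow_S; ring. Qed.

Lemma is_log_scal_mlog (s : R) (T : C -> C) :
  (forall z, in_disc z -> T z = Cexp (RtoC s * mlog c (-1) (z ^ n))%C) ->
  is_log T (fun z => RtoC s * mlog c (-1) (z ^ n))%C.
Proof.
intros H; assert (Hc := c_range); split; [|split].
- apply Cder_analytic; intros z Hz; eexists.
  apply Cder_scal, (Cder_comp (mlog c (-1)) (fun z => z ^ n)%C).
  + apply Cder_mlog; [lra|lra|now apply pow_in_disc].
  + apply (Cder_pow (fun w => w)), Cder_id.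
- rewrite pow_0_n, mlog_0; ring.
- intros z Hz; symmetry; auto.
Qed.

Lemma extremal_rhs_eq gamma z : in_disc z ->
  extremal_rhs n gamma kappa z = Cexp (RtoC gamma * mlog c (-1) (z ^ n))%C.
Proof.
intros Hz; assert (Hc := c_range); unfold extremal_rhs.
apply (power_log _ (fun z => mlog c (-1) (z ^ n)%C)); auto.
apply (is_log_mobius c (-1) _ (fun z => z ^ n)%C); try lra.
- apply analytic_pow.
- apply pow_in_disc.
- apply pow_0_n.
- intros x Hx; unfold mobius.
  replace (RtoC c) with (1 - 2 * RtoC kappa)%C by (unfold c; now rewrite RtoC_minus, RtoC_mult).
  replace (RtoC (-1)) with (- RtoC 1)%C by (rewrite <- RtoC_opp; reflexivity).
  now replace (1 + - (1) * x ^ n)%C with (1 - x ^ n)%C by ring.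
Qed.

Lemma power_mobius gamma z : in_disc z ->
  power (mobius c (-1)) gamma z = Cexp (RtoC gamma * mlog c (-1) z)%C.
Proof.
intros Hz; assert (Hc := c_range).
apply (power_log _ (mlog c (-1))); auto.
apply (is_log_mobius c (-1) (mobius c (-1)) (fun z => z)); auto; try lra.
apply Cder_analytic; intros x _; eexists; apply Cder_id.
Qed.

Variables (mu gamma rad : R).
Hypothesis mu_range : 0 < mu < 1.
Hypothesis gamma_pos : 0 < gamma.
Hypothesis rad_range : 0 < rad < 1.
Hypothesis rad_root :
  (1 - mu) * (1 - rad ^ n) * (1 - c * rad ^ n)
  = 2 * (mu * (beta / (alpha + INR p * beta)) * gamma) * INR n * rad ^ n.

(* At z^n = - rad^n everything is real and equality holds for N = 1; a larger exponent N only
   decreases both terms. *)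
Lemma sharpness (N : R) f : 1 <= N -> normalized p n f ->
  (forall z, in_disc z -> Theta_quot p n m alpha beta f z = Cexp (RtoC (N * gamma) * mlog c (-1) (z ^ n))%C) ->
  forall rho, rad < rho -> ~ bound_on p n m alpha beta mu gamma kappa f rho.
Proof.
intros HN Nf Hf rho Hrho Hb; assert (Hc := c_range).
set (b := beta / (alpha + INR p * beta)) in *.
assert (Pb : 0 < b) by (apply Rdiv_lt_0_compat; lra).
assert (Pn : 0 < INR n) by (apply lt_0_INR; lia).
(* An n-th root of - rad^n, namely rad exp (i pi / n). *)
set (z := (RtoC rad * Cexp (0, (PI / INR n)%R))%C).
assert (Mz : Cmod z = rad).
{ unfold z; rewrite Cmod_mult, Cmod_R, Rabs_pos_eq, Cmod_Cexp by lra; simpl; rewrite exp_0; ring. }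
assert (Hz : in_disc z) by (unfold in_disc; lra).
assert (Nz : z <> RtoC 0) by (apply Cmod_gt_0; lra).
set (t := rad ^ n) in *.
assert (Ht : 0 < t < 1).
{ split; [apply pow_lt; lra|]; apply pow_lt_1_compat; [lra|lia]. }
assert (Zn : (z ^ n)%C = RtoC (- t)).
{ unfold z; rewrite Cpow_mult_l, <- RtoC_pow, Cexp_pow; fold t.
  replace (RtoC (INR n) * (0, (PI / INR n)%R))%C with ((0, PI) : C)
    by (apply C_eq; simpl; field; lra).
  unfold Cexp; simpl; rewrite exp_0, cos_PI, sin_PI; apply C_eq; simpl; ring. }
set (T := theta_sum p n alpha beta m f).
assert (HT : forall x, in_disc x -> T x = Cexp (RtoC (N * gamma) * mlog c (-1) (x ^ n))%C).
{ intros x Hx; rewrite <- Hf by auto; symmetry; now apply Theta_quot_eq. }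
specialize (Hb z Hz ltac:(lra)).
rewrite (power_log _ _ (1 / gamma) z (is_log_scal_mlog (N * gamma) _ Hf) Hz) in Hb.
assert (NT : T z <> RtoC 0) by (rewrite HT by auto; apply Cexp_nz).
assert (Dp := Cder_pow (fun w => w) z (RtoC 1) n (Cder_id z)); cbv beta in Dp.
assert (Dl := Cder_subordinate_power (N * gamma) c (-1) (fun x => x ^ n)%C T ltac:(lra) ltac:(lra)
  pow_in_disc HT z _ Hz Dp).
rewrite (Theta_ratio p n alpha beta n_pos beta_pos den_pos m f z _ Nf Hz Nz NT Dl) in Hb.
fold b in Hb; cbv beta in Hb.
fold T in Hb; rewrite Zn in Hb.
assert (D1 : 0 < 1 - c * t) by nra.
(* For phi = z^n one has z phi' = n z^n = - n t, so b z T' / T is the real number - b N gamma n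
   Y. *)
set (Y := 2 * (1 - kappa) * t / ((1 - c * t) * (1 + t))).
assert (EY : (RtoC b * (z * (T z * (RtoC (N * gamma) * (RtoC (c - -1) / ((1 + RtoC c * RtoC (- t)) * (1 + RtoC (-1) * RtoC (- t))) * (RtoC (INR n) * z ^ (n - 1) * 1))))) / T z
   = RtoC (- (b * N * gamma * INR n * Y)))%C).
{ replace (1 + RtoC c * RtoC (- t))%C with (RtoC (1 - c * t)) by (rewrite <- RtoC_mult, <- RtoC_plus; f_equal; ring).
  replace (1 + RtoC (-1) * RtoC (- t))%C with (RtoC (1 + t)) by (rewrite <- RtoC_mult, <- RtoC_plus; f_equal; ring).
  assert (Zs : (z * z ^ (n - 1) = RtoC (- t))%C).
  { rewrite <- Zn, <- Cpow_S; f_equal; lia. }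
  assert (C1 : RtoC (1 - c * t) <> RtoC 0) by (intros X; apply RtoC_inj in X; lra).
  assert (C2' : RtoC (1 + t) <> RtoC 0) by (intros X; apply RtoC_inj in X; lra).
  replace (RtoC b * (z * (T z * (RtoC (N * gamma) * (RtoC (c - -1) / (RtoC (1 - c * t) * RtoC (1 + t)) * (RtoC (INR n) * z ^ (n - 1) * 1))))) / T z)%C
    with (RtoC b * RtoC (N * gamma) * RtoC (c - -1) * RtoC (INR n) * (z * z ^ (n - 1)) / (RtoC (1 - c * t) * RtoC (1 + t)))%C
    by (field; repeat split; auto).
  rewrite Zs, <- !RtoC_mult, <- RtoC_div by (apply Rmult_integral_contrapositive; lra).
  f_equal; unfold Y, c; field; fold c; lra. }
rewrite EY in Hb.
set (q := (1 - c * t) / (1 + t)).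
set (E := Cexp (RtoC (1 / gamma) * (RtoC (N * gamma) * mlog c (-1) (RtoC (- t))))%C) in *.
assert (Dt : in_disc (RtoC (- t))) by (unfold in_disc; rewrite Cmod_R, Rabs_Ropp, Rabs_pos_eq; lra).
assert (Eq : exp (Re (mlog c (-1) (RtoC (- t)))) = q).
{ rewrite <- Cmod_Cexp, Cexp_mlog by (auto; lra).
  replace (mobius c (-1) (RtoC (- t))) with (RtoC q).
  - rewrite Cmod_R, Rabs_pos_eq; auto; apply Rdiv_le_0_compat; lra.
  - unfold q, mobius; rewrite RtoC_div by lra; f_equal;
      [|f_equal]; rewrite <- RtoC_mult, <- RtoC_plus; f_equal; ring. }
assert (Hq1 : q <= 1) by (unfold q; apply Rle_div_l; unfold c; nra).
assert (Hq0 : 0 < q) by (apply Rdiv_lt_0_compat; lra).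
(* |E| = q^N <= q, since N >= 1 and 0 < q <= 1. *)
assert (HE : Re E <= q).
{ eapply Rle_trans; [apply Rle_abs|]; eapply Rle_trans; [apply re_le_Cmod|].
  unfold E; rewrite Cmod_Cexp, <- Eq.
  replace (RtoC (1 / gamma) * (RtoC (N * gamma) * mlog c (-1) (RtoC (- t))))%C
    with (RtoC N * mlog c (-1) (RtoC (- t)))%C
    by (rewrite RtoC_div, RtoC_mult by lra; field; intros X; apply RtoC_inj in X; lra).
  set (L := mlog c (-1) (RtoC (- t))) in *.
  replace (Re (RtoC N * L)%C) with (N * Re L) by (simpl; unfold Re; ring).
  assert (Re L <= 0).
  { apply Rnot_lt_le; intros H; apply exp_increasing in H; rewrite exp_0 in H; lra. }
  destruct (Rle_lt_or_eq_dec (N * Re L) (Re L)) as [Lt|Eql]; [nra| |].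
  - left; now apply exp_increasing.
  - rewrite Eql; lra. }
replace (Re ((1 - RtoC mu) * E + RtoC mu * (1 + RtoC (- (b * N * gamma * INR n * Y))))%C)
  with ((1 - mu) * Re E + mu * (1 - N * (b * gamma * INR n * Y))) in Hb by (unfold Re, Im; simpl; ring).
assert (PY : 0 <= b * gamma * INR n * Y).
{ assert (0 <= Y) by (apply Rdiv_le_0_compat; [nra|apply Rmult_lt_0_compat; lra]).
  apply Rmult_le_pos; [apply Rmult_le_pos; [nra|lra]|auto]. }
assert (HNY : 1 * (b * gamma * INR n * Y) <= N * (b * gamma * INR n * Y)) by (apply Rmult_le_compat_r; auto).
(* This is the root equation times (1 - kappa) / ((1 - c t) (1 + t)): for N = 1 the functional
   equals mu + (1 - mu) kappa at z. *)
assert (Key : (1 - mu) * (q - kappa) = mu * (b * gamma * INR n * Y)).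
{ replace (q - kappa) with ((1 - kappa) * (1 - t) / (1 + t)) by (unfold q, c; field; lra).
  unfold Y.
  replace (mu * (b * gamma * INR n * (2 * (1 - kappa) * t / ((1 - c * t) * (1 + t)))))
    with ((1 - kappa) * (2 * (mu * b * gamma) * INR n * t) / ((1 - c * t) * (1 + t))) by (field; lra).
  rewrite <- rad_root; field; lra. }
nra.
Qed.

(** Both sides are raised to the n-th power. The left one becomes exp L with L a logarithm of
    [Theta_quot], which must first be known to exist. *)
Lemma extremal_root_eq f : extremal_root p n m alpha beta gamma kappa f ->
  forall z, in_disc z ->
    Theta_quot p n m alpha beta f z = Cexp (RtoC (INR n * gamma) * mlog c (-1) (z ^ n))%C.
Proof.
intros (Nf & NT & HP) z Hz; assert (Pn : 0 < INR n) by (apply lt_0_INR; lia).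
assert (ET : forall x, in_disc x -> Theta_quot p n m alpha beta f x = theta_sum p n alpha beta m f x)
  by (intros; now apply Theta_quot_eq).
destruct (log_exists (theta_sum p n alpha beta m f)) as [L HL].
- apply Cder_analytic; intros x Hx; apply (C2_Cder in_disc); auto; now apply C2_theta_sum.
- intros x Hx; rewrite <- ET; auto.
- now apply theta_sum_0.
- assert (HL' : is_log (Theta_quot p n m alpha beta f) L).
  { destruct HL as (H1 & H2 & H3); repeat split; auto; intros x Hx; rewrite ET; auto. }
  assert (E := HP z Hz); rewrite (power_log _ _ _ z HL' Hz), extremal_rhs_eq in E by auto.
  apply (f_equal (fun x => x ^ n)%C) in E; rewrite !Cexp_pow in E.
  rewrite <- (proj2 (proj2 HL') z Hz).
  replace (L z) with (RtoC (INR n) * (RtoC (1 / INR n) * L z))%C.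
  + rewrite E, RtoC_mult; f_equal; ring.
  + rewrite RtoC_div by lra; field; intros X; apply RtoC_inj in X; lra.
Qed.

Lemma extremal_root_of_eq f : normalized p n f ->
  (forall z, in_disc z ->
    Theta_quot p n m alpha beta f z = Cexp (RtoC (INR n * gamma) * mlog c (-1) (z ^ n))%C) ->
  extremal_root p n m alpha beta gamma kappa f.
Proof.
intros Nf H; assert (Pn : 0 < INR n) by (apply lt_0_INR; lia); split; [|split]; auto.
- intros z Hz; rewrite H by auto; apply Cexp_nz.
- intros z Hz; rewrite (power_log _ _ _ z (is_log_scal_mlog _ _ H) Hz), extremal_rhs_eq by auto.
  f_equal; rewrite RtoC_div, RtoC_mult by lra; field; intros X; apply RtoC_inj in X; lra.
Qed.

End Extremal.

(** * The radius and the proof of the theorem *)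

Lemma pow_lt_mono (x y : R) (n : nat) : (1 <= n)%nat -> 0 <= x < y -> x ^ n < y ^ n.
Proof.
intros Hn Hxy; destruct n as [|n]; [lia|]; clear Hn; induction n as [|n IH]; simpl in *; [lra|].
assert (0 <= x ^ n) by (apply pow_le; lra).
apply Rle_lt_trans with (y * (x * x ^ n)); [apply Rmult_le_compat_r; nra|].
apply Rmult_lt_compat_l; lra.
Qed.

(** The leading coefficient a (1 - 2 kappa) may have either sign or vanish. The root a / (h + sqrt
    D), the rationalised form of the usual formula, and the factorisation of a q cover all cases at
    once; the root is below 1 because q 1 = - 2 e < 0. *)
Lemma quadratic_smallest_root (a e kappa : R) : 0 < a -> 0 < e -> 0 <= kappa < 1 ->
  let q t := a * (1 - t) * (1 - (1 - 2 * kappa) * t) - 2 * e * t in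
  exists t0, 0 < t0 < 1 /\ q t0 = 0 /\ forall t, 0 < t < t0 -> 0 < q t.
Proof.
intros Ha He Hk q; set (h := a * (1 - kappa) + e).
assert (Hh : 0 < h) by (unfold h; nra).
set (D := h ^ 2 - a ^ 2 * (1 - 2 * kappa)).
(* From h >= a (1 - kappa) one gets D >= a^2 kappa^2. *)
assert (HD : 0 <= D).
{ assert (0 <= a * (1 - kappa)) by nra.
  assert ((a * (1 - kappa)) ^ 2 <= h ^ 2) by (apply pow_incr; unfold h; lra).
  assert (0 <= a ^ 2 * kappa ^ 2) by (apply Rmult_le_pos; apply pow2_ge_0).
  unfold D; nra. }
set (sg := sqrt D); assert (Psg : 0 <= sg) by apply sqrt_pos.
assert (Esg : sg * sg = D) by now apply sqrt_sqrt.
assert (Fac : forall t, a * q t = (a - (h + sg) * t) * (a - (h - sg) * t)).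
{ intros t; replace ((a - (h + sg) * t) * (a - (h - sg) * t)) with (a ^ 2 - 2 * a * h * t + (h ^ 2 - sg * sg) * t ^ 2) by ring.
  rewrite Esg; unfold q, D, h; ring. }
assert (H1 : a < h + sg).
{ assert (F := Fac 1); unfold q in F; apply Rnot_le_lt; intros L.
  assert (0 <= (a - (h + sg) * 1) * (a - (h - sg) * 1)) by (apply Rmult_le_pos; lra).
  assert (0 < a * e) by (apply Rmult_lt_0_compat; auto).
  lra. }
exists (a / (h + sg)); split; [|split].
- split; [apply Rdiv_lt_0_compat; lra|apply Rlt_div_l; lra].
- apply Rmult_eq_reg_l with a; [|lra]; rewrite Fac; field_simplify; [|lra..]; field; lra.
- intros t [T1 T2]; apply Rlt_div_r in T2; [|lra].
  apply Rmult_lt_reg_l with a; auto; rewrite Rmult_0_r, Fac.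
  assert (0 <= sg * t) by (apply Rmult_le_pos; lra).
  apply Rmult_lt_0_compat; lra.
Qed.

Theorem theorem4p2 :
  forall (p n : nat) (m : Z) (alpha beta A B kappa mu gamma : R),
  (1 <= p)%nat -> (1 <= n)%nat ->
  0 < beta -> 0 < alpha + INR p * beta ->
  -1 <= B -> B < A -> A <= 1 -> kappa = (1 - A) / (1 - B) ->
  0 < mu -> mu < 1 -> 0 < gamma -> gamma <= 1 ->
  exists rad : R,
    smallest_positive_root (fun r =>
      (1 - mu) * (alpha + INR p * beta) * (1 - 2 * kappa) * r ^ (2 * n)
      - 2 * ((1 - mu) * (alpha + INR p * beta) * (1 - kappa)
             + INR n * mu * beta * gamma) * r ^ n
      + (1 - mu) * (alpha + INR p * beta)) rad /\
    (forall f : C -> C,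
       class_A p n f ->
       subordinate (Theta_quot p n m alpha beta f) (power (mobius A B) gamma) ->
       bound_on p n m alpha beta mu gamma kappa f rad) /\
    (exists f : C -> C, extremal p n m alpha beta gamma kappa f) /\
    (forall f : C -> C,
       extremal p n m alpha beta gamma kappa f ->
       subordinate (Theta_quot p n m alpha beta f)
                   (power (mobius (1 - 2 * kappa) (-1)) gamma) /\
       bound_on p n m alpha beta mu gamma kappa f rad /\
       forall rho, rad < rho ->
         ~ bound_on p n m alpha beta mu gamma kappa f rho) /\
    (exists f : C -> C, extremal_root p n m alpha beta gamma kappa f) /\
    (forall f : C -> C,
       extremal_root p n m alpha beta gamma kappa f ->
       forall rho, rad < rho ->
         ~ bound_on p n m alpha beta mu gamma kappa f rho).
Proof.
intros p n m alpha beta A B kappa mu gamma Hp Hn Hbeta Hden HB HBA HA Hk Hmu0 Hmu1 Hg0 Hg1.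
assert (Hk0 : 0 <= kappa < 1).
{ split; [rewrite Hk; apply Rdiv_le_0_compat; lra|rewrite Hk; apply Rlt_div_l; lra]. }
set (b := beta / (alpha + INR p * beta)).
assert (Pb : 0 < b) by (apply Rdiv_lt_0_compat; lra).
assert (Pn : 0 < INR n) by (apply lt_0_INR; lia).
destruct (quadratic_smallest_root (1 - mu) (mu * b * gamma * INR n) kappa) as (t0 & Ht0 & Q0 & Qpos); auto.
{ lra. }
{ apply Rmult_lt_0_compat; [apply Rmult_lt_0_compat; [now apply Rmult_lt_0_compat|]|]; auto. }
set (rad := Rpower t0 (/ INR n)).
assert (Prad : 0 < rad) by apply exp_pos.
assert (Erad : rad ^ n = t0).
{ rewrite <- Rpower_pow by auto; unfold rad; rewrite Rpower_mult, Rinv_l by lra; apply Rpower_1, Ht0. }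
assert (Below : forall r, 0 < r < rad -> 0 < r ^ n < t0).
{ intros r Hr; split; [apply pow_lt; lra|rewrite <- Erad; apply pow_lt_mono; auto; lra]. }
assert (Lrad : rad < 1).
{ apply Rnot_le_lt; intros H; assert (1 <= rad ^ n) by (rewrite <- (pow1 n); apply pow_incr; lra); lra. }
assert (Spec : forall r, 0 < r < rad ->
  2 * (mu * b * gamma) * INR n * r ^ n < (1 - mu) * (1 - r ^ n) * (1 - (1 - 2 * kappa) * r ^ n)).
{ intros r Hr; assert (X := Qpos _ (Below r Hr)); cbv beta in X; lra. }
assert (Root : (1 - mu) * (1 - rad ^ n) * (1 - (1 - 2 * kappa) * rad ^ n) = 2 * (mu * b * gamma) * INR n * rad ^ n).
{ rewrite Erad; lra. }
(* Kept general in A and B because the extremal function is fed back in with 1 - 2 kappa and -1,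
   which have the same kappa. *)
assert (Bound : forall A B f, -1 <= B /\ B < A /\ A <= 1 -> kappa = (1 - A) / (1 - B) -> normalized p n f ->
  subordinate (Theta_quot p n m alpha beta f) (power (mobius A B) gamma) ->
  bound_on p n m alpha beta mu gamma kappa f rad).
{ intros A' B' f HAB Hk' Nf Hs; apply (subordinate_bound p n alpha beta Hn Hbeta Hden m A' B'); auto. }
(* The polynomial of the theorem is alpha + p beta times the gap in the estimate, so its sign
   decides the bound and its smallest root is the radius. *)
assert (Poly : forall r,
  (1 - mu) * (alpha + INR p * beta) * (1 - 2 * kappa) * r ^ (2 * n)
  - 2 * ((1 - mu) * (alpha + INR p * beta) * (1 - kappa) + INR n * mu * beta * gamma) * r ^ n
  + (1 - mu) * (alpha + INR p * beta)
  = (alpha + INR p * beta) * ((1 - mu) * (1 - r ^ n) * (1 - (1 - 2 * kappa) * r ^ n)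
      - 2 * (mu * b * gamma) * INR n * r ^ n)).
{ intros r; replace (r ^ (2 * n)) with (r ^ n * r ^ n) by (rewrite <- pow_add; f_equal; lia).
  unfold b; field; lra. }
exists rad; split; [|split; [|split; [|split; [|split]]]].
- split; [auto|split].
  + rewrite Poly, Root; ring.
  + intros s Hs Es; rewrite Poly in Es; apply Rnot_lt_le; intros Lt.
    assert (X := Spec s (conj Hs Lt)).
    apply Rmult_integral in Es; destruct Es; lra.
- intros f [Nf _]; now apply Bound.
- destruct (exists_mobius_power p n alpha beta Hn Hbeta Hden m kappa Hk0 gamma) as (f & Nf & Hf).
  exists f; split; auto; intros z Hz.
  now rewrite Hf, (extremal_rhs_eq n Hn kappa Hk0).
- intros f [Nf Hf].
  assert (Hf' : forall z, in_disc z -> Theta_quot p n m alpha beta f z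
      = Cexp (RtoC gamma * mlog (1 - 2 * kappa) (-1) (z ^ n))%C).
  { intros z Hz; rewrite Hf by auto; now apply extremal_rhs_eq. }
  assert (Hs : subordinate (Theta_quot p n m alpha beta f) (power (mobius (1 - 2 * kappa) (-1)) gamma)).
  { exists (fun z => z ^ n)%C; split; [apply analytic_pow|split; [now apply pow_in_disc|split; [now apply pow_0_n|]]].
    intros z Hz; rewrite Hf', (power_mobius kappa Hk0) by (auto; now apply pow_in_disc); reflexivity. }
  split; [auto|split].
  + apply (Bound (1 - 2 * kappa) (-1)); auto; [lra|field].
  + apply (sharpness p n alpha beta Hn Hbeta Hden m kappa Hk0 mu gamma rad) with (N := 1); auto; try lra.
    intros z Hz; now rewrite Rmult_1_l, Hf'.
- destruct (exists_mobius_power p n alpha beta Hn Hbeta Hden m kappa Hk0 (INR n * gamma)) as (f & Nf & Hf).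
  exists f; now apply extremal_root_of_eq.
- intros f Hf.
  (* The equation with exponent 1/n corresponds to the exponent n gamma, that is N = n >= 1. *)
  apply (sharpness p n alpha beta Hn Hbeta Hden m kappa Hk0 mu gamma rad) with (N := INR n); auto; try lra.
  + now apply (le_INR 1).
  + apply Hf.
  + now apply extremal_root_eq.
Qed.
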